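(* Let $N\ge 1$ and $p>1+4/N$. Set $\beta:=4/(p-1)$ and $\varphi(x):=|x|^{-\beta}$ on $\mathbb{R}^N$. Assume that $$[S(t)\varphi](x)>0\quad\text{for all }(x,t)\in\mathbb{R}^N\times(0,\infty).$$ Then there exists a constant $M_*>0$ depending only on $N$ and $p$ such that for all sufficiently small $\varepsilon>0$ there exists a global-in-time solution $u$ to the problem $$\partial_tu+(-\Delta)^2u=|u|^{p-1}u\ \text{ in }\mathbb{R}^N\times(0,\infty),\qquad u(\cdot,0)=\varepsilon\varphi\ \text{ in }\mathbb{R}^N,$$ satisfying $$u(x,t)\ge\frac{\varepsilon M_*}{|x|^\beta+t^{\beta/4}}\quad\text{for all }(x,t)\in\mathbb{R}^N\times(0,\infty).$$
   Context: $G(x,t)$ denotes the fundamental solution of $\partial_t+(-\Delta)^2$ in $\mathbb{R}^N\times(0,\infty)$: $G(x,t)=(2\pi)^{-N}\int_{\mathbb{R}^N}e^{ix\cdot\xi-t|\xi|^4}\,d\xi$; for each $t>0$, $G(\cdot,t)$ is a Schwartz function. Set $[S(t)\varphi](x):=\int_{\mathbb{R}^N}G(x-y,t)\varphi(y)\,dy$. $BC(\mathbb{R}^N)$ is the space of bounded continuous functions on $\mathbb{R}^N$. Definition of solution: let $\varphi$ be locally integrable and bounded at infinity and let $\varepsilon>0$. A function $u\in C((0,\infty);BC(\mathbb{R}^N))$ is called a global-in-time solution to the problem $$\partial_tu+(-\Delta)^2u=|u|^{p-1}u\ \text{ in }\mathbb{R}^N\times(0,\infty),\qquad u(\cdot,0)=\varepsilon\varphi\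 \text{ in }\mathbb{R}^N,$$ if $$u(x,t)=\varepsilon[S(t)\varphi](x)+\int_0^t[S(t-s)F_p(u(s))](x)\,ds\quad\text{for all }(x,t)\in\mathbb{R}^N\times(0,\infty),$$ where $F_p(\xi):=|\xi|^{p-1}\xi$ and $u(s)=u(\cdot,s)$. *)

(* Defs.v *)
From HB Require Import structures.
From mathcomp Require Import all_boot all_order all_algebra.
From mathcomp Require Import complex.
From mathcomp Require Import all_classical all_reals all_analysis.
From mathcomp Require Import measurable_realfun.

Set Implicit Arguments.
Unset Strict Implicit.
Unset Printing Implicit Defensive.

Import Order.TTheory GRing.Theory Num.Theory.
Import numFieldTopology.Exports numFieldNormedType.Exports.

Local Open Scope classical_set_scope.
Local Open Scope ring_scope.

Definition rV_display : measure_display. Proof. exact. Qed.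

Section rV_measurable.
Context {R : realType} (n : nat).

Definition rV_coord (i : 'I_n) (x : 'rV[R]_n) : R := x ord0 i.

Let rV_set0 : g_sigma_preimage rV_coord set0.
Proof. exact: sigma_algebra0. Qed.

Let rV_setC A : g_sigma_preimage rV_coord A -> g_sigma_preimage rV_coord (~` A).
Proof. exact: sigma_algebraC. Qed.

Let rV_bigcup (F : _^nat) : (forall i, g_sigma_preimage rV_coord (F i)) ->
  g_sigma_preimage rV_coord (\bigcup_i (F i)).
Proof. exact: sigma_algebra_bigcup. Qed.

(* The product sigma-algebra, which is the Borel sigma-algebra of R^n. *)
HB.instance Definition _ := @isMeasurable.Build rV_display
  'rV[R]_n (g_sigma_preimage rV_coord) rV_set0 rV_setC rV_bigcup.

Lemma measurable_rV_coord (i : 'I_n) : measurable_fun [set: 'rV[R]_n] (rV_coord i).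
Proof.
move=> _ Y mY; rewrite setTI; apply: sub_sigma_algebra => /=.
rewrite -bigcup_seq/=; exists i => /=; first by rewrite mem_index_enum.
by exists Y => //; rewrite setTI.
Qed.

Lemma measurable_fun_rVP d (T : measurableType d) (f : T -> 'rV[R]_n) :
  (forall i, measurable_fun [set: T] (rV_coord i \o f)) ->
  measurable_fun [set: T] f.
Proof.
move=> mf.
suff H : g_sigma_preimage (fun i => rV_coord i \o f) `<=` measurable.
  by move: H; rewrite g_sigma_preimage_comp => H _ A mA; apply: H; exists A.
apply: smallest_sub; first exact: sigma_algebra_measurable.
rewrite -bigcup_seq; apply: bigcup_sub => i _ A [B mB <-].
exact: mf.
Qed.

End rV_measurable.

Section lebesgue_rV.
Context {R : realType}.

Definition rV_cons (n : nat) (p : R * 'rV[R]_n) : 'rV[R]_n.+1 :=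
  row_mx (const_mx p.1 : 'rV[R]_1) p.2.

Definition rV_uncons (n : nat) (v : 'rV[R]_n.+1) : R * 'rV[R]_n :=
  (v ord0 ord0, \row_j v ord0 (lift ord0 j)).

Lemma rV_cons0 n (p : R * 'rV[R]_n) : rV_cons p ord0 ord0 = p.1.
Proof.
rewrite /rV_cons (_ : ord0 = lshift n (ord0 : 'I_1)); last exact/val_inj.
by rewrite (@row_mxEl _ 1 1 n) mxE.
Qed.

Lemma rV_consS n (p : R * 'rV[R]_n) j : rV_cons p ord0 (lift ord0 j) = p.2 ord0 j.
Proof.
rewrite /rV_cons (_ : lift ord0 j = rshift 1 j); last exact/val_inj.
by rewrite (@row_mxEr _ 1 1 n).
Qed.

Lemma rV_consK n : cancel (@rV_cons n) (@rV_uncons n).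
Proof.
move=> p; rewrite /rV_uncons rV_cons0 [RHS]surjective_pairing; congr pair.
by apply/rowP => j; rewrite mxE rV_consS.
Qed.

Lemma rV_unconsK n : cancel (@rV_uncons n) (@rV_cons n).
Proof.
move=> v; apply/rowP => i; case: (unliftP ord0 i) => [j ->|->].
  by rewrite rV_consS mxE.
by rewrite rV_cons0.
Qed.

Lemma measurable_rV_cons n : measurable_fun [set: R * 'rV[R]_n] (@rV_cons n).
Proof.
apply: measurable_fun_rVP => i; case: (unliftP ord0 i) => [j ->|->].
- rewrite (_ : _ \o _ = rV_coord j \o snd).
    by apply: measurableT_comp => //; exact: measurable_rV_coord.
  by apply/funext => p /=; exact: rV_consS.
- rewrite (_ : _ \o _ = fst)//.
  by apply/funext => p /=; exact: rV_cons0.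
Qed.

Lemma measurable_rV_uncons n : measurable_fun [set: 'rV[R]_n.+1] (@rV_uncons n).
Proof.
apply/measurable_fun_pairP; split; first exact: measurable_rV_coord.
apply: measurable_fun_rVP => i.
rewrite (_ : _ \o _ = rV_coord (lift ord0 i)); first exact: measurable_rV_coord.
by apply/funext => v /=; rewrite /rV_coord /= mxE.
Qed.

Section step.
Context (n : nat) (mu : {sigma_finite_measure set 'rV[R]_n -> \bar R}).

Definition lebesgue_rV_step : set 'rV[R]_n.+1 -> \bar R :=
  pushforward (@lebesgue_measure R \x mu)%E (@rV_cons n).

Let step0 : lebesgue_rV_step set0 = 0%E.
Proof. by rewrite /lebesgue_rV_step /pushforward preimage_set0 measure0. Qed.

Let step_ge0 A : (0 <= lebesgue_rV_step A)%E.
Proof.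
exact: (measure_ge0 (@lebesgue_measure R \x mu)%E (@rV_cons n @^-1` A)).
Qed.

Let step_sigma_additive : semi_sigma_additive lebesgue_rV_step.
Proof.
move=> F mF tF mUF.
rewrite /lebesgue_rV_step /pushforward preimage_bigcup.
have mcons A : measurable A -> measurable (@rV_cons n @^-1` A).
  by move=> mA; rewrite -[X in measurable X]setTI; exact: measurable_rV_cons.
apply: measure_semi_sigma_additive.
- by move=> k; exact: mcons.
- apply/trivIsetP => /= i j _ _ ij; rewrite -preimage_setI.
  by move/trivIsetP : tF => /(_ _ _ _ _ ij) ->//; rewrite preimage_set0.
- by rewrite -preimage_bigcup; exact: mcons.
Qed.

HB.instance Definition _ := isMeasure.Build _ _ _ lebesgue_rV_step
  step0 step_ge0 step_sigma_additive.

Let step_sigma_finite : sigma_finite setT lebesgue_rV_step.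
Proof.
have /sigma_finiteP[F [TF ndF Foo]] := sigma_finiteT (@lebesgue_measure R).
have /sigma_finiteP[G [TG ndG Goo]] := sigma_finiteT mu.
exists (fun k => @rV_uncons n @^-1` (F k `*` G k)).
  rewrite -preimage_bigcup (_ : \bigcup_k _ = setT) ?preimage_setT//.
  rewrite -setXTT TF TG predeqE => -[x y]; split.
    by move=> [k _ []/= ? ?]; split; exists k.
  move=> [/= [k _ Fkx] [l _ Gly]]; exists (maxn k l) => //; split.
  - by move: x Fkx; exact/subsetPset/ndF/leq_maxl.
  - by move: y Gly; exact/subsetPset/ndG/leq_maxr.
move=> k; have [mF muF] := Foo k; have [mG muG] := Goo k; split.
  rewrite -[X in measurable X]setTI; apply: measurable_rV_uncons => //.
  exact: measurableX.
rewrite /lebesgue_rV_step /pushforward -comp_preimage.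
rewrite (_ : _ \o _ = id); last by apply/funext => p /=; rewrite rV_consK.
by rewrite preimage_id product_measure1E// lte_mul_pinfty// ge0_fin_numE.
Qed.

HB.instance Definition _ := Measure_isSigmaFinite.Build _ _ _ lebesgue_rV_step
  step_sigma_finite.

End step.

(* N-dimensional Lebesgue measure, as the N-fold product of the Lebesgue
   measure of R; [lebesgue_rV_box] below is its usual characterization. *)
Fixpoint lebesgue_rV (n : nat) : {sigma_finite_measure set 'rV[R]_n -> \bar R} :=
  if n is m.+1 then lebesgue_rV_step (lebesgue_rV m)
  else dirac (0 : 'rV[R]_0).

Lemma lebesgue_rVS n (A : set R) (B : set 'rV[R]_n) :
  measurable A -> measurable B ->
  lebesgue_rV n.+1 (@rV_uncons n @^-1` (A `*` B)) =
  (lebesgue_measure A * lebesgue_rV n B)%E.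
Proof.
move=> mA mB; rewrite -product_measure1E//= /lebesgue_rV_step /pushforward.
rewrite -comp_preimage (_ : _ \o _ = id)//.
by apply/funext => p /=; rewrite rV_consK.
Qed.

Lemma measurable_rV_box n (A : 'I_n -> set R) : (forall i, measurable (A i)) ->
  measurable [set v : 'rV[R]_n | forall i, A i (v ord0 i)].
Proof.
move=> mA.
rewrite (_ : mkset _ = \bigcap_(i in [set: 'I_n]) (rV_coord i @^-1` A i)).
  apply: fin_bigcap_measurable => // i _; rewrite -[X in measurable X]setTI.
  exact: measurable_rV_coord.
by apply/seteqP; split=> v /= H i; [move=> _; exact: H|exact: (H i I)].
Qed.

Lemma lebesgue_rV_box n (A : 'I_n -> set R) : (forall i, measurable (A i)) ->
  lebesgue_rV n [set v : 'rV[R]_n | forall i, A i (v ord0 i)] =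
  (\prod_(i < n) lebesgue_measure (A i))%E.
Proof.
elim: n A => [|n IH] A mA.
  by rewrite big_ord0 /= diracE mem_set//= => -[].
rewrite big_ord_recl -IH; last by move=> i; exact: mA.
rewrite -lebesgue_rVS; [|exact: mA|exact: (measurable_rV_box (fun i => mA (lift ord0 i)))].
congr (lebesgue_rV _ _); apply/seteqP; split=> v /=.
  by move=> H; split => //= i; rewrite mxE; exact: H.
move=> [/= H0 HS] i; case: (unliftP ord0 i) => [j ->|->//].
by have := HS j; rewrite mxE.
Qed.

Let measurable_oppR : measurable_fun [set: R] (-%R : R -> R).
Proof. exact: (measurable_funN (@measurable_id _ R setT)). Qed.

Lemma measurable_rV_opp n : measurable_fun [set: 'rV[R]_n] (-%R).
Proof.
apply: measurable_fun_rVP => i.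
rewrite (_ : _ \o _ = -%R \o rV_coord i).
  by apply: measurableT_comp => //; exact: measurable_rV_coord.
by apply/funext => v /=; rewrite /rV_coord mxE.
Qed.

Lemma rV_consN n (p : R * 'rV[R]_n) :
  - rV_cons p = rV_cons (- p.1, - p.2) :> 'rV[R]_n.+1.
Proof.
apply/rowP => i; rewrite mxE; case: (unliftP ord0 i) => [j ->|->].
  by rewrite !rV_consS mxE.
by rewrite !rV_cons0.
Qed.

Lemma lebesgue_rVN n (A : set 'rV[R]_n) : measurable A ->
  pushforward (lebesgue_rV n) -%R A = lebesgue_rV n A.
Proof.
elim: n A => [|n IH] A mA.
  rewrite /pushforward; congr (lebesgue_rV 0 _).
  by apply/funext => v; rewrite /preimage /=; congr (A _); apply/rowP => -[].
pose opp2 (p : measurableTypeR R * 'rV[R]_n) : measurableTypeR R * 'rV[R]_n :=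
  (- (p.1 : R), - p.2).
have mopp2 : measurable_fun setT opp2.
  apply/measurable_fun_pairP; split.
    rewrite (_ : _ \o _ = (-%R : R -> R) \o fst)//.
    exact: (measurableT_comp measurable_oppR).
  rewrite (_ : _ \o _ = -%R \o snd)//.
  by apply: measurableT_comp => //; exact: measurable_rV_opp.
pose mu2 := (@lebesgue_measure R \x lebesgue_rV n)%E.
pose m' := pushforward mu2 opp2.
have m'E (B : set (measurableTypeR R)) (C : set 'rV[R]_n) :
    measurable B -> measurable C ->
    m' (B `*` C) = (lebesgue_measure B * lebesgue_rV n C)%E.
  move=> mB mC; rewrite -(IH C)// -(lebesgue_measureN mB) /pushforward.
  rewrite -product_measure1E//=.
    by rewrite -[X in measurable X]setTI; exact: measurable_oppR.
  by rewrite -[X in measurable X]setTI; exact: measurable_rV_opp.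
transitivity (m' (@rV_cons n @^-1` A)).
  congr (mu2 _); apply/funext => p; rewrite /preimage /=.
  by rewrite rV_consN.
apply/esym/product_measure_unique => //.
by rewrite -[X in measurable X]setTI; exact: measurable_rV_cons.
Qed.

Lemma Rintegral_rV_odd n (f : 'rV[R]_n -> R) : measurable_fun setT f ->
  (forall x, f (- x) = - f x) -> \int[lebesgue_rV n]_x f x = 0.
Proof.
move=> mf fN; rewrite /Rintegral integralE.
set P := (X in (X - _)%E); set Q := (X in (_ - X)%E).
suff -> : P = Q by case: Q => //= r; rewrite subrr.
rewrite /P /Q.
transitivity (\int[pushforward (lebesgue_rV n) -%R]_x
    ((fun x => (f x)%:E)^\+ x))%E.
  apply: (eq_measure_integral (pushforward (lebesgue_rV n) -%R)).
    exact: measurable_rV_opp.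
  by move=> mopp A mA _; exact/esym/lebesgue_rVN.
rewrite (ge0_integral_pushforward (@measurable_rV_opp n))//=.
- by apply: eq_integral => x _; rewrite /= funeposE funenegE /= fN EFinN.
- by apply: measurable_funepos; exact/measurable_EFinP.
Qed.

Section fourier.
Variable N : nat.
Implicit Types (x y xi : 'rV[R]_N) (t : R).

Definition dotmul x y : R := \sum_(i < N) x ord0 i * y ord0 i.

(* The norm that the library puts on ['rV[R]_N] is the sup norm. *)
Definition enorm x : R := Num.sqrt (\sum_(i < N) x ord0 i ^+ 2).

Definition expC (z : R[i]) : R[i] :=
  (expR (complex.Re z))%:C%C * (cos (complex.Im z) +i* sin (complex.Im z))%C.

Definition integralC (f : 'rV[R]_N -> R[i]) : R[i] :=
  ((\int[lebesgue_rV N]_xi complex.Re (f xi)) +i*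
   (\int[lebesgue_rV N]_xi complex.Im (f xi)))%C.

Definition heat_kernelC x t : R[i] :=
  ((2 * pi) ^- N)%:C%C *
  integralC (fun xi => expC ('i%C * (dotmul x xi)%:C%C - (t * enorm xi ^+ 4)%:C%C)).

Definition heat_kernel x t : R := complex.Re (heat_kernelC x t).

Lemma dotmulNr x y : dotmul x (- y) = - dotmul x y.
Proof.
by rewrite /dotmul -sumrN; apply: eq_bigr => i _; rewrite mxE mulrN.
Qed.

Lemma enormN x : enorm (- x) = enorm x.
Proof. by congr Num.sqrt; apply: eq_bigr => i _; rewrite mxE sqrrN. Qed.

Lemma measurable_dotmul x : measurable_fun [set: 'rV[R]_N] (dotmul x).
Proof.
apply: measurable_sum => i; apply: measurable_funM => //.
exact: measurable_rV_coord.
Qed.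

Lemma measurable_enorm : measurable_fun [set: 'rV[R]_N] enorm.
Proof.
have msqrt : measurable_fun [set: R] (Num.sqrt : R -> R).
  by apply: continuous_measurable_fun => u; exact: sqrt_continuous.
apply: (measurableT_comp msqrt).
apply: measurable_sum => i; apply: measurable_funX.
exact: measurable_rV_coord.
Qed.

Lemma heat_kernelC_real x t : heat_kernelC x t = (heat_kernel x t)%:C%C.
Proof.
rewrite /heat_kernel /heat_kernelC.
set f := (f in integralC f); rewrite /integralC.
have -> : \int[lebesgue_rV N]_xi complex.Im (f xi) = 0.
  have fE xi : complex.Im (f xi) =
      expR (- (t * enorm xi ^+ 4)) * sin (dotmul x xi).
    rewrite /f /expC /=.
    by rewrite !(mul0r, mul1r, mulr0, addr0, subr0, sub0r, oppr0, add0r).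
  apply: Rintegral_rV_odd; last first.
    by move=> xi; rewrite !fE enormN dotmulNr sinN mulrN.
  rewrite (funext fE); apply: measurable_funM.
    apply: measurableT_comp => //; apply: measurableT_comp => //.
    apply: measurable_funM => //; apply: measurable_funX.
    exact: measurable_enorm.
  have msin : measurable_fun [set: R] (sin : R -> R).
    by apply: continuous_measurable_fun => u; exact: continuous_sin.
  exact: (measurableT_comp msin (measurable_dotmul x)).
by rewrite /real_complex_def /=; simpc.
Qed.

Definition semigroup t (phi : 'rV[R]_N -> R) x : R :=
  \int[lebesgue_rV N]_y (heat_kernel (x - y) t * phi y).

Definition power_nonlinearity (p z : R) : R := `|z| `^ (p - 1) * z.

Definition BC : set ('rV[R]_N -> R) := [set f | continuous f /\ bounded_fun f].

(* [u t] stands for u(.,t), and the values of [u] at t <= 0 are irrelevant.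
   The topology of {uniform _ -> _} induces on BC(R^N) that of its sup norm.
   Since an integral that does not converge has value 0 in the library, the
   convergence of the Duhamel integral is stated separately; the spatial
   integrals converge as soon as phi is locally integrable and bounded at
   infinity. *)
Definition global_solution (p eps : R) (phi : 'rV[R]_N -> R)
    (u : R -> 'rV[R]_N -> R) : Prop :=
  [/\ forall t, 0 < t -> BC (u t),
      {within `]0, +oo[, continuous (u : R -> {uniform 'rV[R]_N -> R})},
      forall x t, 0 < t ->
        (@lebesgue_measure R).-integrable `]0, t[
          (fun s => (semigroup (t - s) (power_nonlinearity p \o u s) x)%:E)
    & forall x t, 0 < t ->
        u t x = eps * semigroup t phi x +
          \int[lebesgue_measure]_(s in `]0, t[)
            semigroup (t - s) (power_nonlinearity p \o u s) x].

(* |x|^(-beta), which for beta <> 0 has value 0 at x = 0 by the convention of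
   [powR]. *)
Definition radial_power (beta : R) x : R := enorm x `^ (- beta).

End fourier.

End lebesgue_rV.

(* Main.v *)
(* Let G = heat_kernel _ 1 and w(x,t) = max(|x|, t^(1/4))^(-beta).  By scaling,
   S(tau^4) f (x) is the integral of G(z) f(x - tau z) dz, and G decays faster
   than any polynomial (integration by parts in Fourier variables).  Hence
   S(t) phi <= K w.  At infinity |x|^beta [S(1) phi](x) tends to the integral of
   G, which is positive, so that the positivity assumption, compactness and
   scaling give S(t) phi >= c w.
   Since beta p = beta + 4, the Duhamel term of a function bounded by A w is
   bounded by C A^p w.  So the Picard iteration started at eps S(t) phi is a
   contraction on functions bounded by 3 K eps w, and in its limit the Duhamel
   term is O(eps^p) w, which for small eps is at most eps c w / 2. *)
Require Import Defs.
From HB Require Import structures.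
From mathcomp Require Import all_boot all_order all_algebra.
From mathcomp Require Import all_classical all_reals all_analysis.
From mathcomp Require Import ring lra measurable_realfun complex.

Set Implicit Arguments.
Unset Strict Implicit.
Unset Printing Implicit Defensive.

Import Order.TTheory GRing.Theory Num.Theory.
Import numFieldTopology.Exports numFieldNormedType.Exports.

Local Open Scope classical_set_scope.
Local Open Scope ring_scope.

(** * Lebesgue measure and integration on R^n *)

(** No sign of G is available, so there is no comparison argument: every upper bound goes through
    |G|, and the positivity of S(t) phi has to survive a perturbation. Hence the Duhamel term is
    controlled pointwise by the very weight w that bounds S(t) phi from below. The obstacle is that
    w^p is as singular as |y|^(-beta-4) when s tends to 0, and beta + 4 < N may fail; part of this
    singularity is therefore paid by a power of s. The hypothesis p > 1 + 4/N enters as beta < N,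
    which makes phi locally integrable and leaves room for that exchange. After scaling only the
    kernel at time 1 remains, and the Duhamel estimates use nothing of it but measurability and
    |G(z)| <= D (1 + |z|)^(-2N). Weights are built on the sup norm, which reduces integrals over R^N
    to products of one-dimensional ones; phi is built on the Euclidean norm, and the two norms
    differ by at most the factor N. The iteration runs among jointly continuous functions of (t, x);
    with the decay of w this yields continuity in time with values in BC(R^N). *)

Section measure_rV.
Context {R : realType}.
Implicit Types n : nat.

Local Notation mu := (@lebesgue_measure R).
Local Notation leb n := (@lebesgue_rV R n).

Lemma rV_coord_le_norm n (v : 'rV[R]_n) i : `|v ord0 i| <= `|v|.
Proof.
rewrite [leRHS]/Num.norm/= mx_normrE.
by apply/bigmax_geP; right; exists (ord0, i).
Qed.

Lemma rV_norm_lt n (v : 'rV[R]_n) (e : R) :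
  0 < e -> (forall i, `|v ord0 i| < e) -> `|v| < e.
Proof.
move=> e0 ve; rewrite /Num.norm/= mx_normrE.
by apply/bigmax_ltP; split=> // -[i j] _ /=; rewrite ord1.
Qed.

(** An open set is the union of the boxes with rational centre and half-width that it contains;
    there are countably many, and boxes lie in the product sigma-algebra. *)
Lemma measurable_rV_open n (A : set 'rV[R]_n) : open A -> measurable A.
Proof.
move=> oA.
pose B (qr : 'rV[rat]_n * rat) : set 'rV[R]_n :=
  [set v | forall i, [set` `](ratr (qr.1 ord0 i) - ratr qr.2),
                             (ratr (qr.1 ord0 i) + ratr qr.2)[] (v ord0 i)].
pose C qr := if `[< B qr `<=` A >] then B qr else set0.
have -> : A = \bigcup_qr C qr.
  apply/seteqP; split; last first.
    by move=> x [qr _]; rewrite /C; case: asboolP => // BA /BA.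
  move=> x Ax; have /nbhs_ballP[e /= e0 eA] := oA _ Ax.
  have /rat_in_itvoo[r] : 0 < e / 2 by rewrite divr_gt0.
  rewrite in_itv/= => /andP[r0 re].
  have /choice[q qP] : forall i, exists q : rat,
      ratr q \in `](x ord0 i - ratr r), (x ord0 i + ratr r)[.
    move=> i; have /rat_in_itvoo[q qi] : x ord0 i - ratr r < x ord0 i + ratr r.
      by lra.
    by exists q.
  exists (\row_i q i, r) => //; rewrite /C asboolT.
    move=> i /=; rewrite mxE; have := qP i; rewrite !in_itv/= => /andP[? ?].
    by apply/andP; split; lra.
  move=> y yB; apply: eA; rewrite mx_norm_ball /ball_/=.
  apply: rV_norm_lt => // i; have := yB i; have := qP i.
  rewrite /= !mxE !in_itv/= => /andP[? ?] /andP[? ?].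
  by rewrite ltr_norml; apply/andP; split; lra.
apply: countable_bigcupT_measurable; first exact: countableP.
move=> qr; rewrite /C; case: asboolP => // _.
apply: (@measurable_rV_box R n (fun i => [set` `](ratr (qr.1 ord0 i) - ratr qr.2),
                             (ratr (qr.1 ord0 i) + ratr qr.2)[])) => i.
exact: measurable_itv.
Qed.

Lemma continuous_measurable_rV n (f : 'rV[R]_n -> R) :
  continuous f -> measurable_fun setT f.
Proof.
move=> cf; apply: (measurability _ (RGenOpens.measurableE R)).
move=> _ [_ [a [b ->]] <-]; rewrite setTI.
apply: measurable_rV_open; apply: open_comp => //.
Qed.

Lemma rV_cons_comb n (x z : R * 'rV[R]_n) (c : R) :
  rV_cons x + c *: rV_cons z = rV_cons (x.1 + c * z.1, x.2 + c *: z.2).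
Proof.
apply/rowP => i; rewrite mxE [X in _ + X]mxE; case: (unliftP ord0 i) => [j ->|->].
  by rewrite !rV_consS /= !mxE.
by rewrite !rV_cons0.
Qed.

Lemma measurable_rV_affine n (x : 'rV[R]_n) (c : R) :
  measurable_fun setT (fun z : 'rV[R]_n => x + c *: z).
Proof.
apply: measurable_fun_rVP => i.
rewrite (_ : _ \o _ = fun z => x ord0 i + c * rV_coord i z).
  apply: measurable_funD => //; apply: measurable_funM => //.
  exact: measurable_rV_coord.
by apply/funext => z /=; rewrite /rV_coord !mxE.
Qed.

Lemma measurable_rV_consl n (a : R) :
  measurable_fun setT (fun v : 'rV[R]_n => rV_cons (a, v)).
Proof.
apply: measurable_fun_rVP => i; case: (unliftP ord0 i) => [j ->|->].
- rewrite (_ : _ \o _ = rV_coord j); first exact: measurable_rV_coord.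
  by apply/funext => p /=; exact: rV_consS.
- rewrite (_ : _ \o _ = cst a)//.
  by apply/funext => p /=; exact: rV_cons0.
Qed.

Lemma measurable_rV_section n (f : 'rV[R]_n.+1 -> \bar R) (a : R) :
  measurable_fun setT f -> measurable_fun setT (fun v => f (rV_cons (a, v))).
Proof.
move=> mf; apply: (measurableT_comp mf).
exact: measurable_rV_consl.
Qed.

Lemma measurable_rV_comp_cons n (f : 'rV[R]_n.+1 -> \bar R) :
  measurable_fun setT f ->
  measurable_fun setT (fun p : R * 'rV[R]_n => f (rV_cons p)).
Proof. by move=> mf; apply: (measurableT_comp mf); exact: measurable_rV_cons. Qed.

Local Open Scope ereal_scope.

Lemma ge0_integral_rV_cons n (f : 'rV[R]_n.+1 -> \bar R) :
  measurable_fun setT f -> (forall x, 0 <= f x) ->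
  \int[leb n.+1]_x f x = \int[mu \x leb n]_p f (rV_cons p).
Proof.
move=> mf f0; rewrite [LHS](_ : _ =
    \int[pushforward (mu \x leb n) (@rV_cons R n)]_x f x)//.
by rewrite ge0_integral_pushforward//; exact: measurable_rV_cons.
Qed.

Lemma ge0_integral_rVS n (f : 'rV[R]_n.+1 -> \bar R) :
  measurable_fun setT f -> (forall x, 0 <= f x) ->
  \int[leb n.+1]_x f x = \int[mu]_a \int[leb n]_v f (rV_cons (a, v)).
Proof.
move=> mf f0; rewrite ge0_integral_rV_cons//.
rewrite (fubini_tonelli1 (m1 := mu) (m2 := leb n) (f \o @rV_cons R n))//=.
exact: (measurable_rV_comp_cons mf).
Qed.

(** The image of [mu] under x |-> a + c x, multiplied by c, agrees with [mu] on half-open intervals,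
    hence on all measurable sets. *)
Lemma ge0_integral_affine (f : R -> \bar R) (a c : R) :
  measurable_fun setT f -> (forall x, 0 <= f x) -> (0 < c)%R ->
  \int[mu]_x f x = c%:E * \int[mu]_(x in setT) f (a + c * x)%R.
Proof.
move=> mf f0 c0.
have mphi : measurable_fun setT (fun x : R => (a + c * x)%R : measurableTypeR R).
  by apply: measurable_funD => //; exact: measurable_funM.
pose C : {nonneg R} := NngNum (ltW c0).
pose m' : {measure set (measurableTypeR R) -> \bar R} :=
  measure_function_pushforward__canonical__measure_function_Measure mu mphi.
transitivity (\int[mscale C m']_x f x).
  apply: eq_measure_integral => //= A mA _.
  apply/lebesgue_measure_unique => //= _ [[u v]] _ <-.
  rewrite /mscale/= /m'/= /pushforward (_ : _ @^-1` _ =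
    [set` `]((u - a) / c)%R, ((v - a) / c)%R]]); last first.
    apply/seteqP; split=> x /=; rewrite !in_itv/= ltr_pdivrMr// ler_pdivlMr//;
      by rewrite ltrBlDl lerBrDl [(c * x)%R]mulrC.
  rewrite !lebesgue_measure_itv/= !lte_fin ltr_pM2r ?invr_gt0// ltrD2r.
  case: ifPn => _; last by rewrite mule0.
  by rewrite -!EFinB -EFinM; congr EFin; field; rewrite gt_eqF.
rewrite ge0_integral_mscale//= ge0_integral_pushforward//=.
Qed.

Lemma ge0_integral_opp (f : R -> \bar R) :
  measurable_fun setT f -> (forall x, 0 <= f x) ->
  \int[mu]_x f x = \int[mu]_x f (- x)%R.
Proof.
move=> mf f0.
have mphi : measurable_fun setT (-%R : R -> measurableTypeR R).
  exact: (measurable_funN (@measurable_id _ R setT)).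
transitivity (\int[pushforward mu (-%R : _ -> measurableTypeR R)]_x f x).
  by apply: eq_measure_integral => //= A mA _; exact/esym/lebesgue_measureN.
by rewrite ge0_integral_pushforward.
Qed.

Lemma ge0_integral_affineN (f : R -> \bar R) (a c : R) :
  measurable_fun setT f -> (forall x, 0 <= f x) -> c != 0%R ->
  \int[mu]_x f x = `|c|%:E * \int[mu]_x f (a + c * x)%R.
Proof.
move=> mf f0; rewrite neq_lt => /orP[c0|c0]; last first.
  by rewrite gtr0_norm//; exact: ge0_integral_affine.
rewrite ltr0_norm// (ge0_integral_affine a (c := (- c)%R))// ?oppr_gt0//.
congr (_ * _); rewrite ge0_integral_opp//.
- by apply: eq_integral => x _; rewrite mulrNN.
- by apply: (measurableT_comp mf); apply: measurable_funD.
Qed.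

Lemma ge0_integral_rV_affine n (f : 'rV[R]_n -> \bar R) x (c : R) :
  measurable_fun setT f -> (forall x, 0 <= f x) -> c != 0%R ->
  \int[leb n]_z f z = (`|c| ^+ n)%:E * \int[leb n]_z f (x + c *: z)%R.
Proof.
move=> + + c0; elim: n f x => [|n IH] f x mf f0.
  rewrite expr0 mul1e; apply: eq_integral => z _; congr f.
  by apply/rowP => -[].
rewrite ge0_integral_rVS// ge0_integral_rVS//; last first.
  by apply: (measurableT_comp mf); exact: measurable_rV_affine.
rewrite -{1}(rV_unconsK x); case: (rV_uncons x) => a y.
under [in RHS]eq_integral do under eq_integral do rewrite rV_cons_comb/=.
have m2 (b d : R) : measurable_fun setT
    (fun t : R => \int[leb n]_v f (rV_cons (b + d * t, v)%R)).
  pose F := fubini_F (leb n) (f \o @rV_cons R n).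
  have mF : measurable_fun setT F.
    apply: measurable_fun_fubini_tonelli_F => //=.
    exact: measurable_rV_comp_cons.
  by apply: (measurableT_comp mF); apply: measurable_funD.
pose G t := \int[leb n]_v f (rV_cons (t, v)).
rewrite [LHS](_ : _ = `|c|%:E * \int[mu]_x G (a + c * x)%R); last first.
  apply: (@ge0_integral_affineN G) => //.
- have := m2 0%R 1%R; congr (measurable_fun _ _).
  by apply/funext => t; rewrite add0r mul1r.
- by move=> t; apply: integral_ge0.
rewrite exprS EFinM -muleA; congr (_ * _).
rewrite -ge0_integralZl_EFin//; last 2 first.
- by move=> t _; apply: integral_ge0.
- have mF : measurable_fun setT (fubini_F (leb n)
      (fun p : R * 'rV[R]_n => f (rV_cons (a + c * p.1, y + c *: p.2)%R))).
    apply: measurable_fun_fubini_tonelli_F => //=.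
    apply: (measurableT_comp mf).
    have := @measurable_rV_affine n.+1 (rV_cons (a, y)) c.
    move=> /(measurableT_comp)/(_ (@measurable_rV_cons R n)).
    by congr (measurable_fun _ _); apply/funext => p /=; rewrite rV_cons_comb.
  exact: mF.
apply: eq_integral => t _; rewrite /G (IH _ y)//; exact: measurable_rV_section.
Qed.

(** In dimension 0 the measure is a Dirac mass, whence the condition on n. *)
Lemma lebesgue_rV_set1 n (x : 'rV[R]_n) : (0 < n)%N -> leb n [set x] = 0.
Proof.
case: n x => // n x _.
have -> : [set x] = [set v : 'rV[R]_n.+1 | forall i, [set x ord0 i] (v ord0 i)].
  apply/seteqP; split=> [v -> //|v /= vx]; apply/rowP => i; exact: vx.
rewrite (@lebesgue_rV_box R n.+1 (fun i => [set x ord0 i]))//.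
by rewrite big_ord_recl lebesgue_measure_set1 mul0e.
Qed.

Lemma measurable_rV_set1 n (x : 'rV[R]_n) : measurable [set x].
Proof.
have -> : [set x] = [set v : 'rV[R]_n | forall i, [set x ord0 i] (v ord0 i)].
  apply/seteqP; split=> [v -> //|v /= vx]; apply/rowP => i; exact: vx.
by apply: (@measurable_rV_box R n (fun i => [set x ord0 i])).
Qed.

(** The source of all integrability on R^n below: majorants are chosen as products over the
    coordinates. *)
Lemma ge0_integral_rV_prod n (f : R -> R) :
  measurable_fun setT f -> (forall x, (0 <= f x)%R) ->
  \int[leb n]_v (\prod_(i < n) f (v ord0 i))%R%:E = (\int[mu]_x (f x)%:E) ^+ n.
Proof.
move=> mf f0.
have mprod m : measurable_fun setT (fun v : 'rV[R]_m => (\prod_(i < m) f (v ord0 i))%R).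
  apply: measurable_prod => i _; apply: (measurableT_comp mf).
  exact: measurable_rV_coord.
elim: n => [|n IH].
  under eq_integral do rewrite big_ord0.
  by rewrite integral_cst//= diracE mem_set// mul1e.
rewrite ge0_integral_rVS//; last 2 first.
- by apply/measurable_EFinP; exact: mprod.
- by move=> x; rewrite lee_fin prodr_ge0.
under eq_integral => a _.
  under eq_integral => v _.
    rewrite big_ord_recl rV_cons0/= EFinM.
    under eq_bigr do rewrite rV_consS/=.
    over.
  rewrite ge0_integralZl_EFin//; last 2 first.
    by move=> v _; rewrite lee_fin prodr_ge0.
    by apply/measurable_EFinP; exact: mprod.
  rewrite IH.
  over.
rewrite ge0_integralZr//; last 3 first.
- exact/measurable_EFinP.
- by move=> x _; rewrite lee_fin.
- by apply: expe_ge0; apply: integral_ge0 => x _; rewrite lee_fin.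
by rewrite expeS.
Qed.

End measure_rV.

(** * Domination, Fubini and limits under the integral *)

Section integrable_tools.
Context d (T : measurableType d) (R : realType).
Variable mu : {measure set T -> \bar R}.
Implicit Types (f g : T -> R).

Lemma integrable_dominated f g : mu.-integrable setT (EFin \o g) ->
  measurable_fun setT f -> (forall x, `|f x| <= g x) ->
  mu.-integrable setT (EFin \o f).
Proof.
move=> ig mf fg; apply: (le_integrable measurableT _ _ ig) => //.
  exact/measurable_EFinP.
by move=> x _ /=; rewrite lee_fin (le_trans (fg x))// ler_norm.
Qed.

Lemma normr_Rintegral_le f g : mu.-integrable setT (EFin \o g) ->
  measurable_fun setT f -> (forall x, `|f x| <= g x) ->
  `|\int[mu]_x f x| <= \int[mu]_x g x.
Proof.
move=> ig mf fg; have jf := integrable_dominated ig mf fg.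
rewrite (le_trans (le_normr_Rintegral _ _))//.
by apply: le_Rintegral => //; exact: (integrable_norm jf).
Qed.

Lemma ge0_integrable_le f (C : R) : measurable_fun setT f -> (forall x, 0 <= f x) ->
  (\int[mu]_x (f x)%:E <= C%:E)%E ->
  mu.-integrable setT (EFin \o f) /\ \int[mu]_x f x <= C.
Proof.
move=> mf f0 fC; have jf : mu.-integrable setT (EFin \o f).
  apply/integrableP; split; first exact/measurable_EFinP.
  rewrite (le_lt_trans _ (ltry C))// (le_trans _ fC)// le_eqVlt; apply/orP; left.
  by apply/eqP/eq_integral => x _ /=; rewrite ger0_norm.
split=> //; rewrite -lee_fin /Rintegral fineK//.
exact: (integrable_fin_num _ jf).
Qed.

Lemma EFin_Rintegral f : mu.-integrable setT (EFin \o f) ->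
  (\int[mu]_x f x)%:E = (\int[mu]_x (f x)%:E)%E.
Proof. by move=> jf; rewrite /Rintegral fineK//; exact: (integrable_fin_num _ jf). Qed.

(** Serves functions with a singularity, whose majorant is valid only off a null set. *)
Lemma ae_Rintegral_le f (C : R) g : mu.-integrable setT (EFin \o g) ->
  measurable_fun setT f -> (forall x, 0 <= f x) -> (forall x, 0 <= g x) ->
  {ae mu, forall x, f x <= g x} -> \int[mu]_x g x <= C ->
  mu.-integrable setT (EFin \o f) /\ \int[mu]_x f x <= C.
Proof.
move=> ig mf f0 g0 fg gC; apply: ge0_integrable_le => //.
apply: (@le_trans _ _ (\int[mu]_x (g x)%:E)%E); last first.
  by rewrite -EFin_Rintegral// lee_fin.
apply: ae_ge0_le_integral => //.
- by move=> x _; rewrite lee_fin.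
- exact/measurable_EFinP.
- by move=> x _; rewrite lee_fin.
- exact: measurable_int ig.
- by apply: filterS fg => x fgx _; rewrite lee_fin.
Qed.

End integrable_tools.

(** Integrability of every slice, not just of almost every one, makes the real-valued inner integral
    equal to the extended one at each point. *)
Lemma Rintegral_Fubini d1 d2 (T1 : measurableType d1) (T2 : measurableType d2)
    (R : realType) (m1 : {sigma_finite_measure set T1 -> \bar R})
    (m2 : {sigma_finite_measure set T2 -> \bar R}) (f : T1 * T2 -> R) :
  (m1 \x m2)%E.-integrable setT (EFin \o f) ->
  (forall x, m2.-integrable setT (fun y => (f (x, y))%:E)) ->
  (forall y, m1.-integrable setT (fun x => (f (x, y))%:E)) ->
  \int[m1]_x \int[m2]_y f (x, y) = \int[m2]_y \int[m1]_x f (x, y).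
Proof.
move=> jf j1 j2; rewrite /Rintegral; congr (fine _).
transitivity (\int[m1]_x \int[m2]_y (f (x, y))%:E)%E.
  by apply: eq_integral => x _; exact: (EFin_Rintegral (j1 x)).
rewrite (Fubini jf).
by apply: eq_integral => y _; exact/esym/(EFin_Rintegral (j2 y)).
Qed.

Lemma integrable_Rintegral1 d1 d2 (T1 : measurableType d1) (T2 : measurableType d2)
    (R : realType) (m1 : {sigma_finite_measure set T1 -> \bar R})
    (m2 : {sigma_finite_measure set T2 -> \bar R}) (f : T1 * T2 -> R) :
  (m1 \x m2)%E.-integrable setT (EFin \o f) ->
  (forall x, m2.-integrable setT (fun y => (f (x, y))%:E)) ->
  m1.-integrable setT (fun x => (\int[m2]_y f (x, y))%:E).
Proof.
move=> jf j1; have := integrable_fubini_F jf; apply: eq_integrable => // x _.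
exact/esym/(EFin_Rintegral (j1 x)).
Qed.

(** Carries dominated convergence from sequences to a continuous parameter: if the limit failed,
    points violating it could be picked in the balls of radius 1/(n+1) and inside [G], where the
    hypotheses on the integrand hold. *)
Lemma cvg_seq_filter (R : realType) (P : pseudoMetricType R) (p0 : P) (G : set P)
    (F : P -> R) (l : R) : nbhs p0 G ->
  (forall u : nat -> P, (forall n, G (u n)) -> u n @[n --> \oo] --> p0 ->
    F (u n) @[n --> \oo] --> l) -> F p @[p --> p0] --> l.
Proof.
move=> Gp0 HF; apply/cvgrPdist_lt => e e0; apply: contrapT => nH.
have {nH}bad (n : nat) : exists p, [/\ G p, ball p0 n.+1%:R^-1 p & e <= `|l - F p|].
  apply: contrapT => nex; apply: nH.
  have nB : nbhs p0 (ball p0 n.+1%:R^-1) by apply: nbhsx_ballx.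
  apply: filterS (filterI Gp0 nB) => p [Gp Bp] /=.
  by rewrite ltNge; apply/negP => le; apply: nex; exists p.
have [u uP] := choice bad.
have ul : F (u n) @[n --> \oo] --> l.
  apply: HF => [n|]; first by have [] := uP n.
  apply/cvg_ballP => d d0; near=> n.
  have [_ + _] := uP n; apply: le_ball.
  rewrite -[d]invrK lef_pV2 ?posrE ?invr_gt0// (@le_trans _ _ n%:R)//.
    by near: n; exact: nbhs_infty_ger.
  by rewrite ler_nat.
have /cvgrPdist_lt/(_ e e0) [n _ /(_ n (leqnn n))] := ul.
by have [_ _] := uP n => + /=; rewrite leNgt => /negP.
Unshelve. all: end_near. Qed.

(** The null set [N] is there for Duhamel integrals, whose integrand, extended by zero past s = t,
    jumps at one point when t varies. *)
Lemma cvg_Rintegral_dominated d (T : measurableType d) (R : realType)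
    (mu : {measure set T -> \bar R}) (P : pseudoMetricType R) (p0 : P)
    (f : P -> T -> R) (g : T -> R) (N : set T) :
  measurable N -> mu N = 0%E ->
  mu.-integrable setT (EFin \o g) ->
  (\forall p \near p0, measurable_fun setT (f p)) ->
  (\forall p \near p0, forall x, ~ N x -> `|f p x| <= g x) ->
  (forall x, ~ N x -> f p x @[p --> p0] --> f p0 x) ->
  \int[mu]_x f p x @[p --> p0] --> \int[mu]_x f p0 x.
Proof.
move=> mN N0 ig mf fg fc.
apply: (cvg_seq_filter (filterI mf fg)) => u uG up0.
have mfu n : measurable_fun setT (f (u n)) by case: (uG n).
have fgu n x : ~ N x -> `|f (u n) x| <= g x by case: (uG n) => _; apply.
have mf0 : measurable_fun setT (f p0) by exact: nbhs_singleton mf.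
have aeN (Q : T -> Prop) : (forall x, ~ N x -> Q x) -> {ae mu, forall x, Q x}.
  move=> H; exists N; split => // x /= nQ; apply: contrapT => /H; exact: nQ.
have [|||||i0 _ ic] := @dominated_convergence _ T R mu setT measurableT
  (fun n => EFin \o f (u n)) (EFin \o f p0) (EFin \o g).
- by move=> n; exact/measurable_EFinP.
- exact/measurable_EFinP.
- apply: aeN => x nx _; apply: cvg_EFin; first exact: nearW.
  exact: (cvg_comp _ _ up0 (fc x nx)).
- exact: ig.
- by apply: aeN => x nx n _; rewrite lee_fin; exact: fgu.
by apply: fine_cvg; rewrite fineK//; exact: integrable_fin_num i0.
Qed.

Section power_integral.
Context {R : realType}.
Local Notation mu := (@lebesgue_measure R).

Lemma powR_primitive_within (c a b : R) : c < 1 -> 0 < a -> a < b ->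
  (\int[mu]_(s in [set` `[a, b]]) (s `^ (- c))%:E =
   (b `^ (1 - c) / (1 - c) - a `^ (1 - c) / (1 - c))%:E)%E.
Proof.
move=> c1 a0 ab; have c1' : 1 - c != 0 by rewrite subr_eq0 gt_eqF.
rewrite (@continuous_FTC2 _ _ (fun s => s `^ (1 - c) / (1 - c)))//.
- apply: continuous_in_subspaceT => s; rewrite inE/= in_itv/= => /andP[as_ _].
  apply: differentiable_continuous; apply/derivable1_diffP.
  apply: derivable_powR; rewrite in_itv/= andbT; exact: lt_le_trans as_.
- have D s : 0 < s -> derivable (fun s => s `^ (1 - c) / (1 - c)) s 1.
    move=> s0; apply: derivableM => //; apply: derivable_powR.
    by rewrite in_itv/= andbT.
  have C s : 0 < s -> {for s, continuous (fun s => s `^ (1 - c) / (1 - c))}.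
    by move=> s0; apply: differentiable_continuous; apply/derivable1_diffP/D.
  split.
  + by move=> s; rewrite in_itv/= => /andP[s1 _]; apply: D; exact: lt_trans s1.
  + apply: cvg_at_right_filter; exact: C.
  + apply: cvg_at_left_filter; apply: C; exact: lt_trans ab.
- move=> s; rewrite in_itv/= => /andP[as_ _]; have s0 := lt_trans a0 as_.
  rewrite derive1Mr; last by apply: derivable_powR; rewrite in_itv/= andbT.
  rewrite powR_derive1 ?in_itv/= ?andbT//.
  by rewrite mulrAC divff// mul1r; congr (_ `^ _); ring.
Qed.

Lemma integral_powR_le (c b : R) : c < 1 -> 0 < b ->
  (\int[mu]_(s in [set` `]0%R, b]])  (s `^ (- c))%:E <= (b `^ (1 - c) / (1 - c))%:E)%E.
Proof.
move=> c1 b0.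
have mpow D : measurable D -> measurable_fun D (fun s : R => (s `^ (- c))%:E).
  by move=> mD; apply/measurable_EFinP; apply: measurable_funTS; exact: measurable_powR.
(* With n + 2 the left endpoint stays strictly below b, as the primitive formula requires, already
   for n = 0. *)
have -> : [set` `]0, b]] = \bigcup_n [set` `[b * n.+2%:R^-1, b]].
  apply/seteqP; split=> s /=; rewrite in_itv/=.
    move=> /andP[s0 sb]; have [n nP] : exists n : nat, b / s < n%:R.
      by exists (Num.bound (b / s)); apply: archi_boundP; rewrite divr_ge0 ?ltW.
    exists n => //=; rewrite in_itv/= sb andbT ler_pdivrMr//.
    rewrite mulrC -ler_pdivrMr// (le_trans (ltW nP))// ler_nat.
    by rewrite (leq_trans (leqnSn _)).
  move=> [n _] /=; rewrite in_itv/= => /andP[ns ->]; rewrite andbT.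
  by apply: lt_le_trans ns; rewrite divr_gt0.
have cv : (\int[mu]_(s in [set` `[(b * n.+2%:R^-1)%R, b]]) (s `^ (- c))%:E)%E
    @[n --> \oo] --> (\int[mu]_(s in \bigcup_n [set` `[(b * n.+2%:R^-1)%R, b]])
      (s `^ (- c))%:E)%E.
  apply: ge0_nondecreasing_set_cvg_integral => //.
  - move=> m n mn; apply/subsetPset => s /=; rewrite !in_itv/= => /andP[ms ->].
    rewrite andbT (le_trans _ ms)// ler_pM2l// lef_pV2 ?posrE// ler_nat.
    by rewrite !ltnS.
  - by move=> n; exact: mpow.
  - by move=> n s _; rewrite lee_fin powR_ge0.
rewrite -(cvg_lim _ cv)//.
apply: lime_le.
- by apply/cvg_ex; eexists; apply: cv.
- apply: nearW => n; have an : 0 < b * n.+2%:R^-1 by rewrite divr_gt0.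
  rewrite powR_primitive_within//; last first.
    by rewrite gtr_pMr// invf_lt1// ltr1n.
  rewrite lee_fin lerBlDr lerDl divr_ge0// ?powR_ge0// subr_ge0; exact: ltW.
Qed.

End power_integral.

(** * Change of variables and slicing for real-valued integrals on R^n *)

Section rV_Rintegral.
Context {R : realType}.
Local Notation mu := (@lebesgue_measure R).
Local Notation leb n := (@lebesgue_rV R n).

Lemma lty_mule (r : R) (x : \bar R) :
  0 < r -> (0 <= x)%E -> (r%:E * x < +oo)%E -> (x < +oo)%E.
Proof. case: x => [x _ _ _|r0 _|//]; first by rewrite ltry.
by rewrite mulry gtr0_sg ?mul1e. Qed.

Lemma fine_mulB (r : R) (x y : \bar R) : x \is a fin_num -> y \is a fin_num ->
  fine (r%:E * x - r%:E * y) = r * fine (x - y).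
Proof. by move: x y => [x| |] [y| |] //= _ _; rewrite mulrBr. Qed.

Lemma integrable_rV_affine n (f : 'rV[R]_n -> R) x (c : R) : c != 0 ->
  (leb n).-integrable setT (EFin \o f) ->
  (leb n).-integrable setT (fun z => (f (x + c *: z))%:E).
Proof.
move=> c0 /integrableP[mf fy].
have mfa : measurable_fun setT (fun z : 'rV[R]_n => (f (x + c *: z))%:E).
  by apply: (measurableT_comp mf); exact: measurable_rV_affine.
apply/integrableP; split => //.
have mabs : measurable_fun setT (fun z => `|(EFin \o f) z|%E).
  exact: measurableT_comp.
move: fy; rewrite (ge0_integral_rV_affine x mabs _ c0)//=.
by apply: lty_mule; rewrite ?exprn_gt0 ?normr_gt0//; exact: integral_ge0.
Qed.

Lemma Rintegral_rV_affine n (f : 'rV[R]_n -> R) x (c : R) : c != 0 ->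
  (leb n).-integrable setT (EFin \o f) ->
  \int[leb n]_z f z = `|c| ^+ n * \int[leb n]_z f (x + c *: z).
Proof.
move=> c0 jf; have ja := integrable_rV_affine x c0 jf.
have mf := measurable_int _ jf.
rewrite /Rintegral integralE [in RHS]integralE.
rewrite (ge0_integral_rV_affine x (measurable_funepos mf) _ c0)//.
rewrite (ge0_integral_rV_affine x (measurable_funeneg mf) _ c0)//.
have A := integrable_pos_fin_num _ ja; have B := integrable_neg_fin_num _ ja.
rewrite -fine_mulB; [|exact: A|exact: B].
by congr (fine (_ - _)); congr (_ * _)%E; apply: eq_integral => z _;
  rewrite ?funeposE ?funenegE.
Qed.

Lemma integrable_rV_cons n (f : 'rV[R]_n.+1 -> R) :
  (leb n.+1).-integrable setT (EFin \o f) ->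
  (mu \x leb n)%E.-integrable setT (fun p => (f (rV_cons p))%:E).
Proof.
move=> /integrableP[mf fy]; apply/integrableP; split.
  exact: (measurable_rV_comp_cons mf).
rewrite -(ge0_integral_rV_cons (f := fun v => `|(EFin \o f) v|%E))//.
exact: measurableT_comp.
Qed.

Lemma integral_rV_cons n (f : 'rV[R]_n.+1 -> R) :
  (leb n.+1).-integrable setT (EFin \o f) ->
  (\int[leb n.+1]_v (f v)%:E = \int[mu \x leb n]_p (f (rV_cons p))%:E)%E.
Proof.
move=> jf; have mf := measurable_int _ jf.
rewrite [LHS](_ : _ =
    \int[pushforward (mu \x leb n) (@rV_cons R n)]_x (f x)%:E)%E//.
rewrite integral_pushforward//; first exact: measurable_rV_cons.
exact: (integrable_rV_cons jf).
Qed.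

Lemma Rintegral_rVS n (f : 'rV[R]_n.+1 -> R) :
  (leb n.+1).-integrable setT (EFin \o f) ->
  (forall a, (leb n).-integrable setT (fun v => (f (rV_cons (a, v)))%:E)) ->
  \int[leb n.+1]_v f v = \int[mu]_a \int[leb n]_v f (rV_cons (a, v)).
Proof.
move=> jf jfa; rewrite /Rintegral integral_rV_cons// -integral12_prod_meas1//; last first.
  exact: (integrable_rV_cons jf).
by congr fine; apply: eq_integral => a _; rewrite /fubini_F -EFin_Rintegral//; exact: jfa.
Qed.

Lemma Rintegral_rVS' n (f : 'rV[R]_n.+1 -> R) :
  (leb n.+1).-integrable setT (EFin \o f) ->
  (forall v, mu.-integrable setT (fun a => (f (rV_cons (a, v)))%:E)) ->
  \int[leb n.+1]_v f v = \int[leb n]_v \int[mu]_a f (rV_cons (a, v)).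
Proof.
move=> jf jfa; rewrite /Rintegral integral_rV_cons// -integral21_prod_meas1//; last first.
  exact: (integrable_rV_cons jf).
by congr fine; apply: eq_integral => a _; rewrite /fubini_G -EFin_Rintegral//; exact: jfa.
Qed.

Lemma integrable_rVS n (f : 'rV[R]_n.+1 -> R) :
  (leb n.+1).-integrable setT (EFin \o f) ->
  (forall a, (leb n).-integrable setT (fun v => (f (rV_cons (a, v)))%:E)) ->
  mu.-integrable setT (fun a => (\int[leb n]_v f (rV_cons (a, v)))%:E).
Proof.
move=> jf jfa; have := integrable_fubini_F (integrable_rV_cons jf).
apply: eq_integrable => // a _; rewrite /fubini_F -EFin_Rintegral//; exact: jfa.
Qed.

Lemma integrable_rVS' n (f : 'rV[R]_n.+1 -> R) :
  (leb n.+1).-integrable setT (EFin \o f) ->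
  (forall v, mu.-integrable setT (fun a => (f (rV_cons (a, v)))%:E)) ->
  (leb n).-integrable setT (fun v => (\int[mu]_a f (rV_cons (a, v)))%:E).
Proof.
move=> jf jfa; have jc := integrable_rV_cons jf.
have mG := measurable_fubini_G jc.
have jG : (leb n).-integrable setT (fubini_G mu (fun p => (f (rV_cons p))%:E)).
  apply/integrableP; split => //.
  have /integrableP[mc cy] := jc.
  have mabs : measurable_fun setT (fun p : measurableTypeR R * 'rV[R]_n =>
    `|(f (rV_cons p))%:E|%E) by exact: measurableT_comp.
  rewrite (le_lt_trans _ cy)// (fubini_tonelli2 (m1 := mu) (m2 := leb n)
    (fun p => `|(f (rV_cons p))%:E|%E))//.
  apply: ge0_le_integral => //=.
  - exact: measurableT_comp.
  - exact: measurable_fun_fubini_tonelli_G.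
  - move=> v _; apply: le_abse_integral => //.
    by have /integrableP[] := jfa v.
apply: eq_integrable jG => // a _; rewrite /fubini_G -EFin_Rintegral//; exact: jfa.
Qed.

End rV_Rintegral.

(** * Decay of the heat kernel *)

Section decay1.
Context {R : realType}.
Local Notation mu := (@lebesgue_measure R).
Implicit Types (Q : {poly {poly R}}) (r z t : R).

(** A polynomial in t and r times the symbol exp(-|xi|^4) read along one coordinate t, with |xi|^2 =
    t^2 + r. This class is stable under d/dt. *)
Definition gauss4 Q r t : R :=
  (map_poly (horner_eval r) Q).[t] * expR (- (t ^+ 2 + r) ^+ 2).

(* Coefficients are polynomials in r, so that the bounds below are uniform in
   r, which stands for the contribution of the other coordinates to |xi|^2. *)
Definition gauss4_next Q : {poly {poly R}} :=
  Q^`() - ('X * ('X ^+ 2 + ('X)%:P) * Q) *+ 4.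

Lemma is_derive_gauss4 Q r t :
  is_derive t 1 (gauss4 Q r) (gauss4 (gauss4_next Q) r t).
Proof.
rewrite /gauss4 /gauss4_next.
set q := map_poly (horner_eval r) Q.
have dp : is_derive t 1 (fun t => q.[t]) q^`().[t].
  exact: is_derive_poly.
have de : is_derive t 1 (fun t => expR (- (t ^+ 2 + r) ^+ 2))
    (- (4 * t * (t ^+ 2 + r)) * expR (- (t ^+ 2 + r) ^+ 2)).
  apply: is_derive_eq; rewrite /GRing.scale/=; ring.
apply: (is_derive_eq (is_deriveM dp de)).
rewrite raddfB/= raddfMn/= !rmorphM/= rmorphD/= map_polyX map_polyXn map_polyC/=.
rewrite deriv_map hornerD hornerN hornerMn !hornerM hornerD hornerC hornerX hornerXn.
rewrite /horner_eval hornerX -/q /GRing.scale/=; ring.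
Qed.

Lemma poly_growth (q : {poly R}) : exists C m, 0 <= C /\
  forall x, 0 <= x -> `|q.[x]| <= C * (1 + x) ^+ m.
Proof.
elim/poly_ind: q => [|q c [C [m [C0 IH]]]].
  by exists 0, 0%N; split=> // x _; rewrite horner0 normr0 mul0r.
exists (C + `|c|), m.+1; split=> [|x x0]; first by rewrite addr_ge0.
have x1 : 1 <= 1 + x by rewrite lerDl.
rewrite hornerMXaddC (le_trans (ler_normD _ _))// mulrDl lerD//.
  rewrite normrM exprSr mulrA ler_pM// ?IH// ger0_norm//.
  by rewrite lerDr.
by rewrite ler_peMr// exprn_ege1.
Qed.

(** The growth is measured by t^2 + r, the quantity in the exponential, so that the polynomial can
    be absorbed by half of the exponent whatever r is. *)
Lemma poly2_growth Q : exists C m, 0 <= C /\ forall r t, 0 <= r ->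
  `|(map_poly (horner_eval r) Q).[t]| <= C * (1 + (t ^+ 2 + r)) ^+ m.
Proof.
elim/poly_ind: Q => [|Q c [C [m [C0 IH]]]].
  by exists 0, 0%N; split=> // r t _; rewrite rmorph0 horner0 normr0 mul0r.
have [D [k [D0 HD]]] := poly_growth c.
exists (C + D), (m.+1 + k)%N; split=> [|r t r0]; first by rewrite addr_ge0.
have t20 : 0 <= t ^+ 2 by rewrite sqr_ge0.
have tr0 : 0 <= t ^+ 2 + r by rewrite addr_ge0.
have x1 : 1 <= 1 + (t ^+ 2 + r) by rewrite lerDl.
rewrite rmorphD rmorphM/= map_polyX map_polyC/= hornerMXaddC.
rewrite (le_trans (ler_normD _ _))// mulrDl lerD//.
  rewrite normrM exprD exprSr !mulrA.
  rewrite (@le_trans _ _ (C * (1 + (t ^+ 2 + r)) ^+ m * (1 + (t ^+ 2 + r))))//.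
    rewrite ler_pM// ?IH//; have := sqr_ge0 (`|t| - 1).
    rewrite sqrrB1 real_normK ?num_real//; have := normr_ge0 t.
    move: (`|t|) => u u0; nra.
  by rewrite ler_peMr// ?exprn_ege1// !mulr_ge0// ?exprn_ge0// ltW// (lt_le_trans _ x1).
rewrite (le_trans (HD _ r0))// ler_wpM2l//.
rewrite (@le_trans _ _ ((1 + (t ^+ 2 + r)) ^+ k))//.
  by rewrite lerXn2r ?nnegrE ?addr_ge0//; lra.
by rewrite addnC ler_weXn2l// leq_addr.
Qed.

(** With s = t^2 + r, (1 + s)^m <= exp(m s), and m s - s^2 <= m^2/2 - s^2/2 because (s - m)^2 >= 0;
    this is where exp(m^2/2) comes from. *)
Lemma gauss4_bound Q : exists2 C, 0 <= C & forall r t, 0 <= r ->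
  `|gauss4 Q r t| <= C * expR (- ((t ^+ 2 + r) ^+ 2 / 2)).
Proof.
have [C [m [C0 HC]]] := poly2_growth Q.
exists (C * expR (m%:R ^+ 2 / 2)); first by rewrite mulr_ge0// expR_ge0.
move=> r t r0; rewrite /gauss4 normrM [X in _ * X]ger0_norm ?expR_ge0//.
rewrite (le_trans (ler_wpM2r _ (HC r t r0))) ?expR_ge0//.
rewrite -!mulrA ler_wpM2l// -expRD.
have tr0 : 0 <= t ^+ 2 + r by rewrite addr_ge0 ?sqr_ge0.
set s := t ^+ 2 + r in tr0 *.
rewrite (@le_trans _ _ (expR s ^+ m * expR (- s ^+ 2)))//.
  rewrite ler_wpM2r ?expR_ge0// lerXn2r ?nnegrE ?expR_ge0 ?expR_ge1Dx//.
  by rewrite addr_ge0.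
rewrite -expRM_natr -expRD ler_expR.
by have := sqr_ge0 (s - m%:R); rewrite sqrrB; lra.
Qed.

Lemma continuous_gauss4 Q r : continuous (gauss4 Q r).
Proof.
move=> t; apply: differentiable_continuous; apply/derivable1_diffP.
by case: (is_derive_gauss4 Q r t).
Qed.

Lemma integrable_expR_pow4 :
  mu.-integrable setT (fun t : R => (expR (- (t ^+ 4 / 2)))%:E).
Proof.
(* The constant comes from t^2 <= t^4/2 + 1/2, that is, (t^2 - 1)^2 >= 0. *)
have H := integrableZl measurableT (expR (1 / 2)) (@integrableT_gauss R).
apply: (@integrable_dominated _ _ R mu (fun t : R => expR (- (t ^+ 4 / 2)))
  (fun t : R => expR (1/2) * gauss_fun t)).
- exact: H.
- apply: continuous_measurable_fun => t; apply: continuous_comp.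
    by apply: (@continuousN R R^o); apply: continuousM; [exact: exprn_continuous|exact: cst_continuous].
  exact: continuous_expR.
- move=> t; rewrite ger0_norm ?expR_ge0// /gauss_fun -expRD ler_expR.
  by have := sqr_ge0 (t ^+ 2 - 1); rewrite sqrrB1 -exprM; lra.
Qed.

Lemma sqrD_ge (a r : R) : 0 <= a -> 0 <= r -> a ^+ 2 + r ^+ 2 <= (a + r) ^+ 2.
Proof. by move=> a0 r0; rewrite sqrrD; have := mulr_ge0 a0 r0; lra. Qed.

(** Since (t^2 + r)^2 >= t^4 + r^2 the variables decouple; the decay kept in r is what makes the
    remaining coordinates integrable later. *)
Lemma gauss4_bound_split Q : exists2 C, 0 <= C & forall r t, 0 <= r ->
  `|gauss4 Q r t| <= C * expR (- (r ^+ 2 / 2)) * expR (- (t ^+ 4 / 2)).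
Proof.
have [C C0 HC] := gauss4_bound Q; exists C => // r t r0.
rewrite (le_trans (HC r t r0))// -mulrA ler_wpM2l// -expRD ler_expR.
by have := sqrD_ge (sqr_ge0 t) r0; rewrite -exprM; lra.
Qed.

Lemma cvg_norm_harmonic (u : nat -> R) (C : R) :
  (forall n, `|u n| <= C * n.+1%:R^-1) -> u n @[n --> \oo] --> 0.
Proof.
move=> uC; apply/norm_cvg0P.
apply: (@squeeze_cvgr _ _ _ _ (fun=> 0) (fun n => C * n.+1%:R^-1)).
- by apply: nearW => n; rewrite normr_ge0 uC.
- exact: cvg_cst.
- by rewrite -(mulr0 C); apply: cvgM; [exact: cvg_cst|exact: cvg_harmonic].
Qed.

Lemma cvg_Rintegral_symitv (f : R -> R) : mu.-integrable setT (EFin \o f) ->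
  \int[mu]_(t in [set` `[(- n.+1%:R), n.+1%:R]]) f t @[n --> \oo]
    --> \int[mu]_t f t.
Proof.
move=> jf; have mf : measurable_fun setT f.
  by apply/measurable_EFinP; exact: measurable_int jf.
have jabs := integrable_norm jf.
under eq_cvg do rewrite Rintegral_mkcond.
have [|||||i0 _ ic] := @dominated_convergence _ _ R mu setT measurableT
  (fun n t => ((f \_ [set` `[(- n.+1%:R), n.+1%:R]]) t)%:E) (EFin \o f)
  (EFin \o (Num.norm \o f)).
- move=> n; apply/measurable_EFinP.
  apply/(measurable_restrictT _ _).1 => //.
  exact: measurable_funTS.
- exact/measurable_EFinP.
- apply: aeW => t _; apply: cvg_near_cst.
  near=> n; rewrite /= patchE mem_set//= in_itv/= -ler_norml.
  have : `|t| <= n%:R by near: n; exact: nbhs_infty_ger.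
  by move/le_trans; apply; rewrite ler_nat.
- exact: jabs.
- apply: aeW => t n _; rewrite lee_fin patchE; case: ifP => //=.
  by rewrite normr0.
by apply: fine_cvg; rewrite fineK//; exact: integrable_fin_num i0.
Unshelve. all: end_near. Qed.

Lemma Rintegral_derive_eq0 (F f : R -> R) (C : R) :
  (forall t : R, is_derive t 1 F (f t)) -> continuous f ->
  mu.-integrable setT (EFin \o f) ->
  (forall t, `|F t| <= C * expR (- (t ^+ 4 / 2))) ->
  \int[mu]_t f t = 0.
Proof.
move=> dF cf jf FC.
have C0 : 0 <= C.
  by have := le_trans (normr_ge0 _) (FC 0); rewrite pmulr_lge0 ?expR_gt0.
have FTC n : \int[mu]_(t in [set` `[(- n.+1%:R), n.+1%:R]]) f t =
    F n.+1%:R - F (- n.+1%:R).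
  have n0 : (0 : R) < n.+1%:R by [].
  rewrite /Rintegral (@continuous_FTC2 _ f F) //; first by lra.
  - exact: continuous_subspaceT.
  - have cF (x : R) : {for x, continuous F}.
      apply: differentiable_continuous; apply/derivable1_diffP.
      by case: (dF x).
    split; [|exact/cvg_at_right_filter/cF|exact/cvg_at_left_filter/cF].
    by move=> x _; case: (dF x).
  - by move=> x _; rewrite derive1E; case: (dF x).
have lim0 : F n.+1%:R - F (- n.+1%:R) @[n --> \oo] --> (0 : R).
  (* Two boundary terms, each at most C exp(-x^4/2) <= 2 C / x for x >= 1. *)
  apply: (@cvg_norm_harmonic _ (4 * C)) => n.
  have n1 : (1 : R) <= n.+1%:R by rewrite ler1n.
  set x := n.+1%:R in n1 *; have x0 : 0 < x by rewrite (lt_le_trans _ n1).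
  have e2 : expR (- (x ^+ 4 / 2)) <= 2 / x.
    rewrite expRN -[2 / x]invrK lef_pV2 ?posrE ?expR_gt0 ?invr_gt0 ?divr_gt0//.
    rewrite invf_div (@le_trans _ _ (1 + x ^+ 4 / 2)) ?expR_ge1Dx//.
    have : x <= x ^+ 4 by rewrite exprS ler_peMr ?exprn_ege1// ltW.
    by lra.
  rewrite (le_trans (ler_normB _ _))//.
  have xN : (- x) ^+ 4 = x ^+ 4 by ring.
  have B := FC x; have A := FC (- x); rewrite xN in A.
  have H : C * expR (- (x ^+ 4 / 2)) <= C * (2 / x) by rewrite ler_wpM2l.
  have -> : 4 * C / x = C * (2 / x) + C * (2 / x) by field; rewrite gt_eqF.
  by rewrite lerD// (le_trans _ H).
by rewrite -(cvg_lim _ (cvg_Rintegral_symitv jf))// (funext FTC); exact/cvg_lim.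
Qed.

(** The phase puts cosine and sine integrals into one family, stable under integration by parts, and
    later carries the contribution of the other coordinates. *)
Definition oscint (th z : R) Q r : R := \int[mu]_t (cos (th + z * t) * gauss4 Q r t).

Lemma continuous_oscint th z Q r :
  continuous (fun t : R => cos (th + z * t) * gauss4 Q r t).
Proof.
move=> t; apply: continuousM; last exact: continuous_gauss4.
apply: continuous_comp; last exact: continuous_cos.
by apply: continuousD; [exact: cst_continuous|apply: continuousM => //; exact: cst_continuous].
Qed.

Lemma measurable_oscint th z Q r :
  measurable_fun setT (fun t : R => cos (th + z * t) * gauss4 Q r t).
Proof. by apply: continuous_measurable_fun; exact: continuous_oscint. Qed.

Lemma normrM_cos_le (x y : R) : `|cos x * y| <= `|y|.
Proof. by rewrite normrM ler_piMl// ler_norml cos_geN1 cos_le1. Qed.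

Lemma oscint_dominated th z Q r : 0 <= r -> exists2 C, 0 <= C &
  forall t, `|cos (th + z * t) * gauss4 Q r t| <= C * expR (- (t ^+ 4 / 2)).
Proof.
move=> r0; have [C C0 HC] := gauss4_bound_split Q.
exists (C * expR (- (r ^+ 2 / 2))); first by rewrite mulr_ge0 ?expR_ge0.
by move=> t; rewrite (le_trans (normrM_cos_le _ _))// HC.
Qed.

Lemma integrable_oscint th z Q r : 0 <= r ->
  mu.-integrable setT (fun t : R => (cos (th + z * t) * gauss4 Q r t)%:E).
Proof.
move=> r0; have [C C0 HC] := oscint_dominated th z Q r0.
apply: (@integrable_dominated _ _ R mu
  (fun t : R => cos (th + z * t) * gauss4 Q r t)
  (fun t : R => C * expR (- (t ^+ 4 / 2)))) => //.
- exact: (integrableZl measurableT C (@integrable_expR_pow4)).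
- exact: measurable_oscint.
Qed.

(** Integration by parts: z cos(th + z t) is the derivative of sin(th + z t), and -sin is cos
    shifted by pi/2. *)
Lemma oscint_ibp th z Q r : 0 <= r ->
  z * oscint th z Q r = oscint (th + pi / 2) z (gauss4_next Q) r.
Proof.
move=> r0; apply/eqP; rewrite -subr_eq0; apply/eqP.
rewrite /oscint -RintegralZl//; last exact: integrable_oscint.
rewrite -RintegralB//; last 2 first.
- exact: (integrableZl measurableT z (integrable_oscint _ _ _ r0)).
- exact: integrable_oscint.
(* The boundary term contains a sine, which is the cosine with phase th - pi/2. *)
have [C C0 HC] := oscint_dominated (th - pi / 2) z Q r0.
have sinE x : cos (x - pi / 2) = sin x.
  by rewrite -[in RHS](subrK (pi / 2) x) sinDpihalf.
apply: (@Rintegral_derive_eq0 (fun t : R => sin (th + z * t) * gauss4 Q r t)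
  (fun t : R => z * (cos (th + z * t) * gauss4 Q r t) -
    cos (th + pi / 2 + z * t) * gauss4 (gauss4_next Q) r t) C).
- move=> t; have := is_derive_gauss4 Q r t => dg.
  apply: is_derive_eq; rewrite /GRing.scale/= [th + pi / 2 + _]addrAC cosDpihalf.
  by ring.
- pose G t := z * (cos (th + z * t) * gauss4 Q r t) -
    cos (th + pi / 2 + z * t) * gauss4 (gauss4_next Q) r t.
  suff : continuous (G : R -> R) by [].
  move=> t; apply: cvgB; last exact: continuous_oscint.
  by apply: cvgM; [exact: cvg_cst|exact: continuous_oscint].
- exact: (integrableB measurableT
    (integrableZl measurableT z (integrable_oscint th z Q r0))
    (integrable_oscint (th + pi / 2) z (gauss4_next Q) r0)).
- by move=> t; have := HC t; rewrite addrAC sinE.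
Qed.

(** Each power of z is paid by one integration by parts, which replaces [Q] and shifts the phase;
    hence the induction for all [Q] and the constant uniform in th. *)
Lemma oscint_decay k Q : exists2 C, 0 <= C & forall th z r, 0 <= r ->
  `|z| ^+ k * `|oscint th z Q r| <= C * expR (- (r ^+ 2 / 2)).
Proof.
elim: k Q => [|k IH] Q; last first.
  have [C C0 HC] := IH (gauss4_next Q); exists C => // th z r r0.
  by rewrite exprSr -mulrA -normrM oscint_ibp// HC.
have [C C0 HC] := gauss4_bound_split Q.
have J0 : 0 <= \int[mu]_t expR (- (t ^+ 4 / 2)).
  by apply: Rintegral_ge0 => t _; rewrite expR_ge0.
exists (C * \int[mu]_t expR (- (t ^+ 4 / 2))); first by rewrite mulr_ge0.
move=> th z r r0; rewrite expr0 mul1r.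
have := @normr_Rintegral_le _ _ R mu
  (fun t : R => cos (th + z * t) * gauss4 Q r t)
  (fun t : R => (C * expR (- (r ^+ 2 / 2))) * expR (- (t ^+ 4 / 2))).
rewrite RintegralZl//; last exact: integrable_expR_pow4.
move=> H; rewrite mulrAC; apply: H.
- exact: (integrableZl measurableT _ (@integrable_expR_pow4)).
- exact: measurable_oscint.
- by move=> t; rewrite (le_trans (normrM_cos_le _ _))// HC.
Qed.

End decay1.

(** * Decay in several variables *)

Section decayN.
Context {R : realType}.
Local Notation mu := (@lebesgue_measure R).
Local Notation leb n := (@lebesgue_rV R n).

Definition sqnorm n (v : 'rV[R]_n) : R := \sum_(i < n) v ord0 i ^+ 2.

Lemma sqnorm_ge0 n (v : 'rV[R]_n) : 0 <= sqnorm v.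
Proof. by apply: sumr_ge0 => i _; rewrite sqr_ge0. Qed.

Lemma sqnorm_cons n (a : R) (v : 'rV[R]_n) :
  sqnorm (rV_cons (a, v)) = a ^+ 2 + sqnorm v.
Proof.
rewrite /sqnorm big_ord_recl rV_cons0; congr (_ + _).
by apply: eq_bigr => i _; rewrite rV_consS.
Qed.

Lemma dotmul_cons n (z : 'rV[R]_n.+1) (a : R) (v : 'rV[R]_n) :
  dotmul z (rV_cons (a, v)) = z ord0 ord0 * a + dotmul (rV_uncons z).2 v.
Proof.
rewrite /dotmul big_ord_recl rV_cons0; congr (_ + _).
by apply: eq_bigr => i _; rewrite rV_consS mxE.
Qed.

Lemma measurable_sqnorm n : measurable_fun setT (@sqnorm n).
Proof. by apply: measurable_sum => i; apply: measurable_funX; exact: measurable_rV_coord. Qed.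

Lemma measurable_expR_sqnorm n (g : R -> R) : continuous g ->
  measurable_fun setT (fun v : 'rV[R]_n => g (sqnorm v)).
Proof.
move=> cg; apply: (measurableT_comp (continuous_measurable_fun cg)).
exact: measurable_sqnorm.
Qed.

Lemma integrable_expR_sqnorm n :
  (leb n).-integrable setT (fun v => (expR (- sqnorm v))%:E).
Proof.
have E v : expR (- sqnorm v) = \prod_(i < n) gauss_fun (v ord0 i).
  by rewrite /sqnorm -sumrN expR_sum.
apply/integrableP; split.
  apply/measurable_EFinP; apply: (measurable_expR_sqnorm (g := fun s => expR (- s))) => s.
  by apply: continuous_comp; [exact: continuousN|exact: continuous_expR].
under eq_integral do rewrite gee0_abs ?lee_fin ?expR_ge0// E.
rewrite ge0_integral_rV_prod; last 2 first.
- exact: measurable_gauss_fun.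
- exact: gauss_fun_ge0.
by rewrite integralT_gauss -EFin_expe ltry.
Qed.

Lemma integrable_expR_sqnorm2 n :
  (leb n).-integrable setT (fun v => (expR (- (sqnorm v ^+ 2 / 2)))%:E).
Proof.
apply: (@integrable_dominated _ _ R (leb n) (fun v => expR (- (sqnorm v ^+ 2 / 2)))
  (fun v => expR (1 / 2) * expR (- sqnorm v))).
- exact: (integrableZl measurableT _ (@integrable_expR_sqnorm n)).
- apply: (measurable_expR_sqnorm (g := fun s => expR (- (s ^+ 2 / 2)))) => s.
  apply: continuous_comp; last exact: continuous_expR.
  by apply: cvgN; apply: cvgM; [exact: exprn_continuous|exact: cvg_cst].
- move=> v; rewrite ger0_norm ?expR_ge0// -expRD ler_expR.
  by have := sqr_ge0 (sqnorm v - 1); rewrite sqrrB1; lra.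
Qed.

(* The phase th and the shift r make this family stable under integration in
   one coordinate, as needed for an induction on n. *)
Definition osc n (th : R) (z : 'rV[R]_n) (r : R) v : R :=
  cos (th + dotmul z v) * expR (- (sqnorm v + r) ^+ 2).

Lemma measurable_osc n th (z : 'rV[R]_n) r : measurable_fun setT (osc th z r).
Proof.
apply: measurable_funM.
  have mcos : measurable_fun [set: R] (cos : R -> R).
    by apply: continuous_measurable_fun => u; exact: continuous_cos.
  apply: (measurableT_comp mcos); apply: measurable_funD => //.
  exact: measurable_dotmul.
apply: (measurable_expR_sqnorm (g := fun s => expR (- (s + r) ^+ 2))) => s.
apply: (@continuous_comp _ _ _ (fun s => - (s + r) ^+ 2)); last exact: continuous_expR.
apply: cvgN; have cD : x + r @[x --> s] --> s + r.
  by apply: cvgD; [exact: cvg_id|exact: cvg_cst].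
exact: (cvgM cD cD).
Qed.

Lemma osc_le n th (z : 'rV[R]_n) r v : 0 <= r ->
  `|osc th z r v| <= expR (- (sqnorm v ^+ 2 / 2)).
Proof.
move=> r0; rewrite (le_trans (normrM_cos_le _ _))// ger0_norm ?expR_ge0//.
rewrite ler_expR lerN2; have := sqrD_ge (sqnorm_ge0 v) r0.
by have := sqr_ge0 (sqnorm v); have := sqr_ge0 r; lra.
Qed.

Lemma integrable_osc n th (z : 'rV[R]_n) r : 0 <= r ->
  (leb n).-integrable setT (EFin \o osc th z r).
Proof.
move=> r0; apply: (integrable_dominated (@integrable_expR_sqnorm2 n)).
  exact: measurable_osc.
by move=> v; exact: osc_le.
Qed.

Lemma osc_cons n th (z : 'rV[R]_n.+1) r a v :
  osc th z r (rV_cons (a, v)) =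
  osc (th + z ord0 ord0 * a) (rV_uncons z).2 (a ^+ 2 + r) v.
Proof. by rewrite /osc dotmul_cons sqnorm_cons addrA [a ^+ 2 + _]addrC addrA. Qed.

Lemma osc_cons' n th (z : 'rV[R]_n.+1) r a v :
  osc th z r (rV_cons (a, v)) =
  cos (th + dotmul (rV_uncons z).2 v + z ord0 ord0 * a) *
  gauss4 1 (sqnorm v + r) a.
Proof.
rewrite /osc dotmul_cons sqnorm_cons /gauss4 rmorph1 hornerC mul1r.
by congr (cos _ * expR (- _ ^+ 2)); ring.
Qed.

(** Induction on n. If i is not the first coordinate, the others are integrated first and the
    induction hypothesis applies with r replaced by a^2 + r; if it is, the first coordinate is
    integrated first and [oscint_decay] applies. Either way the leftover exponential is integrable
    in the remaining variables. *)
Lemma rV_decay k n : exists2 C, 0 <= C & forall th (z : 'rV[R]_n) r i, 0 <= r ->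
  `|z ord0 i| ^+ k * `|\int[leb n]_v osc th z r v| <= C * expR (- (r ^+ 2 / 2)).
Proof.
elim: n => [|n [C C0 HC]].
  by exists 0 => // th z r [].
have [D D0 HD] := @oscint_decay R k 1.
set I1 := \int[mu]_t expR (- (t ^+ 4 / 2)).
set In := \int[leb n]_v expR (- (sqnorm v ^+ 2 / 2)).
have I10 : 0 <= I1 by apply: Rintegral_ge0 => t _; rewrite expR_ge0.
have In0 : 0 <= In by apply: Rintegral_ge0 => t _; rewrite expR_ge0.
exists (C * I1 + D * In); first by rewrite addr_ge0 ?mulr_ge0.
move=> th z r i r0; have jo := integrable_osc th z r0.
case: (unliftP ord0 i) => [j ->|->].
  have jv a : (leb n).-integrable setT (fun v => (osc th z r (rV_cons (a, v)))%:E).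
    under eq_fun do rewrite osc_cons.
    by apply: integrable_osc; rewrite addr_ge0 ?sqr_ge0.
  rewrite (Rintegral_rVS jo jv) -[X in X * _]ger0_norm ?exprn_ge0// -normrM.
  have ji := integrable_rVS jo jv.
  rewrite -RintegralZl//.
  apply: (@le_trans _ _ (\int[mu]_a (C * expR (- (r ^+ 2 / 2)) *
      expR (- (a ^+ 4 / 2))))).
    apply: normr_Rintegral_le.
    - exact: (integrableZl measurableT _ (@integrable_expR_pow4 R)).
    - by apply: measurable_funM => //; apply/measurable_EFinP; exact: measurable_int ji.
    - move=> a; rewrite normrM [X in X * _]ger0_norm ?exprn_ge0//.
      under eq_Rintegral do rewrite osc_cons.
      have ar0 : 0 <= a ^+ 2 + r by rewrite addr_ge0 ?sqr_ge0.
      have := HC (th + z ord0 ord0 * a) (rV_uncons z).2 _ j ar0; rewrite mxE.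
      move=> /le_trans; apply; rewrite -mulrA ler_wpM2l// -expRD ler_expR.
      by have := sqrD_ge (sqr_ge0 a) r0; rewrite -exprM; lra.
  rewrite RintegralZl//; last exact: integrable_expR_pow4.
  rewrite -/I1 mulrAC ler_wpM2r ?expR_ge0// lerDl mulr_ge0//.
have ja v : mu.-integrable setT (fun a => (osc th z r (rV_cons (a, v)))%:E).
  under eq_fun do rewrite osc_cons'.
  by apply: integrable_oscint; rewrite addr_ge0 ?sqnorm_ge0.
rewrite (Rintegral_rVS' jo ja) -[X in X * _]ger0_norm ?exprn_ge0// -normrM.
have ji := integrable_rVS' jo ja.
rewrite -RintegralZl//.
apply: (@le_trans _ _ (\int[leb n]_v (D * expR (- (r ^+ 2 / 2)) *
    expR (- (sqnorm v ^+ 2 / 2))))).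
  apply: normr_Rintegral_le.
  - exact: (integrableZl measurableT _ (@integrable_expR_sqnorm2 n)).
  - by apply: measurable_funM => //; apply/measurable_EFinP; exact: measurable_int ji.
  - move=> v; rewrite normrM [X in X * _]ger0_norm ?exprn_ge0//.
    under eq_Rintegral do rewrite osc_cons'.
    have vr0 : 0 <= sqnorm v + r by rewrite addr_ge0 ?sqnorm_ge0.
    have := HD (th + dotmul (rV_uncons z).2 v) (z ord0 ord0) _ vr0.
    move=> /le_trans; apply; rewrite -mulrA ler_wpM2l// -expRD ler_expR.
    by have := sqrD_ge (sqnorm_ge0 v) r0; lra.
rewrite RintegralZl//; last exact: integrable_expR_sqnorm2.
by rewrite -/In mulrAC ler_wpM2r ?expR_ge0// lerDr mulr_ge0.
Qed.

End decayN.

(** * The kernel at time 1: weights, scaling, decay, continuity *)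

Section kernel_weight.
Context {R : realType}.
Local Notation mu := (@lebesgue_measure R).
Local Notation leb n := (@lebesgue_rV R n).

Lemma integral_oneDsqr :
  (\int[mu]_t ((1 + t ^+ 2)^-1)%:E = (2 * (pi / 2))%:E)%E.
Proof.
rewrite ge0_symfun_integralT//=.
- rewrite (_ : [set x | _] = [set` `[0, +oo[]); last first.
    by apply/seteqP; split => x/=; rewrite in_itv/= andbT.
  by rewrite integral0y_oneDsqr -EFinM.
- by move=> x; rewrite invr_ge0 addr_ge0 ?sqr_ge0.
- exact: continuous_oneDsqrV.
- by move=> x/=; rewrite sqrrN.
Qed.

Lemma measurable_oneDsqrV : measurable_fun setT (fun t : R => (1 + t ^+ 2)^-1).
Proof. by apply: continuous_measurable_fun; exact: continuous_oneDsqrV. Qed.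

Definition weight n (m : nat) (z : 'rV[R]_n) : R := (1 + `|z|) ^- m.

Lemma weight_ge0 n m (z : 'rV[R]_n) : 0 <= weight m z.
Proof. by rewrite invr_ge0 exprn_ge0// addr_ge0. Qed.

Lemma norm1D_gt0 n (z : 'rV[R]_n) : 0 < 1 + `|z|.
Proof. by rewrite ltr_wpDr. Qed.

Lemma measurable_rV_norm n : measurable_fun setT (fun z : 'rV[R]_n => `|z|).
Proof. by apply: continuous_measurable_rV => z; exact: norm_continuous. Qed.

Lemma measurable_weight n m : measurable_fun setT (@weight n m).
Proof.
apply: continuous_measurable_rV => z.
have cD : 1 + `|x| @[x --> z] --> 1 + `|z|.
  by apply: (@cvgD _ _ _ (nbhs z)); [exact: cvg_cst|exact: norm_continuous].
have cX : (1 + `|x|) ^+ m @[x --> z] --> (1 + `|z|) ^+ m.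
  exact: (continuous_comp cD (@exprn_continuous R m _)).
by apply: (@cvgV _ _ (nbhs z) _ _ _ _ cX); rewrite expf_neq0// gt_eqF// norm1D_gt0.
Qed.

Lemma le_weight n m k (z : 'rV[R]_n) : (m <= k)%N -> weight k z <= weight m z.
Proof.
move=> mk; rewrite lef_pV2 ?posrE ?exprn_gt0 ?norm1D_gt0//.
by rewrite ler_weXn2l// lerDl.
Qed.

Lemma weightS n m (z : 'rV[R]_n) : weight m.+1 z = (1 + `|z|)^-1 * weight m z.
Proof. by rewrite /weight exprS invfM. Qed.

(** As 1 + v_i^2 <= (1 + |v|)^2 for every i, 2n powers dominate a product of n functions 1/(1 +
    v_i^2). *)
Lemma integrable_weight n m : (2 * n <= m)%N ->
  (leb n).-integrable setT (EFin \o @weight n m).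
Proof.
move=> nm; have f0 (t : R) : 0 <= (1 + t ^+ 2)^-1.
  by rewrite invr_ge0 addr_ge0 ?sqr_ge0.
have m1 k : measurable_fun setT (fun v : 'rV[R]_k => \prod_(i < k) (1 + (v ord0 i) ^+ 2)^-1).
  apply: measurable_prod => i _; apply: (measurableT_comp measurable_oneDsqrV).
  exact: measurable_rV_coord.
have I1 : (\int[leb n]_v (\prod_(i < n) (1 + (v ord0 i) ^+ 2)^-1)%:E <=
    ((2 * (pi / 2)) ^+ n)%:E)%E.
  rewrite (@ge0_integral_rV_prod R n (fun t => (1 + t ^+ 2)^-1) measurable_oneDsqrV f0).
  by rewrite integral_oneDsqr EFin_expe.
have [j1 _] := @ge0_integrable_le _ _ R (leb n)
  (fun v : 'rV[R]_n => \prod_(i < n) (1 + (v ord0 i) ^+ 2)^-1)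
  ((2 * (pi / 2)) ^+ n) (m1 n) (fun v => prodr_ge0 _ (fun i _ => f0 _)) I1.
apply: (integrable_dominated j1); first exact: measurable_weight.
move=> v; rewrite ger0_norm ?weight_ge0// (le_trans (le_weight v nm))//.
rewrite prodfV lef_pV2 ?posrE ?exprn_gt0 ?norm1D_gt0//; last first.
  by apply: prodr_gt0 => i _; rewrite ltr_wpDr// sqr_ge0.
rewrite exprM -[X in (_ ^+ 2) ^+ X]card_ord -prodr_const.
apply: ler_prod => i _; rewrite addr_ge0 ?sqr_ge0//=.
have := rV_coord_le_norm v i; have := normr_ge0 (v ord0 i).
rewrite -[v ord0 i ^+ 2]real_normK ?num_real//.
by move: (`|v ord0 i|) (`|v|) => s S; nra.
Qed.

Lemma rV_norm_coord n (z : 'rV[R]_n) : (0 < n)%N -> exists i, `|z| = `|z ord0 i|.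
Proof.
case: n z => // n z _.
apply: contrapT => H; suff : `|z| < `|z| by rewrite ltxx.
have [z0|z0] := eqVneq `|z| 0.
  exfalso; apply: H; exists ord0; apply/eqP.
  by rewrite eq_le rV_coord_le_norm z0 normr_ge0.
apply: rV_norm_lt => [|i]; first by rewrite lt0r z0 normr_ge0.
by rewrite lt_neqAle rV_coord_le_norm andbT; apply/eqP => E; apply: H; exists i.
Qed.

End kernel_weight.

Section kernel.
Context {R : realType}.
Variable N : nat.
Hypothesis N0 : (0 < N)%N.
Local Notation mu := (@lebesgue_measure R).
Local Notation leb n := (@lebesgue_rV R n).
Local Notation G := (fun z : 'rV[R]_N => heat_kernel z 1).

Lemma enormE (v : 'rV[R]_N) : enorm v ^+ 2 = sqnorm v.
Proof. by rewrite /enorm sqr_sqrtr// sqnorm_ge0. Qed.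

Lemma heat_kernelE (x : 'rV[R]_N) t : heat_kernel x t =
  (2 * pi) ^- N * \int[leb N]_v (cos (dotmul x v) * expR (- (t * sqnorm v ^+ 2))).
Proof.
rewrite /heat_kernel /heat_kernelC /integralC/= [X in _ - X = _]mul0r subr0.
congr (_ * _).
apply: eq_Rintegral => v _; rewrite /expC /=.
rewrite !(mul0r, mul1r, mulr0, addr0, subr0, sub0r, oppr0, add0r) mulrC.
by rewrite -enormE -exprM.
Qed.

Lemma heat_kernel1E (x : 'rV[R]_N) :
  heat_kernel x 1 = (2 * pi) ^- N * \int[leb N]_v osc 0 x 0 v.
Proof.
rewrite heat_kernelE; congr (_ * _); apply: eq_Rintegral => v _.
by rewrite /osc add0r addr0 mul1r.
Qed.

Lemma twopiN_gt0 : 0 < (2 * pi) ^- N :> R.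
Proof. by rewrite invr_gt0 exprn_gt0// mulr_gt0// pi_gt0. Qed.

(** The frequency variable is dilated by tau. Writing times as tau^4 keeps fourth roots out of the
    kernel estimates. *)
Lemma heat_kernel_scale (x : 'rV[R]_N) (tau : R) : 0 < tau ->
  heat_kernel x (tau ^+ 4) = tau ^- N * heat_kernel (tau^-1 *: x) 1.
Proof.
move=> t0; have tn0 : tau != 0 by rewrite gt_eqF.
rewrite heat_kernel1E heat_kernelE mulrCA; congr (_ * _).
rewrite (Rintegral_rV_affine 0 tn0 (integrable_osc _ _ (lexx 0))).
rewrite gtr0_norm// mulKf ?expf_neq0//; apply: eq_Rintegral => v _.
rewrite /osc !add0r addr0; congr (cos _ * expR (- _)).
  rewrite /dotmul; apply: eq_bigr => i _; rewrite !mxE.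
  by field.
have -> : sqnorm (tau *: v) = tau ^+ 2 * sqnorm v.
  by rewrite /sqnorm mulr_sumr; apply: eq_bigr => i _; rewrite mxE exprMn.
by ring.
Qed.

(** The substitution y = x - tau z moves all dependence on time from the kernel into the argument of
    f. *)
Lemma semigroupE (f : 'rV[R]_N -> R) (x : 'rV[R]_N) (tau : R) : 0 < tau ->
  (leb N).-integrable setT (fun z => (G z * f (x - tau *: z))%:E) ->
  semigroup (tau ^+ 4) f x = \int[leb N]_z (G z * f (x - tau *: z)).
Proof.
move=> t0 jh; have tn0 : tau != 0 by rewrite gt_eqF.
have tn1 : - tau^-1 != 0 by rewrite oppr_eq0 invr_eq0.
rewrite (Rintegral_rV_affine (f := fun z => G z * f (x - tau *: z))
  (tau^-1 *: x) tn1 jh).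
rewrite normrN gtr0_norm ?invr_gt0// /semigroup.
rewrite -RintegralZl//; last exact: (integrable_rV_affine _ tn1 jh).
apply: eq_Rintegral => y _; rewrite heat_kernel_scale// exprVn -!mulrA.
by rewrite scaleNr -scalerBr scalerA divff// scale1r subKr.
Qed.

(** [rV_decay] is applied to a coordinate that realizes the sup norm, with exponent 0 for |z| <= 1
    and m for |z| > 1; the factor 2^m comes from 1 + |z| <= 2 max(1, |z|). *)
Lemma heat_kernel_decay m : exists2 C, 0 <= C & forall z, `|G z| <= C * weight m z.
Proof.
have [C C0 HC] := @rV_decay R m N; have [D D0 HD] := @rV_decay R 0 N.
have c0 := twopiN_gt0.
exists ((2 * pi) ^- N * (2 ^+ m * (C + D))).
  by rewrite mulr_ge0 ?mulr_ge0 ?addr_ge0 ?(ltW c0).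
move=> z; rewrite heat_kernel1E normrM gtr0_norm// -mulrA ler_wpM2l ?(ltW c0)//.
rewrite ler_pdivlMr ?exprn_gt0 ?norm1D_gt0//.
have [i zi] := rV_norm_coord z N0.
have := HC 0 z 0 i (lexx 0); have := HD 0 z 0 i (lexx 0).
rewrite expr0 mul1r expr0n/= mul0r oppr0 expR0 !mulr1 -zi => HJ HI.
set J := `|_| in HJ HI *; have J0 : 0 <= J by exact: normr_ge0.
have [z1|z1] := leP `|z| 1.
  rewrite mulrC ler_pM ?exprn_ge0 ?addr_ge0//.
    by rewrite lerXn2r ?nnegrE ?addr_ge0//; lra.
  by rewrite (le_trans HJ)// lerDr.
rewrite (@le_trans _ _ (2 ^+ m * (`|z| ^+ m * J)))//; last first.
  by rewrite ler_wpM2l ?exprn_ge0// (le_trans HI)// lerDl.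
rewrite mulrA -exprMn mulrC ler_wpM2r// lerXn2r ?nnegrE ?addr_ge0 ?mulr_ge0//.
by lra.
Qed.

Lemma continuous_dotmul (v z0 : 'rV[R]_N) : dotmul z v @[z --> z0] --> dotmul z0 v.
Proof.
rewrite /dotmul; elim: (index_enum _) => [|i s IH].
  rewrite big_nil; under eq_cvg do rewrite big_nil.
  exact: (@cvg_cst _ _ _ (nbhs z0)).
rewrite big_cons; under eq_cvg do rewrite big_cons.
apply: (@cvgD _ _ _ (nbhs z0)) => //.
apply: (@cvgM _ _ (nbhs z0)); last exact: (@cvg_cst _ _ _ (nbhs z0)).
exact: coord_continuous.
Qed.

Lemma continuous_heat_kernel1 : continuous G.
Proof.
move=> z0; rewrite (_ : (fun z => heat_kernel z 1) = fun z : 'rV[R]_N =>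
    (2 * pi) ^- N * \int[leb N]_v osc 0 z 0 v); last first.
  by apply/funext => z; exact: heat_kernel1E.
apply: (@cvgM _ _ (nbhs z0)); first exact: cvg_cst.
apply: (@cvg_Rintegral_dominated _ _ R (leb N) _ z0 (fun z => osc 0 z 0)
  (fun v => expR (- (sqnorm v ^+ 2 / 2))) set0) => //.
- exact: integrable_expR_sqnorm2.
- by apply: (@nearW _ (nbhs z0)) => z; exact: measurable_osc.
- by apply: (@nearW _ (nbhs z0)) => z v _; exact: osc_le.
- move=> v _; apply: (@cvgM _ _ (nbhs z0)); last exact: cvg_cst.
  apply: (@continuous_comp _ _ _ (fun z : 'rV[R]_N => 0 + dotmul z v)); last exact: continuous_cos.
  by apply: (@cvgD _ _ _ (nbhs z0)); [exact: cvg_cst|exact: continuous_dotmul].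
Qed.

Lemma measurable_heat_kernel1 : measurable_fun setT G.
Proof. exact: (continuous_measurable_rV continuous_heat_kernel1). Qed.

End kernel.

(** * Mass of the heat kernel *)

Section laplace.
Context {R : realType}.
Local Notation mu := (@lebesgue_measure R).
Local Notation leb n := (@lebesgue_rV R n).

Lemma expRN_norm_le (t : R) : expR (- `|t|) <= 4 * (1 + t ^+ 2)^-1.
Proof.
rewrite expRN -[4]invrK -invfM lef_pV2 ?posrE ?expR_gt0 ?mulr_gt0 ?invr_gt0//;
  last by rewrite ltr_wpDr// sqr_ge0.
have -> : expR `|t| = expR (`|t| / 2) ^+ 2.
  by rewrite -expRM_natr; congr expR; field.
have := expR_ge1Dx (`|t| / 2); rewrite -[t ^+ 2]real_normK ?num_real//.
have := normr_ge0 t; move: (`|t|) (expR _) => s e; nra.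
Qed.

Lemma continuous_expRN_norm : continuous (fun t : R => expR (- `|t|)).
Proof.
move=> t; apply: continuous_comp; last exact: continuous_expR.
by apply: cvgN; exact: norm_continuous.
Qed.

Lemma integrable_expRN_norm : mu.-integrable setT (fun t : R => (expR (- `|t|))%:E).
Proof.
have [j1 _] := @ge0_integrable_le _ _ R mu (fun t : R => (1 + t ^+ 2)^-1)
  (2 * (pi / 2)) measurable_oneDsqrV (fun t => eq_ind_r _ (addr_ge0 ler01 (sqr_ge0 t)) (invr_ge0 _))
  (eq_ind_r (fun x => (x <= _)%E) (lexx _) integral_oneDsqr).
apply: (@integrable_dominated _ _ R mu (fun t : R => expR (- `|t|))
  (fun t : R => 4 * (1 + t ^+ 2)^-1)).
- exact: (integrableZl measurableT _ j1).
- by apply: continuous_measurable_fun; exact: continuous_expRN_norm.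
- by move=> t; rewrite ger0_norm ?expR_ge0// expRN_norm_le.
Qed.

(** A primitive of cos(th + s t) exp(e t) if e^2 = 1: the sign e = 1 serves t <= 0 and e = -1 serves
    t >= 0, where exp(e t) is exp(-|t|). *)
Definition laplace_prim (e th s t : R) : R :=
  expR (e * t) * (s * sin (th + s * t) + e * cos (th + s * t)) / (1 + s ^+ 2).

Lemma is_derive_laplace_prim (e th s t : R) : e ^+ 2 = 1 ->
  is_derive t 1 (laplace_prim e th s) (cos (th + s * t) * expR (e * t)).
Proof.
move=> e1; have s1 : 1 + s ^+ 2 != 0 by rewrite gt_eqF// ltr_wpDr// sqr_ge0.
apply: is_derive_eq; rewrite /GRing.scale/=.
apply/eqP; rewrite -subr_eq0; apply/eqP.
have -> : 1 + s ^+ 2 = e ^+ 2 + s ^+ 2 by rewrite e1.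
field.
by rewrite e1.
Qed.

Lemma integrable_laplace1 (th s : R) :
  mu.-integrable setT (fun t : R => (cos (th + s * t) * expR (- `|t|))%:E).
Proof.
apply: (@integrable_dominated _ _ R mu (fun t : R => cos (th + s * t) * expR (- `|t|))
  (fun t : R => expR (- `|t|))).
- exact: integrable_expRN_norm.
- apply: continuous_measurable_fun => t.
  apply: cvgM; last exact: continuous_expRN_norm.
  apply: continuous_comp; last exact: continuous_cos.
  by apply: cvgD; [exact: cvg_cst|apply: cvgM; [exact: cvg_cst|exact: cvg_id]].
- move=> t; rewrite (le_trans (normrM_cos_le _ _))// ger0_norm//.
Qed.

Lemma laplace1 (th s : R) : \int[mu]_t (cos (th + s * t) * expR (- `|t|)) =
  cos th * (2 / (1 + s ^+ 2)).
Proof.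
have jf := integrable_laplace1 th s.
have lim1 := cvg_Rintegral_symitv jf.
rewrite -(cvg_lim _ lim1)//; apply/cvg_lim => //.
have s1 : 0 < 1 + s ^+ 2 by rewrite ltr_wpDr// sqr_ge0.
have FTC (e a b : R) : e ^+ 2 = 1 -> a < b ->
    \int[mu]_(t in [set` `[a, b]]) (cos (th + s * t) * expR (e * t)) =
    laplace_prim e th s b - laplace_prim e th s a.
  move=> e1 ab; rewrite /Rintegral.
  rewrite (@continuous_FTC2 _ (fun t => cos (th + s * t) * expR (e * t))
    (laplace_prim e th s)) //.
  - apply: continuous_subspaceT => t; apply: cvgM.
      apply: continuous_comp; last exact: continuous_cos.
      by apply: cvgD; [exact: cvg_cst|apply: cvgM; [exact: cvg_cst|exact: cvg_id]].
    apply: continuous_comp; last exact: continuous_expR.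
    by apply: cvgM; [exact: cvg_cst|exact: cvg_id].
  - have cF (x : R) : {for x, continuous (laplace_prim e th s)}.
      apply: differentiable_continuous; apply/derivable1_diffP.
      by case: (is_derive_laplace_prim th s x e1).
    split; [|exact/cvg_at_right_filter/cF|exact/cvg_at_left_filter/cF].
    by move=> x _; case: (is_derive_laplace_prim th s x e1).
  - by move=> x _; rewrite derive1E; case: (is_derive_laplace_prim th s x e1).
have E n : \int[mu]_(t in [set` `[(- n.+1%:R), n.+1%:R]])
      (cos (th + s * t) * expR (- `|t|)) =
    cos th * (2 / (1 + s ^+ 2)) +
    (laplace_prim (-1) th s n.+1%:R - laplace_prim 1 th s (- n.+1%:R)).
  have n0 : (0 : R) < n.+1%:R by [].
  have jS D : measurable D ->
      mu.-integrable D (fun t : R => (cos (th + s * t) * expR (- `|t|))%:E).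
    by move=> mD; apply: (integrableS measurableT).
  have -> : [set` `[(- n.+1%:R), n.+1%:R]] =
      [set` `[(- n.+1%:R), 0%R]] `|` [set` `]0%R, n.+1%:R]] :> set R.
    apply/seteqP; split=> x /=; rewrite !in_itv/=.
      by move=> /andP[-> ->]; rewrite andbT; case: (leP x 0) => H; [left|right].
    by move=> [/andP[-> x0]|/andP[x0 ->]]; rewrite ?andbT /=; lra.
  rewrite Rintegral_setU//; last 2 first.
  - by apply: jS; exact: measurableU.
  - apply/disj_set2P; rewrite -subset0 => x [] /=; rewrite !in_itv/=.
    by move=> /andP[_ +] /andP[+ _]; rewrite leNgt => /negP.
  rewrite Rintegral_itv_obnd_cbnd; last exact: jS.
  rewrite (@eq_Rintegral _ _ _ mu _ (fun t => cos (th + s * t) * expR (1 * t)));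
    last first.
    by move=> x; rewrite inE/= in_itv/= => /andP[_ x0]; rewrite ler0_norm// opprK mul1r.
  rewrite [X in _ + X](@eq_Rintegral _ _ _ mu _
    (fun t => cos (th + s * t) * expR (-1 * t))); last first.
    by move=> x; rewrite inE/= in_itv/= => /andP[x0 _]; rewrite ger0_norm// mulN1r.
  (* At t = 0 the sine terms of the two primitives cancel and the cosine terms add up to 2 cos th /
     (1 + s^2). *)
  rewrite (FTC 1) ?expr1n ?oppr_lt0// (FTC (-1)) ?sqrrN ?expr1n//.
  rewrite /laplace_prim !mulr0 addr0 expR0; field; exact: lt0r_neq0.
rewrite (funext E).
suff H : laplace_prim (-1) th s n.+1%:R - laplace_prim 1 th s (- n.+1%:R)
    @[n --> \oo] --> (0 : R).
  have := cvgD (@cvg_cst _ (cos th * (2 / (1 + s ^+ 2))) _ \oo _) H.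
  by rewrite addr0; exact.
apply: (@cvg_norm_harmonic _ _ (2 * ((`|s| + 1) / (1 + s ^+ 2)))) => n.
set x : R := n.+1%:R; have x0 : 0 < x by rewrite ltr0n.
have ex : expR (- x) <= x^-1.
  by rewrite expRN lef_pV2 ?posrE ?expR_gt0// (le_trans _ (expR_ge1Dx _))// lerDr.
have B (e y : R) : `|e| = 1 -> expR (e * y) = expR (- x) ->
    `|laplace_prim e th s y| <= (`|s| + 1) / (1 + s ^+ 2) * x^-1.
  move=> e1 ey; rewrite /laplace_prim ey !normrM normfV (gtr0_norm s1).
  rewrite [X in X * _ * _]ger0_norm ?expR_ge0// -mulrA mulrC ler_pM//.
  - by rewrite mulr_ge0 ?invr_ge0 ?(ltW s1).
  - rewrite ler_wpM2r ?invr_ge0 ?(ltW s1)// (le_trans (ler_normD _ _))//.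
    rewrite !normrM e1 mul1r lerD//; last by rewrite ler_norml cos_geN1 cos_le1.
    by rewrite ler_piMr// ler_norml sin_geN1 sin_le1.
rewrite (le_trans (ler_normB _ _))// -mulrA mulr_natl mulr2n lerD// B//.
- by rewrite normrN normr1.
- by rewrite mulN1r.
- by rewrite normr1.
- by rewrite mul1r.
Qed.

(** exp(-|v|_1): the l1 norm makes it factor over the coordinates, and so does its Fourier
    transform. *)
Definition exp1norm n (v : 'rV[R]_n) : R := \prod_(i < n) expR (- `|v ord0 i|).

Lemma exp1norm_ge0 n (v : 'rV[R]_n) : 0 <= exp1norm v.
Proof. by apply: prodr_ge0 => i _; rewrite expR_ge0. Qed.

Lemma measurable_exp1norm n : measurable_fun setT (@exp1norm n).
Proof.
apply: measurable_prod => i _.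
apply: (measurableT_comp (continuous_measurable_fun continuous_expRN_norm)).
exact: measurable_rV_coord.
Qed.

Lemma exp1norm_cons n a (v : 'rV[R]_n) :
  exp1norm (rV_cons (a, v)) = expR (- `|a|) * exp1norm v.
Proof.
rewrite /exp1norm big_ord_recl rV_cons0; congr (_ * _).
by apply: eq_bigr => i _; rewrite rV_consS.
Qed.

Lemma integrable_exp1norm n : (leb n).-integrable setT (EFin \o @exp1norm n).
Proof.
apply/integrableP; split; first by apply/measurable_EFinP; exact: measurable_exp1norm.
under eq_integral do rewrite /= ger0_norm ?exp1norm_ge0//.
rewrite (@ge0_integral_rV_prod R n (fun t => expR (- `|t|))); last 2 first.
- exact: (continuous_measurable_fun continuous_expRN_norm).
- by move=> x; rewrite expR_ge0.
by rewrite -(EFin_Rintegral integrable_expRN_norm) -EFin_expe ltry.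
Qed.

Lemma dotmulC n (x y : 'rV[R]_n) : dotmul x y = dotmul y x.
Proof. by apply: eq_bigr => i _; rewrite mulrC. Qed.

Lemma measurable_laplace n th (xi : 'rV[R]_n) :
  measurable_fun setT (fun y => cos (th + dotmul xi y) * exp1norm y).
Proof.
apply: measurable_funM; last exact: measurable_exp1norm.
have mcos : measurable_fun [set: R] (cos : R -> R).
  by apply: continuous_measurable_fun => u; exact: continuous_cos.
apply: (measurableT_comp mcos); apply: measurable_funD => //.
exact: measurable_dotmul.
Qed.

Lemma integrable_laplace n th (xi : 'rV[R]_n) :
  (leb n).-integrable setT (fun y => (cos (th + dotmul xi y) * exp1norm y)%:E).
Proof.
apply: (@integrable_dominated _ _ R (leb n)
  (fun y => cos (th + dotmul xi y) * exp1norm y) (@exp1norm n)).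
- exact: integrable_exp1norm.
- exact: measurable_laplace.
- by move=> y; rewrite (le_trans (normrM_cos_le _ _))// ger0_norm ?exp1norm_ge0.
Qed.

(** Coordinates are integrated one at a time; [laplace1] gives back a cosine of its phase, which is
    the integrand of the same problem in one dimension less. *)
Lemma laplaceN n th (xi : 'rV[R]_n) :
  \int[leb n]_y (cos (th + dotmul xi y) * exp1norm y) =
  cos th * \prod_(i < n) (2 / (1 + xi ord0 i ^+ 2)).
Proof.
elim: n th xi => [|n IH] th xi.
  rewrite big_ord0 mulr1 /Rintegral.
  rewrite (eq_integral (fun=> (cos th)%:E)); last first.
    by move=> y _; rewrite /dotmul /exp1norm !big_ord0 addr0 mulr1.
  have -> : (\int[leb 0]_y (cos th)%:E = (cos th)%:E)%E.
    by rewrite integral_cst//= diracE mem_set// mule1.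
  by [].
have E a v : cos (th + dotmul xi (rV_cons (a, v))) * exp1norm (rV_cons (a, v)) =
    (cos (th + dotmul (rV_uncons xi).2 v + xi ord0 ord0 * a) * expR (- `|a|)) *
    exp1norm v.
  by rewrite dotmul_cons exp1norm_cons mulrA addrA addrAC.
rewrite (Rintegral_rVS' (integrable_laplace th xi)); last first.
  move=> v; under eq_fun do rewrite E.
  exact: (integrableZr measurableT _ (integrable_laplace1 _ _)).
under eq_Rintegral => v _.
  under eq_Rintegral do rewrite E.
  rewrite RintegralZr//; last exact: integrable_laplace1.
  rewrite laplace1 mulrAC.
  over.
rewrite RintegralZr//; last exact: integrable_laplace.
rewrite IH big_ord_recl mulrAC -mulrA.
congr (_ * (_ * _)).
by apply: eq_bigr => i _; rewrite mxE.
Qed.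

Lemma prod_oneDsqr_ge0 n (xi : 'rV[R]_n) :
  0 <= \prod_(i < n) (2 / (1 + xi ord0 i ^+ 2)).
Proof. by apply: prodr_ge0 => i _; rewrite divr_ge0// addr_ge0 ?sqr_ge0. Qed.

Section positive_mass.
Variable N : nat.
Hypothesis N0 : (0 < N)%N.
Local Notation G := (fun z : 'rV[R]_N => heat_kernel z 1).

Lemma integrable_expR_sqnorm_scale n (tau : R) : 0 < tau ->
  (leb n).-integrable setT (fun v => (expR (- (tau ^+ 4 * sqnorm v ^+ 2)))%:E).
Proof.
move=> t0; have tn0 : tau != 0 by rewrite gt_eqF.
have := integrable_rV_affine 0 tn0 (integrable_osc 0 (0 : 'rV[R]_n) (lexx 0)).
apply: eq_integrable => // v _; rewrite /osc !add0r addr0.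
have -> : sqnorm (tau *: v) = tau ^+ 2 * sqnorm v.
  by rewrite /sqnorm mulr_sumr; apply: eq_bigr => i _; rewrite mxE exprMn.
have -> : dotmul 0 (tau *: v) = 0.
  by apply: big1 => i _; rewrite mxE mul0r.
by rewrite cos0 mul1r exprMn -exprM.
Qed.

Lemma heat_kernel_mulr (tau : R) (y : 'rV[R]_N) (c : R) : 0 < tau ->
  heat_kernel y (tau ^+ 4) * c = (2 * pi) ^- N *
    \int[leb N]_v (cos (dotmul y v) * c * expR (- (tau ^+ 4 * sqnorm v ^+ 2))).
Proof.
move=> t0; pose h v := cos (dotmul y v) * expR (- (tau ^+ 4 * sqnorm v ^+ 2)).
have jg := integrable_expR_sqnorm_scale N t0.
have jh : (leb N).-integrable setT (EFin \o h).
  apply: (integrable_dominated jg).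
  - apply: measurable_funM; last by apply/measurable_EFinP; exact: measurable_int jg.
    have mcos : measurable_fun [set: R] (cos : R -> R).
      by apply: continuous_measurable_fun => u; exact: continuous_cos.
    by apply: (measurableT_comp mcos); exact: measurable_dotmul.
  - by move=> v; rewrite (le_trans (normrM_cos_le _ _))// ger0_norm ?expR_ge0.
have E := RintegralZr c measurableT jh.
rewrite heat_kernelE -mulrA; congr (_ * _).
rewrite -[LHS]/((\int[leb N]_v h v) * c) -E.
by apply: eq_Rintegral => v _; rewrite /h mulrAC.
Qed.

Lemma laplaceN_mulr (v : 'rV[R]_N) (c : R) :
  \int[leb N]_y (cos (dotmul y v) * exp1norm y * c) =
  c * \prod_(i < N) (2 / (1 + v ord0 i ^+ 2)).
Proof.
have := laplaceN 0 v; rewrite cos0 mul1r => <-.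
rewrite mulrC -(RintegralZr _ measurableT (integrable_laplace 0 v)).
by apply: eq_Rintegral => y _; rewrite add0r dotmulC.
Qed.

(** The multiplication formula for Fourier transforms: exchanging the integrals in y and in
    frequency moves the transform from the symbol to [exp1norm], where [laplaceN] evaluates it. *)
Lemma mass_identity (t : R) : (exists2 tau, 0 < tau & t = tau ^+ 4) ->
  \int[leb N]_y (heat_kernel y t * exp1norm y) =
  (2 * pi) ^- N * \int[leb N]_v (expR (- (t * sqnorm v ^+ 2)) *
    \prod_(i < N) (2 / (1 + v ord0 i ^+ 2))).
Proof.
move=> [tau t0 ->]; set g := fun v : 'rV[R]_N => expR (- (tau ^+ 4 * sqnorm v ^+ 2)).
have jg : (leb N).-integrable setT (EFin \o g) := integrable_expR_sqnorm_scale N t0.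
have mg : measurable_fun setT g by apply/measurable_EFinP; exact: measurable_int jg.
pose Phi (p : 'rV[R]_N * 'rV[R]_N) : R :=
  cos (dotmul p.1 p.2) * exp1norm p.1 * g p.2.
have mPhi : measurable_fun setT Phi.
  apply: measurable_funM; last exact: (measurableT_comp mg).
  apply: measurable_funM; last exact: (measurableT_comp (@measurable_exp1norm N)).
  have mcos : measurable_fun [set: R] (cos : R -> R).
    by apply: continuous_measurable_fun => u; exact: continuous_cos.
  apply: (measurableT_comp mcos); apply: measurable_sum => i.
  apply: measurable_funM.
    exact: (measurableT_comp (measurable_rV_coord i) measurable_fst).
  exact: (measurableT_comp (measurable_rV_coord i) measurable_snd).
have Phi_le p : `|Phi p| <= exp1norm p.1 * g p.2.
  rewrite /Phi -mulrA (le_trans (normrM_cos_le _ _))// ger0_norm//.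
  by rewrite mulr_ge0 ?exp1norm_ge0 ?expR_ge0.
have jPhi : (leb N \x leb N)%E.-integrable setT (EFin \o Phi).
  apply/integrable12ltyP; first exact/measurable_EFinP.
  have jE := @integrable_exp1norm N.
  apply: (@le_lt_trans _ _ (\int[leb N]_x (exp1norm x * \int[leb N]_v g v)%:E)%E).
    apply: ge0_le_integral => //.
    - move=> x _; exact: integral_ge0.
    - apply: (measurable_fun_fubini_tonelli_F (m2 := leb N) (fun p => `|(Phi p)%:E|%E)) => //.
      by do 2 apply: measurableT_comp => //.
    - by apply/measurable_EFinP; apply: measurable_funM => //; exact: measurable_exp1norm.
    - move=> x _; rewrite EFinM EFin_Rintegral// -ge0_integralZl_EFin ?exp1norm_ge0//; last 2 first.
      + by move=> v _; rewrite lee_fin expR_ge0.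
      + exact: measurable_int jg.
      apply: ge0_le_integral => //.
      + apply: measurableT_comp => //; apply/measurable_EFinP.
        exact: (measurableT_comp mPhi (pair1_measurable x)).
      + by apply: measurable_funeM; exact: measurable_int jg.
      + by move=> v _; rewrite /= -EFinM lee_fin; exact: (Phi_le (x, v)).
  by have := integrableZr measurableT (\int[leb N]_v g v) jE => /integrable_lty; apply.
have jy y : (leb N).-integrable setT (fun v => (Phi (y, v))%:E).
  apply: (@integrable_dominated _ _ R (leb N) (fun v => Phi (y, v))
    (fun v => exp1norm y * g v)).
  - exact: (integrableZl measurableT _ jg).
  - exact: (measurableT_comp mPhi (pair1_measurable y)).
  - by move=> v; exact: Phi_le.
have jv v : (leb N).-integrable setT (fun y => (Phi (y, v))%:E).
  apply: (@integrable_dominated _ _ R (leb N) (fun y => Phi (y, v))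
    (fun y => exp1norm y * g v)).
  - exact: (integrableZr measurableT _ (@integrable_exp1norm N)).
  - exact: (measurableT_comp mPhi (pair2_measurable v)).
  - by move=> y; exact: Phi_le.
have swap : \int[leb N]_y \int[leb N]_v Phi (y, v) = \int[leb N]_v \int[leb N]_y Phi (y, v).
  exact: (Rintegral_Fubini jPhi jy jv).
have LE y : heat_kernel y (tau ^+ 4) * exp1norm y =
    (2 * pi) ^- N * \int[leb N]_v Phi (y, v).
  exact: heat_kernel_mulr.
have RE v : \int[leb N]_y Phi (y, v) =
    g v * \prod_(i < N) (2 / (1 + v ord0 i ^+ 2)).
  exact: (laplaceN_mulr v (g v)).
have jR : (leb N).-integrable setT (fun y => (\int[leb N]_v Phi (y, v))%:E).
  exact: (integrable_Rintegral1 jPhi jy).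
transitivity (\int[leb N]_y ((2 * pi) ^- N * \int[leb N]_v Phi (y, v))).
  by apply: eq_Rintegral => y _; exact: LE.
rewrite (RintegralZl _ measurableT jR) swap; congr (_ * _).
by apply: eq_Rintegral => v _; exact: RE.
Qed.

Lemma integrable_mass_lower (t : R) : (exists2 tau, 0 < tau & t = tau ^+ 4) ->
  (leb N).-integrable setT (fun v => (expR (- (t * sqnorm v ^+ 2)) *
    \prod_(i < N) (2 / (1 + v ord0 i ^+ 2)))%:E).
Proof.
move=> [tau t0 ->]; have jg := integrable_expR_sqnorm_scale N t0.
have mp : measurable_fun setT (fun v : 'rV[R]_N => \prod_(i < N) (2 / (1 + v ord0 i ^+ 2))).
  apply: measurable_prod => i _.
  have mV : measurable_fun setT (fun s : R => 2 / (1 + s ^+ 2)).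
    by apply: measurable_funM => //; exact: measurable_oneDsqrV.
  by apply: (measurableT_comp mV); exact: measurable_rV_coord.
apply: (@integrable_dominated _ _ R (leb N) (fun v => expR (- (tau ^+ 4 * sqnorm v ^+ 2)) *
    \prod_(i < N) (2 / (1 + v ord0 i ^+ 2)))
  (fun v => expR (- (tau ^+ 4 * sqnorm v ^+ 2)) * 2 ^+ N)).
- exact: (integrableZr measurableT _ jg).
- by apply: measurable_funM => //; apply/measurable_EFinP; exact: measurable_int jg.
- move=> v; rewrite ger0_norm ?mulr_ge0 ?prod_oneDsqr_ge0 ?expR_ge0//.
  rewrite ler_wpM2l ?expR_ge0// -[X in _ ^+ X]card_ord -prodr_const.
  apply: ler_prod => i _; rewrite divr_ge0 ?addr_ge0 ?sqr_ge0//=.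
  by rewrite ler_pdivrMr ?ltr_wpDr ?sqr_ge0// ler_peMr// lerDl sqr_ge0.
Qed.

(** On the unit cube |v|^2 <= N and every factor 2/(1 + v_i^2) is at least 1, so the integral is at
    least exp(-N^2). *)
Lemma mass_lower_gt0 : 0 < \int[leb N]_v (expR (- (1 * sqnorm v ^+ 2)) *
    \prod_(i < N) (2 / (1 + v ord0 i ^+ 2))).
Proof.
pose B : set 'rV[R]_N := [set v | forall i, [set` `[0%R, 1%R]] (v ord0 i)].
have mB : measurable B.
  by apply: (@measurable_rV_box R N (fun=> [set` `[0%R, 1%R]])).
have B1 : leb N B = 1%E.
  rewrite /B (@lebesgue_rV_box R N (fun=> [set` `[0%R, 1%R]]))//.
  rewrite big1// => i _; rewrite lebesgue_measure_itv/= lte_fin ltr01.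
  by rewrite -EFinB subr0.
have jB : (leb N).-integrable setT (EFin \o (\1_B : 'rV[R]_N -> R)).
  have [] := @ge0_integrable_le _ _ R (leb N) (\1_B : 'rV[R]_N -> R) 1; rewrite //.
    by rewrite integral_indic// setIT le_eqVlt; apply/orP; left; apply/eqP; exact: B1.
have e0 : 0 < expR (- (N%:R ^+ 2)) :> R by rewrite expR_gt0.
apply: (@lt_le_trans _ _ (\int[leb N]_v (expR (- (N%:R ^+ 2)) * \1_B v))).
  rewrite (RintegralZl _ measurableT jB).
  rewrite mulr_gt0// /Rintegral integral_indic// setIT.
  by apply: (@lt_le_trans _ _ (fine 1%E) _ _ ltr01); exact: (eq_ind _ (fun x => fine 1%E <= fine x) (lexx _) _ (esym B1)).
apply: le_Rintegral => //.
- exact: (integrableZl measurableT _ jB).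
- by apply: integrable_mass_lower; exists 1 => //; rewrite expr1n.
move=> v _; rewrite indicE; case: (boolP (v \in B)) => [|_]; last first.
  by rewrite mulr0 mulr_ge0 ?expR_ge0 ?prod_oneDsqr_ge0.
rewrite inE mulr1 => vB.
have v1 i : v ord0 i ^+ 2 <= 1.
  by have := vB i; rewrite /= in_itv/= => /andP[? ?]; rewrite exprn_ile1.
rewrite -[leLHS]mulr1 ler_pM ?expR_ge0//.
  rewrite ler_expR lerN2 mul1r lerXn2r ?nnegrE ?sqnorm_ge0//.
  rewrite /sqnorm -[X in _ <= X%:R]card_ord -sum1_card natr_sum.
  by apply: ler_sum => i _.
apply: (@le_trans _ _ (\prod_(i < N) 1)); first by rewrite big1.
apply: ler_prod => i _; rewrite ler01/= ler_pdivlMr ?ltr_wpDr ?sqr_ge0//.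
by have := v1 i; lra.
Qed.

Lemma integrable_heat_kernel1 : (leb N).-integrable setT (EFin \o G).
Proof.
have [C C0 HC] := @heat_kernel_decay R N N0 (2 * N)%N.
apply: (integrable_dominated (g := fun z => C * weight (2 * N)%N z)) HC.
- exact: (integrableZl measurableT _ (integrable_weight (leqnn _))).
- exact: measurable_heat_kernel1.
Qed.

(* Fourier inversion is avoided by testing G against exp(-d |z|_1): the Fourier
   transform of the latter is explicit and positive, which bounds the integrals
   below by a positive constant independent of d in ]0, 1]. *)
Lemma heat_kernel_mass_gt0 : 0 < \int[leb N]_z G z.
Proof.
set c0 := (2 * pi) ^- N * \int[leb N]_v (expR (- (1 * sqnorm v ^+ 2)) *
    \prod_(i < N) (2 / (1 + v ord0 i ^+ 2))).
have c0_gt0 : 0 < c0 by rewrite mulr_gt0 ?twopiN_gt0 ?mass_lower_gt0.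
apply: (lt_le_trans c0_gt0).
have jG := integrable_heat_kernel1.
have mG : measurable_fun setT G by exact: measurable_heat_kernel1.
pose f (d : R) (z : 'rV[R]_N) := G z * exp1norm (d *: z).
have mf d : measurable_fun setT (f d).
  have md : measurable_fun setT (fun z : 'rV[R]_N => d *: z).
    have := measurable_rV_affine (0 : 'rV[R]_N) d; congr (measurable_fun _ _).
    by apply/funext => z; rewrite add0r.
  exact: measurable_funM mG (measurableT_comp (@measurable_exp1norm N) md).
have fle d z : `|f d z| <= `|G z|.
  rewrite normrM ler_piMr// ger0_norm ?exp1norm_ge0//.
  by apply: prodr_ile1 => i _; rewrite expR_ge0/= expR_le1 oppr_le0.
have jf d : (leb N).-integrable setT (EFin \o f d).
  exact: (integrable_dominated (integrable_norm jG)).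
have cf : \int[leb N]_z f d z @[d --> (0 : R)] --> \int[leb N]_z f 0 z.
  apply: (@cvg_Rintegral_dominated _ _ R (leb N) R 0 f (fun z => `|G z|) set0) => //.
  - exact: (integrable_norm jG).
  - by apply: (@nearW _ (nbhs (0 : R))) => d; exact: mf.
  - by apply: (@nearW _ (nbhs (0 : R))) => d z _; exact: fle.
  - move=> z _; apply: cvgM; first exact: cvg_cst.
    rewrite /exp1norm; elim: (index_enum _) => [|i s IH].
      by rewrite big_nil; under eq_cvg do rewrite big_nil; exact: cvg_cst.
    rewrite big_cons; under eq_cvg do rewrite big_cons.
    apply: cvgM => //; apply: continuous_comp; last exact: continuous_expR.
    apply: cvgN; apply: cvg_norm.
    under eq_cvg do rewrite mxE; rewrite mxE.
    by apply: cvgM; [exact: cvg_id|exact: cvg_cst].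
have f0 : \int[leb N]_z f 0 z = \int[leb N]_z G z.
  apply: eq_Rintegral => z _; rewrite /f scale0r /exp1norm big1 ?mulr1// => i _.
  by rewrite mxE normr0 oppr0 expR0.
rewrite -f0; have cfr := cvg_at_right_filter cf.
rewrite -(cvg_lim _ cfr)//; apply: limr_ge; first by apply/cvg_ex; eexists; exact: cfr.
near=> d; have d0 : 0 < d by near: d; exact: nbhs_right_gt.
have d1 : d <= 1 by near: d; apply: nbhs_right_le.
have dn0 : d^-1 != 0 by rewrite invr_eq0 gt_eqF.
(* The substitution z = y/d trades the dilation of [exp1norm] for the time d^4 <= 1 in the kernel;
   the frequency integral of [mass_identity] only grows when time decreases. *)
rewrite (Rintegral_rV_affine 0 dn0 (jf d)) gtr0_norm ?invr_gt0//.
rewrite -RintegralZl//; last exact: (integrable_rV_affine _ dn0 (jf d)).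
have -> : \int[leb N]_y (d^-1 ^+ N * f d (0 + d^-1 *: y)) =
    \int[leb N]_y (heat_kernel y (d ^+ 4) * exp1norm y).
  apply: eq_Rintegral => y _; rewrite /f heat_kernel_scale// add0r scalerA.
  by rewrite divff ?gt_eqF// scale1r exprVn mulrA.
rewrite mass_identity; last by exists d.
rewrite ler_wpM2l ?(ltW (twopiN_gt0 N))//.
apply: le_Rintegral => //.
- by apply: integrable_mass_lower; exists 1 => //; rewrite expr1n.
- by apply: integrable_mass_lower; exists d.
move=> v _; rewrite ler_wpM2r ?prod_oneDsqr_ge0// ler_expR lerN2.
by rewrite ler_wpM2r ?sqr_ge0// exprn_ile1// ltW.
Unshelve. all: end_near. Qed.

End positive_mass.

End laplace.

(** * Convolution with singular functions *)

Section singular.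
Context {R : realType}.
Local Notation mu := (@lebesgue_measure R).
Local Notation leb n := (@lebesgue_rV R n).

(** The coordinate hyperplanes have to be left out because [sym_powR] is 0 at 0 and a product of its
    values is no majorant there. *)
Lemma ae_coord_neq0 n : {ae leb n, forall y : 'rV[R]_n, forall i, y ord0 i != 0}.
Proof.
apply: filter_forall => i.
pose A j : set R := if j == i then [set 0] else setT.
have mA j : measurable (A j) by rewrite /A; case: ifP.
exists [set v : 'rV[R]_n | forall j, A j (v ord0 j)]; split.
- exact: (measurable_rV_box mA).
- have := @lebesgue_rV_box R n A mA; rewrite (bigD1 i)//= {2}/A eqxx.
  by rewrite lebesgue_measure_set1 mul0e.
- move=> y /= /negP; rewrite negbK => /eqP yi j.
  by rewrite /A; case: eqP => [->|//]; rewrite yi.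
Qed.

Lemma expe_le (x : \bar R) (C : R) n : (0 <= x)%E -> (x <= C%:E)%E ->
  (x ^+ n <= (C ^+ n)%:E)%E.
Proof.
case: x => [x| |] //; rewrite !lee_fin => x0 xC.
by rewrite -EFin_expe lee_fin lerXn2r ?nnegrE// (le_trans x0).
Qed.

Lemma measurable_rV_ball n (X : R) : measurable [set y : 'rV[R]_n | `|y| < X].
Proof.
have := @measurable_rV_norm R n measurableT [set` `]-oo, X[] (measurable_itv _).
by rewrite setTI; congr (measurable _); apply/seteqP; split=> y /=; rewrite in_itv.
Qed.

Definition half_powR (c t : R) : R := t `^ (- c) * \1_[set` `]0%R, 1%R]] t.

Lemma half_powR_ge0 c t : 0 <= half_powR c t.
Proof. by rewrite mulr_ge0 ?powR_ge0// indicE. Qed.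

Lemma measurable_half_powR c : measurable_fun setT (half_powR c).
Proof. by apply: measurable_funM; [exact: measurable_powR|exact: measurable_indic]. Qed.

Lemma integral_half_powR c : c < 1 ->
  (\int[mu]_t (half_powR c t)%:E <= ((1 - c)^-1)%:E)%E.
Proof.
move=> c1; have := @integral_powR_le R c 1 c1 ltr01; rewrite powR1 mul1r.
apply: le_trans; rewrite [leRHS]integral_mkcond le_eqVlt; apply/orP; left; apply/eqP.
apply: eq_integral => t _; rewrite /half_powR patchE indicE.
by case: ifP; rewrite ?mulr1 ?mulr0.
Qed.

Definition sym_powR (c t : R) : R := half_powR c t + half_powR c (- t).

Lemma integral_sym_powR c : c < 1 ->
  (\int[mu]_t (sym_powR c t)%:E <= (2 / (1 - c))%:E)%E.
Proof.
move=> c1; have mh : measurable_fun setT (fun t => (half_powR c t)%:E).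
  by apply/measurable_EFinP; exact: measurable_half_powR.
have mhN : measurable_fun setT (fun t : R => (half_powR c (- t))%:E).
  apply/measurable_EFinP; apply: (measurableT_comp (measurable_half_powR c)).
  exact: (measurable_funN (@measurable_id _ R setT)).
under eq_integral do rewrite EFinD.
rewrite ge0_integralD//; last 2 first.
- by move=> t _; rewrite lee_fin half_powR_ge0.
- by move=> t _; rewrite lee_fin half_powR_ge0.
rewrite -(ge0_integral_opp (f := fun t => (half_powR c t)%:E))//; last first.
  by move=> t; rewrite lee_fin half_powR_ge0.
have -> : 2 / (1 - c) = (1 - c)^-1 + (1 - c)^-1 by rewrite mulr_natl mulr2n.
by rewrite EFinD leeD ?integral_half_powR.
Qed.

Lemma sym_powR_ge0 c t : 0 <= sym_powR c t.
Proof. by rewrite addr_ge0 ?half_powR_ge0. Qed.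

Lemma measurable_sym_powR c : measurable_fun setT (sym_powR c).
Proof.
apply: measurable_funD; first exact: measurable_half_powR.
apply: (measurableT_comp (measurable_half_powR c)).
exact: (measurable_funN (@measurable_id _ R setT)).
Qed.

Lemma sym_powR_ge c t : t != 0 -> `|t| <= 1 -> `|t| `^ (- c) <= sym_powR c t.
Proof.
rewrite neq_lt => /orP[t0|t0] t1.
  rewrite (le_trans _ (_ : half_powR c (- t) <= _)) ?lerDr ?half_powR_ge0//.
  rewrite /half_powR indicE mem_set ?mulr1 ?ltr0_norm//=.
  by rewrite in_itv/= oppr_gt0 t0 -ltr0_norm.
rewrite (le_trans _ (_ : half_powR c t <= _)) ?lerDl ?half_powR_ge0//.
rewrite /half_powR indicE mem_set ?mulr1 ?gtr0_norm//=.
by rewrite in_itv/= t0 -(gtr0_norm t0).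
Qed.

(** A class stable under dilation, over which the constants below are uniform: it contains phi and,
    for all s at once, the weights [pnorm y s] to the power -a. *)
Definition singular n (a : R) (psi : 'rV[R]_n -> R) : Prop :=
  [/\ measurable_fun setT psi, forall y, 0 <= psi y &
      forall y, y != 0 -> psi y <= `|y| `^ (- a)].

Lemma singular_scale n (a X : R) (psi : 'rV[R]_n -> R) : 0 < X ->
  singular a psi -> singular a (fun y => X `^ a * psi (X *: y)).
Proof.
move=> X0 [mp p0 pa]; split.
- apply: measurable_funM => //; apply: (measurableT_comp mp).
  have := measurable_rV_affine (0 : 'rV[R]_n) X; congr (measurable_fun _ _).
  by apply/funext => z; rewrite add0r.
- by move=> y; rewrite mulr_ge0 ?powR_ge0.
- move=> y y0; have Xy : X *: y != 0 by rewrite scaler_eq0 negb_or gt_eqF.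
  rewrite (le_trans (ler_wpM2l (powR_ge0 _ _) (pa _ Xy)))//.
  rewrite normrZ gtr0_norm// powRM ?(ltW X0)// mulrA -powRD; last first.
    by rewrite (gt_eqF X0) implybT.
  by rewrite subrr powRr0 mul1r.
Qed.

Section singular_integral.
Variables (N : nat) (a : R).
Hypotheses (N0 : (0 < N)%N) (a0 : 0 < a) (aN : a < N%:R).

(* |y|^(-a) is at most the product of the |y_i|^(-a/N), since |y| is a sup norm. *)
Lemma singular_unit_ball : exists2 C, 0 <= C & forall psi, singular a psi ->
  (leb N).-integrable setT (fun y => (psi y * \1_[set y | `|y| < 1] y)%:E) /\
  \int[leb N]_y (psi y * \1_[set y | `|y| < 1] y) <= C.
Proof.
have Nr0 : 0 < N%:R :> R by rewrite ltr0n.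
set c := a / N%:R; have c0 : 0 < c by rewrite divr_gt0.
have c1 : c < 1 by rewrite ltr_pdivrMr// mul1r.
exists ((2 / (1 - c)) ^+ N).
  by rewrite exprn_ge0// divr_ge0// subr_ge0 ltW.
move=> psi [mp p0 pa].
have mprod : measurable_fun setT (fun v : 'rV[R]_N => \prod_(i < N) sym_powR c (v ord0 i)).
  apply: measurable_prod => i _; apply: (measurableT_comp (measurable_sym_powR c)).
  exact: measurable_rV_coord.
have prod0 (v : 'rV[R]_N) : 0 <= \prod_(i < N) sym_powR c (v ord0 i).
  by apply: prodr_ge0 => i _; exact: sym_powR_ge0.
have IP : (\int[leb N]_v (\prod_(i < N) sym_powR c (v ord0 i))%:E <=
    ((2 / (1 - c)) ^+ N)%:E)%E.
  rewrite (@ge0_integral_rV_prod R N _ (measurable_sym_powR c) (sym_powR_ge0 c)).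
  apply: expe_le (integral_sym_powR c1).
  by apply: integral_ge0 => t _; rewrite lee_fin sym_powR_ge0.
have [jP PC] := ge0_integrable_le mprod prod0 IP.
apply: (ae_Rintegral_le jP) => //.
- by apply: measurable_funM => //; apply: measurable_indic; exact: measurable_rV_ball.
- by move=> y; rewrite mulr_ge0// indicE.
- apply: filterS (@ae_coord_neq0 N) => y y0.
  rewrite indicE; case: (boolP (y \in _)) => [|_]; last by rewrite mulr0.
  rewrite inE /= mulr1 => y1.
  have yn0 : y != 0.
    by apply: contra_neq (y0 (Ordinal N0)) => ->; rewrite mxE.
  rewrite (le_trans (pa _ yn0))//.
  have yp : 0 < `|y| by rewrite normr_gt0.
  have -> : `|y| `^ (- a) = \prod_(i < N) `|y| `^ (- c).
    rewrite prodr_const card_ord -powR_mulrn ?powR_ge0// -powRrM.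
    by congr (_ `^ _); rewrite /c; field; exact: lt0r_neq0.
  apply: ler_prod => i _; rewrite powR_ge0/=.
  have yi : 0 < `|y ord0 i| by rewrite normr_gt0.
  apply: (@le_trans _ _ (`|y ord0 i| `^ (- c))).
    by rewrite !powRN lef_pV2 ?posrE ?powR_gt0// ge0_ler_powR ?nnegrE ?(ltW c0)// rV_coord_le_norm.
  by apply: sym_powR_ge => //; rewrite (le_trans (rV_coord_le_norm _ _))// ltW.
Qed.

(** Dilation by X reduces this to the unit ball, since [singular_scale] keeps the class and hence
    the constant. *)
Lemma singular_ball : exists2 C, 0 <= C & forall psi X, 0 < X -> singular a psi ->
  (leb N).-integrable setT (fun y => (psi y * \1_[set y | `|y| < X] y)%:E) /\
  \int[leb N]_y (psi y * \1_[set y | `|y| < X] y) <= C * X ^+ N * X `^ (- a).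
Proof.
have [C C0 HC] := singular_unit_ball; exists C => // psi X X0 sp.
have Xn0 : X != 0 by rewrite gt_eqF.
have Xi0 : X^-1 != 0 by rewrite invr_eq0.
have Xa0 : X `^ a != 0 by rewrite gt_eqF// powR_gt0.
have [j1 I1] := HC _ (singular_scale X0 sp).
pose f y := psi y * \1_[set y : 'rV[R]_N | `|y| < X] y.
have E (y : 'rV[R]_N) : X `^ a * psi (X *: y) * \1_[set y | `|y| < 1] y =
    X `^ a * f (0 + X *: y).
  rewrite /f add0r -mulrA !indicE; congr (_ * (_ * _%:R)).
  congr nat_of_bool; apply/idP/idP; rewrite !inE /= normrZ gtr0_norm//.
    by move=> y1; rewrite gtr_pMr.
  by rewrite gtr_pMr.
have j2 : (leb N).-integrable setT (fun y => (f (0 + X *: y))%:E).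
  have := integrableZl measurableT (X `^ a)^-1 j1.
  by apply: eq_integrable => // y _; rewrite -EFinM E mulKf.
have j3 : (leb N).-integrable setT (EFin \o f).
  have := integrable_rV_affine 0 Xi0 j2; apply: eq_integrable => // y _.
  by rewrite !add0r scalerA divff// scale1r.
split=> //; rewrite (Rintegral_rV_affine 0 Xn0 j3) gtr0_norm// [leRHS]mulrAC mulrC.
rewrite ler_wpM2r ?exprn_ge0 ?(ltW X0)// -(ler_pM2l (_ : 0 < X `^ a)) ?powR_gt0//.
rewrite -RintegralZl// powRN mulrCA divff// mulr1.
by under eq_Rintegral do rewrite -E.
Qed.

Let K := @weight R N (2 * N).

(** Let X = max(|x|, 1). Where |x - z| >= X/2 the singular factor is at most (X/2)^(-a) and [K] is
    integrable. Where |x - z| < X/2 one has 1 + |z| >= X/2, so [K] is at most (X/2)^(-N), which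
    cancels the volume factor of [singular_ball]. *)
Lemma weight_singular_unit : exists2 C, 0 <= C & forall psi x, singular a psi ->
  (leb N).-integrable setT (fun z => (K z * psi (x - z))%:E) /\
  \int[leb N]_z (K z * psi (x - z)) <= C * Num.max `|x| 1 `^ (- a).
Proof.
have [C C0 HC] := singular_ball.
have jK : (leb N).-integrable setT (EFin \o K) := integrable_weight (leqnn _).
have K0 z : 0 <= K z := weight_ge0 _ z.
have IK0 : 0 <= \int[leb N]_z K z by apply: Rintegral_ge0 => z _; exact: K0.
have p2 : 0 < 2^-1 `^ (- a) :> R by rewrite powR_gt0.
exists (2^-1 `^ (- a) * (\int[leb N]_z K z + C)).
  by rewrite mulr_ge0 ?addr_ge0// ltW.
move=> psi x sp; have [mp psi0 pa] := sp.
set X := Num.max `|x| 1; have X1 : 1 <= X by rewrite le_max lexx orbT.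
have X0 : 0 < X by rewrite (lt_le_trans ltr01).
have Xh0 : 0 < X / 2 by rewrite divr_gt0.
have [jB IB] := HC psi (X / 2) Xh0 sp.
have m1 : -1 != 0 :> R by rewrite oppr_eq0 oner_eq0.
pose b y := psi y * \1_[set y : 'rV[R]_N | `|y| < X / 2] y.
have jb := integrable_rV_affine x m1 jB.
pose g z := (X / 2) `^ (- a) * K z + (X / 2) ^- N * b (x + -1 *: z).
have j1 : (leb N).-integrable setT (fun z => ((X / 2) `^ (- a) * K z)%:E).
  exact: (integrableZl measurableT _ jK).
have j2 : (leb N).-integrable setT (fun z => ((X / 2) ^- N * b (x + -1 *: z))%:E).
  exact: (integrableZl measurableT _ jb).
have jg : (leb N).-integrable setT (EFin \o g).
  exact: (integrableD measurableT j1 j2).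
have mshift : measurable_fun setT (fun z : 'rV[R]_N => x - z).
  have := measurable_rV_affine x (-1); congr (measurable_fun _ _).
  by apply/funext => z; rewrite scaleN1r.
apply: (ae_Rintegral_le jg).
- apply: measurable_funM; first exact: measurable_weight.
  exact: (measurableT_comp mp mshift).
- by move=> z; rewrite mulr_ge0.
- move=> z; rewrite addr_ge0 ?mulr_ge0 ?powR_ge0 ?invr_ge0 ?exprn_ge0 ?(ltW Xh0) ?K0//.
- have : {ae leb N, forall z : 'rV[R]_N, z != x}.
    exists [set x]; split; [exact: measurable_rV_set1|exact: lebesgue_rV_set1|].
    by move=> z /= /negP; rewrite negbK => /eqP.
  apply: filterS => z zx; have y0 : x - z != 0 by rewrite subr_eq0 eq_sym.
  rewrite /g scaleN1r /b; have [yX|yX] := leP (X / 2) `|x - z|.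
    rewrite (le_trans _ (_ : (X / 2) `^ (- a) * K z <= _))//.
      rewrite mulrC ler_wpM2r ?K0// (le_trans (pa _ y0))//.
      by rewrite !powRN lef_pV2 ?posrE ?powR_gt0 ?normr_gt0// ge0_ler_powR ?nnegrE ?(ltW a0) ?(ltW Xh0).
    by rewrite lerDl !mulr_ge0// ?invr_ge0 ?exprn_ge0 ?(ltW Xh0)// indicE.
  rewrite indicE mem_set//= mulr1 (le_trans _ (_ : (X / 2) ^- N * psi (x - z) <= _))//.
    rewrite ler_wpM2r// (le_trans (@le_weight _ _ N _ _ _))//; first by rewrite leq_pmull.
    rewrite lef_pV2 ?posrE ?exprn_gt0 ?norm1D_gt0//.
    rewrite lerXn2r ?nnegrE ?(ltW Xh0) ?addr_ge0//.
    have := ler_normD (x - z) z; rewrite subrK.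
    move: yX; rewrite /X; have := normr_ge0 z; case: (leP `|x| 1) => _; lra.
  by rewrite lerDr mulr_ge0 ?powR_ge0 ?K0.
rewrite RintegralD//.
rewrite (RintegralZl _ measurableT jK) (RintegralZl _ measurableT jb).
have := Rintegral_rV_affine x m1 jB; rewrite normrN normr1 expr1n mul1r => <-.
have XE : (X / 2) `^ (- a) = 2^-1 `^ (- a) * X `^ (- a).
  by rewrite powRM ?(ltW X0)// mulrC.
rewrite mulrAC -XE mulrDr lerD2l.
rewrite -(ler_pM2l (_ : 0 < (X / 2) ^+ N)) ?exprn_gt0// mulrA divff ?mul1r; last first.
  by rewrite expf_neq0// gt_eqF.
apply: (le_trans IB); set A := (X / 2) ^+ N; set B := (X / 2) `^ (- a).
by rewrite (_ : C * A * B = A * (B * C)) ?lexx//; ring.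
Qed.

(** The unit case at x/tau, applied to the dilated function. *)
Lemma weight_singular : exists2 C, 0 <= C & forall psi x tau, 0 < tau -> singular a psi ->
  (leb N).-integrable setT (fun z => (K z * psi (x - tau *: z))%:E) /\
  \int[leb N]_z (K z * psi (x - tau *: z)) <= C * Num.max `|x| tau `^ (- a).
Proof.
have [C C0 HC] := weight_singular_unit; exists C => // psi x tau t0 sp.
have ta : 0 < tau `^ (- a) by rewrite powR_gt0.
have tn0 : tau != 0 by rewrite gt_eqF.
have [j1 I1] := HC _ (tau^-1 *: x) (singular_scale t0 sp).
have E z : K z * psi (x - tau *: z) = tau `^ (- a) *
    (K z * (tau `^ a * psi (tau *: (tau^-1 *: x - z)))).
  rewrite scalerBr scalerA divff// scale1r powRN.
  by rewrite [RHS]mulrCA [in RHS]mulKf// gt_eqF// powR_gt0.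
have j2 : (leb N).-integrable setT (fun z => (K z * psi (x - tau *: z))%:E).
  by under eq_fun do rewrite E; exact: (integrableZl measurableT _ j1).
split=> //; under eq_Rintegral do rewrite E.
rewrite (RintegralZl _ measurableT j1); apply: (le_trans (ler_wpM2l (ltW ta) I1)).
clear E I1 j1 j2 HC sp.
rewrite mulrCA -powRM ?(ltW t0) ?le_max ?normr_ge0// maxr_pMr ?(ltW t0)//.
by rewrite normrZ normfV gtr0_norm// mulrA divff// mul1r mulr1.
Qed.

End singular_integral.
End singular.

(** * Lipschitz bounds for powers *)

Section powR_lipschitz.
Context {R : realType}.

Lemma expR_sub1_le (x : R) : 1 - expR x <= - x.
Proof. by have := expR_ge1Dx x; lra. Qed.

Lemma ln_le_sub1 (x : R) : 0 < x -> ln x <= x - 1.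
Proof.
by move=> x0; have := @le_ln1Dx R (x - 1); rewrite addrCA subrr addr0; apply; lra.
Qed.

(** The constant bounds the derivative of r^(-b) on [r0, oo[; both signs of r - 1 follow from ln x
    <= x - 1 and exp x >= 1 + x. *)
Lemma powRN_lipschitz (b r0 r : R) : 0 <= b -> 0 < r0 <= 1 -> r0 <= r ->
  `|r `^ (- b) - 1| <= b * r0^-1 * r0 `^ (- b) * `|r - 1|.
Proof.
move=> b0 /andP[r00 r01] rr; have rp : 0 < r := lt_le_trans r00 rr.
have i1 : 1 <= r0^-1 by rewrite invf_ge1.
have e1 : (1 : R) `^ b = 1 by rewrite powR1.
have p1 : 1 <= r0 `^ (- b).
  by rewrite powRN invf_ge1 ?powR_gt0// -[leRHS]e1 ge0_ler_powR ?nnegrE// ltW.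
have bb : b <= b * r0^-1 * r0 `^ (- b).
  by rewrite -mulrA ler_peMr// mulr_ege1.
have rE e : r `^ e = expR (e * ln r) by rewrite /powR gt_eqF.
have [r1|r1] := leP 1 r.
  have le1 : r `^ (- b) <= 1.
    by rewrite powRN invf_le1 ?powR_gt0// -[leLHS]e1 ge0_ler_powR ?nnegrE// ltW.
  rewrite ler0_norm ?subr_le0// opprB ger0_norm ?subr_ge0// rE.
  rewrite (le_trans (expR_sub1_le _))// mulNr opprK.
  apply: (@le_trans _ _ (b * (r - 1))); first by rewrite ler_wpM2l// ln_le_sub1.
  by rewrite ler_wpM2r// subr_ge0.
have ge1 : 1 <= r `^ (- b).
  by rewrite powRN invf_ge1 ?powR_gt0// -[leRHS]e1 ge0_ler_powR ?nnegrE// ltW.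
rewrite ger0_norm ?subr_ge0// ltr0_norm ?subr_lt0// opprB.
have -> : r `^ (- b) - 1 = r `^ (- b) * (1 - r `^ b).
  by rewrite mulrBr mulr1 powRN mulVf// gt_eqF// powR_gt0.
have rb : 1 - r `^ b <= b * r0^-1 * (1 - r).
  rewrite rE (le_trans (expR_sub1_le _))// -mulrN -mulrA ler_wpM2l//.
  rewrite -lnV ?posrE// (le_trans (ln_le_sub1 _)) ?invr_gt0//.
  have -> : r^-1 - 1 = r^-1 * (1 - r) by rewrite mulrBr mulr1 mulVf// gt_eqF.
  by rewrite ler_wpM2r ?subr_ge0 ?(ltW r1)// lef_pV2 ?posrE.
rewrite mulrC [leRHS]mulrAC ler_pM ?powR_ge0//.
  by rewrite subr_ge0 -[leRHS]e1 ge0_ler_powR ?nnegrE// ltW.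
by rewrite !powRN lef_pV2 ?posrE ?powR_gt0// ge0_ler_powR ?nnegrE// ltW.
Qed.

(** If y < x/2, then x <= 2 (x - y) suffices. Otherwise q = y/x >= 1/2 and 1 - q^p <= -p ln q <= p
    (1/q - 1) <= 2 p (1 - q); this is the origin of the factor 2. *)
Lemma powR_sub_le (p x y : R) : 1 < p -> 0 <= y -> y <= x ->
  x `^ p - y `^ p <= 2 * p * x `^ (p - 1) * (x - y).
Proof.
move=> p1 y0 yx; have p0 : 0 < p by lra.
have [->|xn0] := eqVneq x 0.
  by have := powR_ge0 y p; rewrite powR0 ?gt_eqF// (@powR0 _ (p - 1)) ?subr_eq0 ?gt_eqF//; lra.
have x0 : 0 < x by rewrite lt0r xn0 (le_trans y0).
rewrite -(mulr_powRB1 (ltW x0) p0).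
set X := x `^ (p - 1); have X0 : 0 < X by rewrite powR_gt0.
have [yh|yh] := leP (x / 2) y; last first.
  have yp := powR_ge0 y p.
  have h1 : 0 <= X * (x / 2 - y) by rewrite mulr_ge0 ?(ltW X0)//; lra.
  have h2 : 0 <= (p - 1) * (X * (x - y)).
    by rewrite !mulr_ge0 ?(ltW X0)//; lra.
  nra.
have yp : 0 < y by lra.
pose q := y / x; have q0 : 0 < q by rewrite divr_gt0.
have yE : y = q * x by rewrite /q divfK.
have qh : 1 / 2 <= q by rewrite /q ler_pdivlMr//; lra.
have q1 : q <= 1 by rewrite /q ler_pdivrMr//; lra.
have qp : 1 - q `^ p <= 2 * p * (1 - q).
  rewrite /powR gt_eqF// (le_trans (expR_sub1_le _))// -mulrN -lnV ?posrE//.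
  rewrite [2 * p]mulrC -mulrA ler_wpM2l ?(ltW p0)// (le_trans (ln_le_sub1 _)) ?invr_gt0//.
  have -> : q^-1 - 1 = q^-1 * (1 - q) by rewrite mulrBr mulr1 mulVf// gt_eqF.
  rewrite ler_wpM2r ?subr_ge0// -[leRHS]invrK lef_pV2 ?posrE ?invr_gt0//; lra.
have -> : y `^ p = q `^ p * (x * X).
  by rewrite {1}yE powRM ?(ltW q0) ?(ltW x0)// -(mulr_powRB1 (ltW x0) p0).
have -> : x * X - q `^ p * (x * X) = x * X * (1 - q `^ p) by ring.
have -> : 2 * p * X * (x - y) = x * X * (2 * p * (1 - q)) by rewrite {1}yE; ring.
by rewrite ler_wpM2l// mulr_ge0// ltW.
Qed.

Lemma normr_power_nonlinearity (p z : R) : 1 < p -> `|power_nonlinearity p z| = `|z| `^ p.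
Proof.
move=> p1; rewrite /power_nonlinearity normrM ger0_norm ?powR_ge0// mulrC.
by rewrite mulr_powRB1//; lra.
Qed.

(** By symmetry and oddness |y| <= |x| and x >= 0. For y >= 0 this is [powR_sub_le]; for y < 0 both
    powers are at most x^(p-1) times their base, and the bases add up to x - y. *)
Lemma power_nonlinearity_lip (p M x y : R) : 1 < p -> `|x| <= M -> `|y| <= M ->
  `|power_nonlinearity p x - power_nonlinearity p y| <=
  2 * p * M `^ (p - 1) * `|x - y|.
Proof.
move=> p1; have p0 : 0 < p by lra.
have p10 : 0 <= p - 1 by lra.
have M1 z : 0 <= z -> z <= M -> z `^ (p - 1) <= M `^ (p - 1).
  by move=> z0 zM; rewrite ge0_ler_powR ?nnegrE// (le_trans z0).
have Np z : power_nonlinearity p (- z) = - power_nonlinearity p z.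
  by rewrite /power_nonlinearity normrN mulrN.
have pos z : 0 <= z -> power_nonlinearity p z = z `^ p.
  by move=> z0; rewrite /power_nonlinearity ger0_norm// mulrC mulr_powRB1.
wlog xy : x y / `|y| <= `|x|.
  move=> H xM yM; have [|/ltW] := leP `|y| `|x|; first by move=> yx; exact: H.
  by move=> xy; rewrite distrC [`|x - y|]distrC; exact: H.
wlog x0 : x y xy / 0 <= x.
  move=> H xM yM; have [x0|/ltW x0] := leP 0 x; first exact: H.
  have := H (- x) (- y); rewrite !normrN !Np -!opprD !normrN.
  by apply => //; lra.
move=> xM yM; rewrite (ger0_norm x0) in xy xM.
have [y0|y0] := leP 0 y.
  rewrite (ger0_norm y0) in xy.
  rewrite !pos// ger0_norm ?subr_ge0; last by rewrite ge0_ler_powR ?nnegrE// ltW.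
  rewrite (ger0_norm (_ : 0 <= x - y)) ?subr_ge0//.
  rewrite (le_trans (powR_sub_le p1 y0 xy))// ler_wpM2r ?subr_ge0//.
  by rewrite ler_wpM2l ?M1// mulr_ge0 ?ltW.
rewrite (ltr0_norm y0) in xy; have ny0 : 0 <= - y by lra.
rewrite -[y]opprK Np opprK (pos x)// (pos (- y))// opprK.
have xp := powR_ge0 x p; have yp := powR_ge0 (- y) p.
rewrite ger0_norm ?addr_ge0// ger0_norm; last by lra.
have := M1 _ x0 xM; have := powR_ge0 x (p - 1).
have y1 : (- y) `^ p <= x `^ (p - 1) * (- y).
  rewrite -(mulr_powRB1 ny0 p0) mulrC ler_wpM2r// ge0_ler_powR ?nnegrE//.
rewrite -[x `^ p](mulr_powRB1 x0 p0).
move: (x `^ (p - 1)) (M `^ (p - 1)) y1 => X Y y1 X0 XY.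
have h1 : 0 <= (Y - X) * (x - y) by rewrite mulr_ge0//; lra.
have h2 : 0 <= (2 * p - 1) * (Y * (x - y)) by rewrite !mulr_ge0//; lra.
nra.
Qed.

End powR_lipschitz.

#[local] Opaque heat_kernel.

(** * The linear evolution of phi: upper bound, asymptotics, lower bound *)

Section linear.
Context {R : realType}.
Local Notation mu := (@lebesgue_measure R).
Local Notation leb n := (@lebesgue_rV R n).
Variables (N : nat) (beta : R).
Hypotheses (N0 : (0 < N)%N) (b0 : 0 < beta) (bN : beta < N%:R).
Local Notation G := (fun z : 'rV[R]_N => heat_kernel z 1).
Local Notation K := (@weight R N (2 * N)).
Local Notation phi := (@radial_power R N beta).
Implicit Types x y z : 'rV[R]_N.

Lemma compact_rV_ball n (r : R) : compact [set x : 'rV[R]_n | `|x| <= r].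
Proof.
apply: bounded_closed_compact.
  by exists r; split; [exact: num_real|move=> M rM x /le_trans; apply; exact: ltW].
apply: (@closed_comp _ _ (fun x : 'rV[R]_n => `|x|) [set s | s <= r]).
  by move=> x _; exact: norm_continuous.
exact: closed_le.
Qed.

Let N1 : 1 <= N%:R :> R. Proof. by rewrite ler1n. Qed.

Lemma enorm_ge0 x : 0 <= enorm x. Proof. exact: sqrtr_ge0. Qed.

Lemma norm_le_enorm x : `|x| <= enorm x.
Proof.
have [i ->] := rV_norm_coord x N0.
rewrite -(ler_pXn2r (n := 2)) ?nnegrE ?enorm_ge0// enormE real_normK ?num_real//.
by rewrite /sqnorm (bigD1 i)//= lerDl; apply: sumr_ge0 => j _; rewrite sqr_ge0.
Qed.

Lemma enorm_le_norm x : enorm x <= N%:R * `|x|.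
Proof.
rewrite -(ler_pXn2r (n := 2)) ?nnegrE ?enorm_ge0 ?mulr_ge0// enormE.
apply: (@le_trans _ _ (\sum_(i < N) `|x| ^+ 2)).
  apply: ler_sum => i _; rewrite -[x ord0 i ^+ 2]real_normK ?num_real//.
  by rewrite lerXn2r ?nnegrE// rV_coord_le_norm.
rewrite sumr_const card_ord -[X in X <= _]mulr_natl exprMn ler_wpM2r ?sqr_ge0//.
by rewrite -natrX ler_nat; case: (N) N0 => // n _; rewrite leq_pmulr.
Qed.

Lemma enorm_gt0 x : x != 0 -> 0 < enorm x.
Proof. by move=> x0; rewrite (lt_le_trans _ (norm_le_enorm x))// normr_gt0. Qed.

Lemma radial_powerZ x tau : 0 < tau ->
  phi (tau *: x) = tau `^ (- beta) * phi x.
Proof.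
move=> t0; rewrite /radial_power.
have -> : enorm (tau *: x) = tau * enorm x.
  apply/eqP; rewrite -(eqrXn2 (n := 2)) ?mulr_ge0 ?enorm_ge0 ?ltW//.
  rewrite exprMn !enormE /sqnorm mulr_sumr; apply/eqP/eq_bigr => i _.
  by rewrite mxE exprMn.
by rewrite powRM ?enorm_ge0 ?ltW.
Qed.

Lemma radial_power_ge0 x : 0 <= phi x. Proof. exact: powR_ge0. Qed.

Lemma singular_radial_power : singular beta phi.
Proof.
split; last 2 first.
- exact: radial_power_ge0.
- move=> y y0; rewrite /radial_power !powRN.
  rewrite lef_pV2 ?posrE ?powR_gt0 ?enorm_gt0 ?normr_gt0//.
  by rewrite ge0_ler_powR ?nnegrE ?enorm_ge0 ?(ltW b0) ?norm_le_enorm.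
apply: (measurableT_comp (@measurable_powR R (- beta))).
exact: measurable_enorm.
Qed.

(** The second form keeps one more power of decay, which becomes the rate 1/|x| in
    [heat_phi_asymptotic]. *)
Lemma heat_kernel_weight : exists2 C, 0 <= C &
  (forall z, `|G z| <= C * K z) /\
  forall z, `|G z| <= C * ((1 + `|z|)^-1 * K z).
Proof.
have [C C0 HC] := @heat_kernel_decay R N N0 (2 * N).+1.
exists C => //; split=> z; rewrite (le_trans (HC z))// ler_wpM2l//.
  exact: le_weight.
by rewrite weightS.
Qed.

Lemma heat_singular a : 0 < a -> a < N%:R -> exists2 C, 0 <= C &
  forall (psi f : 'rV[R]_N -> R) x (tau : R), 0 < tau -> singular a psi ->
  measurable_fun setT f -> (forall y, `|f y| <= psi y) ->
  (leb N).-integrable setT (fun z => (G z * f (x - tau *: z))%:E) /\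
  `|\int[leb N]_z (G z * f (x - tau *: z))| <= C * Num.max `|x| tau `^ (- a).
Proof.
move=> a0 aN; have [C C0 HC] := weight_singular N0 a0 aN.
have [D D0 [HD _]] := heat_kernel_weight.
exists (D * C); first by rewrite mulr_ge0.
move=> psi f x tau t0 sp mf fpsi; have [j I] := HC psi x tau t0 sp.
have j2 := integrableZl measurableT D j.
have m : measurable_fun setT (fun z => G z * f (x - tau *: z)).
  apply: measurable_funM; first exact: measurable_heat_kernel1.
  apply: (measurableT_comp mf); have := measurable_rV_affine x (- tau).
  by congr (measurable_fun _ _); apply/funext => z; rewrite scaleNr.
have dom z : `|G z * f (x - tau *: z)| <= D * (K z * psi (x - tau *: z)).
  by rewrite normrM mulrA ler_pM.
split; first exact: (integrable_dominated j2 m dom).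
apply: (le_trans (normr_Rintegral_le j2 m dom)).
by rewrite (RintegralZl _ measurableT j) -mulrA ler_wpM2l.
Qed.

(** S(1) phi; the homogeneity of phi recovers all other times in [semigroup_phi]. *)
Definition heat_phi x : R := \int[leb N]_z (G z * phi (x - z)).

Lemma integrable_heat_phi x :
  (leb N).-integrable setT (fun z => (G z * phi (x - z))%:E).
Proof.
have [C _ HC] := heat_singular b0 bN.
have [mp _ _] := singular_radial_power.
have le y : `|phi y| <= phi y by rewrite ger0_norm ?radial_power_ge0.
have [j _] := HC phi phi x 1 ltr01 singular_radial_power mp le.
have E : (fun z => (G z * phi (x - z))%:E) = (fun z => (G z * phi (x - 1 *: z))%:E).
  by apply/funext => z; rewrite scale1r.
by rewrite E.
Qed.

Lemma heat_phi_bound : exists2 C, 0 <= C &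
  forall x, `|heat_phi x| <= C * Num.max `|x| 1 `^ (- beta).
Proof.
have [C C0 HC] := heat_singular b0 bN; exists C => // x.
have [mp _ _] := singular_radial_power.
have le y : `|phi y| <= phi y by rewrite ger0_norm ?radial_power_ge0.
have [_ I] := HC phi phi x 1 ltr01 singular_radial_power mp le.
have E : (fun z => G z * phi (x - z)) = (fun z => G z * phi (x - 1 *: z)).
  by apply/funext => z; rewrite scale1r.
by rewrite /heat_phi E.
Qed.

Lemma semigroup_phi x tau : 0 < tau ->
  semigroup (tau ^+ 4) phi x = tau `^ (- beta) * heat_phi (tau^-1 *: x).
Proof.
move=> t0; have tn0 : tau != 0 by rewrite gt_eqF.
have E z : G z * phi (x - tau *: z) = tau `^ (- beta) * (G z * phi (tau^-1 *: x - z)).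
  have -> : x - tau *: z = tau *: (tau^-1 *: x - z).
    by rewrite scalerBr scalerA divff// scale1r.
  by rewrite radial_powerZ// mulrCA.
have j := integrable_heat_phi (tau^-1 *: x).
rewrite (semigroupE t0); last first.
  by under eq_fun do rewrite E; exact: (integrableZl measurableT _ j).
by under eq_Rintegral do rewrite E; rewrite (RintegralZl _ measurableT j).
Qed.

(** Here x occurs only in the continuous factor, as dominated convergence in x requires. *)
Lemma heat_phiE x : heat_phi x = \int[leb N]_y (G (x - y) * phi y).
Proof.
have m1 : -1 != 0 :> R by rewrite oppr_eq0 oner_eq0.
rewrite /heat_phi (Rintegral_rV_affine x m1 (integrable_heat_phi x)).
rewrite normrN normr1 expr1n mul1r; apply: eq_Rintegral => y _.
by rewrite scaleN1r subKr.
Qed.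

Lemma heat_phi_continuous : continuous heat_phi.
Proof.
move=> x0; have [D D0 [HD _]] := heat_kernel_weight.
have [mp _ _] := singular_radial_power.
have [C C0 HC] := weight_singular N0 b0 bN.
have [j _] := HC phi x0 1 ltr01 singular_radial_power.
have m1 : -1 != 0 :> R by rewrite oppr_eq0 oner_eq0.
have j1 : (leb N).-integrable setT (fun y => (K (x0 - y) * phi y)%:E).
  have := integrable_rV_affine x0 m1 j; congr (_.-integrable _ _).
  by apply/funext => y; rewrite scale1r scaleN1r subKr.
(* For |x - x0| < 1 one has 1 + |x0 - y| <= 2 (1 + |x - y|), raised to the power 2N. *)
have j2 := integrableZl measurableT (D * 2 ^+ (2 * N)) j1.
rewrite (funext heat_phiE).
have mG x : measurable_fun setT (fun y => G (x - y)).
  apply: (measurableT_comp (@measurable_heat_kernel1 R N)).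
  have := measurable_rV_affine x (-1); congr (measurable_fun _ _).
  by apply/funext => y; rewrite scaleN1r.
apply: (@cvg_Rintegral_dominated _ _ R (leb N) _ x0 (fun x y => G (x - y) * phi y)
  (fun y => D * 2 ^+ (2 * N) * (K (x0 - y) * phi y)) set0) => //.
- by apply: (@nearW _ (nbhs x0)) => x; exact: measurable_funM (mG x) mp.
- have : nbhs x0 (ball x0 1) by exact: nbhsx_ballx.
  apply: filterS => x; rewrite mx_norm_ball /ball_ /= => xx0 y _.
  rewrite normrM [`|phi y|]ger0_norm ?radial_power_ge0// mulrA.
  rewrite ler_wpM2r ?radial_power_ge0// (le_trans (HD _))// -mulrA ler_wpM2l//.
  rewrite /weight -ler_pdivrMl ?exprn_gt0// -invfM -exprMn.
  rewrite lef_pV2 ?posrE ?exprn_gt0 ?mulr_gt0 ?norm1D_gt0//.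
  rewrite lerXn2r ?nnegrE ?mulr_ge0 ?addr_ge0//.
  have := ler_normD (x0 - x) (x - y); rewrite addrA subrK.
  by have := normr_ge0 (x - y); lra.
- move=> y _; apply: (@cvgM _ _ (nbhs x0)); last exact: (@cvg_cst _ _ _ (nbhs x0)).
  have cS : x - y @[x --> x0] --> x0 - y.
    by apply: (@cvgB _ _ _ (nbhs x0)); [exact: cvg_id|exact: (@cvg_cst _ _ _ (nbhs x0))].
  exact: (cvg_comp _ _ cS (@continuous_heat_kernel1 R N (x0 - y))).
Qed.

(** The difference of the squared norms is at most |z| 3 |x| in each coordinate; it is divided by
    the sum of the norms, which is at least the Euclidean norm of x. *)
Lemma enorm_shift x z : x != 0 -> `|z| <= `|x| / 2 ->
  `|enorm (x - z) / enorm x - 1| <= 3 * N%:R * (`|z| / `|x|).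
Proof.
move=> x0 zx; have e0 := enorm_gt0 x0; have n0 : 0 < `|x| by rewrite normr_gt0.
have ey := enorm_ge0 (x - z); have xe := norm_le_enorm x.
have -> : enorm (x - z) / enorm x - 1 = (enorm (x - z) - enorm x) / enorm x.
  by field; rewrite gt_eqF.
have S : `|enorm (x - z) ^+ 2 - enorm x ^+ 2| <= N%:R * (`|z| * (3 * `|x|)).
  rewrite !enormE /sqnorm -sumrB (le_trans (ler_norm_sum _ _ _))//.
  have -> : N%:R * (`|z| * (3 * `|x|)) = \sum_(i < N) `|z| * (3 * `|x|).
    by rewrite sumr_const card_ord mulr_natl.
  apply: ler_sum => i _; rewrite !mxE subr_sqr normrM ler_pM//.
    rewrite addrAC subrr sub0r normrN; exact: rV_coord_le_norm.
  have := ler_normD (x ord0 i - z ord0 i) (x ord0 i).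
  have := ler_normB (x ord0 i) (z ord0 i).
  by have := rV_coord_le_norm x i; have := rV_coord_le_norm z i; lra.
rewrite normrM normfV (gtr0_norm e0) ler_pdivrMr//.
have : `|enorm (x - z) - enorm x| * enorm x <= N%:R * (`|z| * (3 * `|x|)).
  apply: le_trans S; rewrite subr_sqr normrM ler_wpM2l// ger0_norm ?addr_ge0 ?enorm_ge0//.
  by rewrite lerDr.
rewrite -ler_pdivlMr// => /le_trans; apply; rewrite ler_pdivrMr//.
have -> : 3 * N%:R * (`|z| / `|x|) * enorm x * enorm x =
   3 * N%:R * `|z| / `|x| * (enorm x ^+ 2) by ring.
have -> : N%:R * (`|z| * (3 * `|x|)) = 3 * N%:R * `|z| / `|x| * `|x| ^+ 2.
  by field; rewrite gt_eqF.
rewrite ler_wpM2l ?mulr_ge0 ?invr_ge0//.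
by rewrite lerXn2r ?nnegrE ?(ltW e0).
Qed.

(** The integrand is G(z) ((|x - z|/|x|)^(-beta) - 1) in Euclidean norms. For |z| <= |x|/2 the
    bracket is O(|z|/|x|) by [powRN_lipschitz], and the extra decay of G absorbs |z|; for larger z
    that extra decay is itself at most 2/|x|. *)
Lemma heat_phi_asymptotic : exists2 C, 0 <= C & forall x, 1 <= `|x| ->
  `|enorm x `^ beta * heat_phi x - \int[leb N]_z G z| <= C / `|x|.
Proof.
have [D D0 [_ HD]] := heat_kernel_weight.
have [C C0 HC] := weight_singular_unit N0 b0 bN.
(* Lower bound for the quotient of Euclidean norms when |z| <= |x|/2: the sup norm loses the factor
   2, the comparison of norms the factor N. *)
pose r0 : R := (2 * N%:R)^-1.
have N1' := N1.
have r01 : 0 < r0 <= 1.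
  rewrite invr_gt0 mulr_gt0 ?ltr0n//= invf_le1 ?mulr_gt0 ?ltr0n//; lra.
pose C1 := beta * r0^-1 * r0 `^ (- beta).
have C10 : 0 <= C1.
  by rewrite !mulr_ge0 ?powR_ge0 ?invr_ge0 ?(ltW b0)//; case/andP: r01 => /ltW.
pose C2 := Num.max 2 (C1 * (3 * N%:R)).
have C20 : 0 <= C2 by rewrite le_max ler0n.
have jK : (leb N).-integrable setT (EFin \o K) := integrable_weight (leqnn _).
set IK := \int[leb N]_z K z.
exists (D * C2 * (IK + N%:R `^ beta * C)).
  rewrite !mulr_ge0// addr_ge0 ?mulr_ge0 ?powR_ge0//.
  by apply: Rintegral_ge0 => z _; exact: weight_ge0.
move=> x x1; set e := enorm x; set s := `|x|.
have s0 : 0 < s by rewrite (lt_le_trans ltr01).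
have x0 : x != 0 by rewrite -normr_gt0.
have e0 : 0 < e := enorm_gt0 x0.
have [j I] := HC phi x singular_radial_power.
have jh := integrable_heat_phi x; have jG := integrable_heat_kernel1 (R := R) N0.
have jeh := integrableZl measurableT (e `^ beta) jh.
have jeK := integrableZl measurableT (e `^ beta) j.
pose f z := e `^ beta * (G z * phi (x - z)) - G z.
pose g z := D * (C2 / s) * (K z + e `^ beta * (K z * phi (x - z))).
have jf : (leb N).-integrable setT (EFin \o f) := integrableB measurableT jeh jG.
have jg : (leb N).-integrable setT (EFin \o g).
  exact: (integrableZl measurableT _ (integrableD measurableT jK jeK)).
have -> : e `^ beta * heat_phi x - \int[leb N]_z G z = \int[leb N]_z f z.
  by rewrite (RintegralB measurableT jeh jG) (RintegralZl _ measurableT jh).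
have mf : measurable_fun setT f by apply/measurable_EFinP; exact: measurable_int jf.
have eb0 : 0 < e `^ beta by rewrite powR_gt0.
have xe := norm_le_enorm x; have ex := enorm_le_norm x.
apply: (@le_trans _ _ (\int[leb N]_z g z)).
  apply: (normr_Rintegral_le jg mf) => z.
  clear jg jf mf jeK jeh jh jG j I.
  rewrite /f /g; set P := phi (x - z); have P0 : 0 <= P := radial_power_ge0 _.
  have -> : e `^ beta * (G z * P) - G z = G z * (e `^ beta * P - 1) by ring.
  have -> : D * (C2 / s) * (K z + e `^ beta * (K z * P)) =
    D * K z * (C2 / s * (1 + e `^ beta * P)) by ring.
  have K0 : 0 <= K z := weight_ge0 _ _.
  rewrite normrM (le_trans (ler_wpM2r (normr_ge0 _) (HD z)))//.
  have -> : D * ((1 + `|z|)^-1 * K z) * `|e `^ beta * P - 1| =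
    D * K z * (`|e `^ beta * P - 1| * (1 + `|z|)^-1) by ring.
  apply: ler_wpM2l; first by rewrite mulr_ge0.
  have eP0 : 0 <= e `^ beta * P := mulr_ge0 (ltW eb0) P0.
  have [zs|zs] := leP `|z| (s / 2).
    have y0 : x - z != 0.
      rewrite subr_eq0; apply/eqP => xz; move: zs; rewrite /s xz.
      by have := s0; rewrite /s xz; lra.
    have sy : s / 2 <= `|x - z|.
      by have := ler_normD (x - z) z; rewrite subrK -/s; lra.
    have rr : r0 <= enorm (x - z) / e.
      rewrite ler_pdivlMr// (le_trans _ (norm_le_enorm _))// (le_trans _ sy)//.
      rewrite /r0 mulrC ler_pdivrMr ?mulr_gt0 ?ltr0n//.
      by rewrite (le_trans ex)// le_eqVlt; apply/orP; left; apply/eqP; rewrite -/s; field.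
    have -> : e `^ beta * P = (enorm (x - z) / e) `^ (- beta).
      rewrite powRM ?enorm_ge0 ?invr_ge0 ?(ltW e0)// [RHS]mulrC; congr (_ * _).
      rewrite -[e^-1]powR_inv1 ?(ltW e0)// -powRrM; congr (_ `^ _); ring.
    apply: (@le_trans _ _ (C1 * (3 * N%:R * (`|z| / s)) * (1 + `|z|)^-1)).
      rewrite ler_wpM2r ?invr_ge0 ?addr_ge0//.
      apply: (le_trans (powRN_lipschitz (ltW b0) r01 rr)).
      by rewrite -/C1 ler_wpM2l//; exact: enorm_shift.
    have -> : C1 * (3 * N%:R * (`|z| / s)) * (1 + `|z|)^-1 =
        C1 * (3 * N%:R) * (`|z| * (1 + `|z|)^-1) / s by ring.
    rewrite mulrAC ler_pM ?powR_ge0//.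
    - apply: mulr_ge0; last by rewrite invr_ge0 ltW.
      by apply: mulr_ge0 => //; rewrite mulr_ge0.
    - by rewrite ler_wpM2r ?invr_ge0 ?(ltW s0)// le_max lexx orbT.
    - rewrite (@le_trans _ _ 1)//; first by rewrite ler_pdivrMr ?norm1D_gt0// mul1r lerDr.
      by rewrite lerDl powR_ge0.
  rewrite mulrC ler_pM ?invr_ge0 ?addr_ge0//.
    rewrite (@le_trans _ _ (2 / s))//.
      rewrite -[leRHS]invrK lef_pV2 ?posrE ?norm1D_gt0 ?invr_gt0 ?divr_gt0// invf_div.
      by lra.
    by rewrite ler_wpM2r ?invr_ge0 ?(ltW s0)// le_max lexx.
  by rewrite (le_trans (ler_normB _ _))// normr1 ger0_norm// addrC.
rewrite (RintegralZl _ measurableT (integrableD measurableT jK jeK)).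
rewrite (RintegralD measurableT jK jeK) (RintegralZl _ measurableT j) -/IK.
have -> : D * C2 * (IK + N%:R `^ beta * C) / s = D * (C2 / s) * (IK + N%:R `^ beta * C).
  by ring.
rewrite ler_wpM2l ?mulr_ge0 ?invr_ge0 ?(ltW s0)// lerD2l.
apply: (le_trans (ler_wpM2l (ltW eb0) I)).
rewrite max_l// mulrCA mulrC ler_wpM2r//.
apply: (@le_trans _ _ ((N%:R * s) `^ beta * s `^ (- beta))).
  by rewrite ler_wpM2r ?powR_ge0// ge0_ler_powR ?nnegrE ?(ltW b0) ?mulr_ge0 ?(ltW e0) ?(ltW s0).
by rewrite powRM ?(ltW s0)// powRN -mulrA divff ?mulr1// gt_eqF// powR_gt0.
Qed.

(** Inside a ball a continuous positive function has a positive minimum; outside, the asymptotics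
    leave at least half of the mass L of the kernel. *)
Lemma heat_phi_lower : (forall x, 0 < heat_phi x) ->
  exists2 c, 0 < c & forall x, c * Num.max `|x| 1 `^ (- beta) <= heat_phi x.
Proof.
move=> pos; have L0 := heat_kernel_mass_gt0 (R := R) N0.
set L := \int[leb N]_z G z in L0.
have [C C0 HC] := heat_phi_asymptotic.
(* Beyond this radius the error C/|x| is at most L/2. *)
pose r := Num.max 1 (2 * C / L).
have r1 : 1 <= r by rewrite le_max lexx.
have r0 : 0 < r := lt_le_trans ltr01 r1.
pose A : set 'rV[R]_N := [set x | `|x| <= r].
have cA : compact A by exact: compact_rV_ball.
have [x1 _ x1min] : exists2 c, c \in A & forall t, t \in A -> heat_phi c <= heat_phi t.
  apply: EVT_min_rV => //; first by exists 0; rewrite /A /= normr0 ltW.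
  exact: (continuous_subspaceT heat_phi_continuous).
have Nb : 0 < N%:R `^ (- beta) :> R by rewrite powR_gt0 ?ltr0n.
(* In the ball the weight is at most 1; outside, N^(-beta) pays for passing from the Euclidean to
   the sup norm. *)
exists (Num.min (heat_phi x1) (L / 2 * N%:R `^ (- beta))).
  by rewrite lt_min pos mulr_gt0 ?divr_gt0.
move=> x; set c := Num.min _ _.
have c1 : c <= heat_phi x1 by rewrite ge_min lexx.
have c2 : c <= L / 2 * N%:R `^ (- beta) by rewrite ge_min lexx orbT.
have c0 : 0 <= c by rewrite le_min (ltW (pos _)) mulr_ge0 ?(ltW Nb) ?divr_ge0 ?(ltW L0).
have [xr|xr] := leP `|x| r.
  have xA : heat_phi x1 <= heat_phi x by apply: x1min; rewrite inE.
  apply: (le_trans _ xA); apply: (le_trans _ c1); clear xA c1 c2 x1min cA HC xr.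
  have M1 : 1 <= Num.max `|x| 1 by rewrite le_max lexx orbT.
  apply: (ler_piMr c0); rewrite powRN.
  have e1 : (1 : R) `^ beta = 1 by rewrite powR1.
  have M2 : 1 <= Num.max `|x| 1 `^ beta.
    rewrite -[leLHS]e1; apply: (ge0_ler_powR (ltW b0)) => //; rewrite nnegrE.
      exact: ler01.
    by rewrite (le_trans ler01).
  by rewrite invf_le1// (lt_le_trans ltr01).
have x1' : 1 <= `|x| by rewrite (le_trans r1)// ltW.
have x0 : x != 0 by rewrite -normr_gt0 (lt_le_trans ltr01).
have e0 := enorm_gt0 x0; have n0 : 0 < `|x| by rewrite normr_gt0.
have := HC x x1'; rewrite ler_norml => /andP[+ _].
have CL : C / `|x| <= L / 2.
  rewrite (ler_pdivrMr _ _ n0) mulrC.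
  have : 2 * C / L <= `|x| by rewrite (le_trans _ (ltW xr))// le_max lexx orbT.
  by rewrite ler_pdivrMr//; lra.
have aux (a b d : R) : b <= d / 2 -> - b <= a - d -> d / 2 <= a by lra.
move=> low; have low2 := aux _ _ _ CL low.
clear low CL HC cA x1min c1; move: (heat_phi x) low2 => h low2.
rewrite max_l//.
have eb : 0 < enorm x `^ beta by rewrite powR_gt0.
rewrite -(ler_pM2l eb) (le_trans _ low2)// mulrCA.
apply: (@le_trans _ _ (c * N%:R `^ beta)).
  rewrite ler_wpM2l//.
  apply: (@le_trans _ _ ((N%:R * `|x|) `^ beta * `|x| `^ (- beta))).
    by rewrite ler_wpM2r ?powR_ge0// ge0_ler_powR ?nnegrE ?(ltW b0) ?mulr_ge0 ?(ltW e0) ?(ltW n0) ?enorm_le_norm.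
  by rewrite powRM ?(ltW n0)// powRN -mulrA divff ?mulr1// gt_eqF// powR_gt0.
have Nb' : 0 < N%:R `^ beta :> R by rewrite powR_gt0 ?ltr0n.
rewrite -ler_pdivlMr// (le_trans c2)// powRN.
exact: lexx.
Qed.

End linear.

(** * The Duhamel operator *)

Lemma cvg_pair_nbhs (T : Type) (F : set_system T) (U V : topologicalType)
    (f : T -> U) (g : T -> V) (a : U) (b : V) : Filter F ->
  f x @[x --> F] --> a -> g x @[x --> F] --> b ->
  (f x, g x) @[x --> F] --> ((a, b) : U * V).
Proof. by move=> FF fa gb; exact: (cvg_pair fa gb). Qed.

Section duhamel.
Context {R : realType}.
Local Notation mu := (@lebesgue_measure R).
Local Notation leb n := (@lebesgue_rV R n).

(** Nested square roots are continuous on all of R, with value 0 on the negative numbers. *)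
Definition root4 (t : R) : R := Num.sqrt (Num.sqrt t).

Lemma root4_ge0 t : 0 <= root4 t. Proof. exact: sqrtr_ge0. Qed.

Lemma root4_gt0 t : 0 < t -> 0 < root4 t.
Proof. by move=> t0; rewrite !sqrtr_gt0. Qed.

Lemma root4K t : 0 <= t -> root4 t ^+ 4 = t.
Proof. by move=> t0; rewrite (exprM _ 2 2) !sqr_sqrtr ?sqrtr_ge0. Qed.

Lemma root4_continuous : continuous root4.
Proof.
move=> t; apply: (@continuous_comp _ _ _ (@Num.sqrt R)); exact: sqrt_continuous.
Qed.

Lemma root4_powR t b : 0 <= t -> root4 t `^ b = t `^ (b / 4).
Proof.
move=> t0; rewrite /root4 -!powR12_sqrt ?powR_ge0// -!powRrM.
by congr (_ `^ _); field.
Qed.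

Lemma ler_root4 s t : s <= t -> root4 s <= root4 t.
Proof. by move=> st; rewrite /root4 !ler_wsqrtr. Qed.

Lemma powRN_le (x y a : R) : 0 <= a -> 0 < x -> x <= y -> y `^ (- a) <= x `^ (- a).
Proof.
move=> a0 x0 xy; have y0 := lt_le_trans x0 xy.
by rewrite !powRN lef_pV2 ?posrE ?powR_gt0// ge0_ler_powR ?nnegrE// ltW.
Qed.

Lemma powR_add (x r s : R) : 0 < x -> x `^ (r + s) = x `^ r * x `^ s.
Proof. by move=> x0; rewrite powRD// (gt_eqF x0) implybT. Qed.

Lemma powRN_half (x y a : R) : 0 <= a -> 0 < y -> y / 2 <= x ->
  x `^ (- a) <= 2 `^ a * y `^ (- a).
Proof.
move=> a0 y0 yx; apply: (le_trans (powRN_le a0 _ yx)); first by rewrite divr_gt0.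
rewrite powRM ?invr_ge0 ?(ltW y0)// mulrC ler_wpM2r ?powR_ge0//.
by rewrite -[2^-1]powR_inv1// -powRrM mulrNN mul1r.
Qed.

(** Homogeneous under (x, t) |-> (tau x, tau^4 t); the weight w is its power -beta. *)
Definition pnorm n (x : 'rV[R]_n) (t : R) : R := Num.max `|x| (root4 t).

Lemma pnorm_gt0 n (x : 'rV[R]_n) t : 0 < t -> 0 < pnorm x t.
Proof. by move=> t0; rewrite lt_max (root4_gt0 t0) orbT. Qed.

Lemma pnorm_root4 n (x : 'rV[R]_n) t : root4 t <= pnorm x t.
Proof. by rewrite le_max lexx orbT. Qed.

Lemma pnormN_split n (y : 'rV[R]_n) s a c : 0 < s -> 0 <= c ->
  pnorm y s `^ (- (a + 4 * c)) <= s `^ (- c) * pnorm y s `^ (- a).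
Proof.
move=> s0 c0; rewrite opprD addrC powR_add ?pnorm_gt0// ler_wpM2r ?powR_ge0//.
have -> : s `^ (- c) = root4 s `^ (- (4 * c)).
  by rewrite root4_powR ?(ltW s0)//; congr (_ `^ _); field.
by rewrite powRN_le ?pnorm_root4 ?root4_gt0// mulr_ge0.
Qed.

Lemma measurable_pnormN n (a t : R) :
  measurable_fun setT (fun y : 'rV[R]_n => pnorm y t `^ (- a)).
Proof.
apply: (measurableT_comp (@measurable_powR R (- a))).
by apply: measurable_maxr => //; exact: measurable_rV_norm.
Qed.

Lemma singular_pnorm n a t : 0 <= a -> singular a (fun y : 'rV[R]_n => pnorm y t `^ (- a)).
Proof.
move=> a0; split.
- exact: measurable_pnormN.
- by move=> y; exact: powR_ge0.
- by move=> y y0; rewrite powRN_le ?normr_gt0// le_max lexx.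
Qed.

(** Joint continuity for positive times: it gives measurable slices, is preserved by the Duhamel
    operator and, with decay at infinity, yields uniform continuity in time. *)
Definition jcont n (f : R -> 'rV[R]_n -> R) : Prop :=
  forall (s : R) (y : 'rV[R]_n), 0 < s -> f q.1 q.2 @[q --> (s, y)] --> f s y.

Lemma jcont_slice n (f : R -> 'rV[R]_n -> R) s : jcont f -> 0 < s -> continuous (f s).
Proof.
move=> fc s0 y; have cS : (s, z) @[z --> y] --> (s, y).
  by apply: (@cvg_pair_nbhs _ (nbhs y)); [exact: (@cvg_cst _ _ _ (nbhs y))|exact: cvg_id].
exact: (cvg_comp _ _ cS (fc s y s0)).
Qed.

Variables (N : nat) (beta D : R) (G : 'rV[R]_N -> R).
Local Notation K := (@weight R N (2 * N)).
Hypotheses (N0 : (0 < N)%N) (b0 : 0 < beta) (bN : beta < N%:R).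
Hypotheses (D0 : 0 <= D) (mG : measurable_fun setT G) (GK : forall z, `|G z| <= D * K z).

Lemma integrable_kernel : (leb N).-integrable setT (EFin \o G).
Proof.
exact: (integrable_dominated (integrableZl measurableT D (integrable_weight (leqnn _))) mG GK).
Qed.

(* Trading 4 c powers of the singularity for the factor s^(-c) with c < 1 makes
   the spatial exponent smaller than N and keeps the time integral finite. *)
Lemma kernel_bound : exists C c : R, [/\ 0 <= C, 0 < c < 1 &
  forall (h : 'rV[R]_N -> R) (A s t : R) (x : 'rV[R]_N), 0 <= A -> 0 < s < t -> measurable_fun setT h ->
  (forall y, `|h y| <= A * pnorm y s `^ (- (beta + 4))) ->
  (leb N).-integrable setT (fun z => (G z * h (x - root4 (t - s) *: z))%:E) /\
  `|\int[leb N]_z (G z * h (x - root4 (t - s) *: z))| <=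
    C * A * (s `^ (- c) * pnorm x t `^ (- (beta + 4 - 4 * c)))].
Proof.
(* The new spatial exponent a = beta + d lies strictly between beta and N, and c = 1 - d/4 lies in
   [1/2, 1[. *)
pose d := Num.min 2 ((N%:R - beta) / 2).
have d0 : 0 < d by rewrite lt_min ltr0n/= divr_gt0 ?subr_gt0.
have d2 : d <= 2 by rewrite ge_min lexx.
have dN : d <= (N%:R - beta) / 2 by rewrite ge_min lexx orbT.
pose a := beta + d; pose c := 1 - d / 4.
have aE : a = beta + 4 - 4 * c by rewrite /a /c; field.
have a0 : 0 < a by rewrite addr_gt0.
have c0 : 0 <= c by rewrite /c; lra.
have aN : a < N%:R by rewrite /a; lra.
have [C C0 HC] := weight_singular N0 a0 aN.
have jK : (leb N).-integrable setT (EFin \o K) := integrable_weight (leqnn _).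
set IK := \int[leb N]_z K z.
have IK0 : 0 <= IK by apply: Rintegral_ge0 => z _; exact: weight_ge0.
exists (D * (2 `^ a * (C + IK))), c; split.
- by rewrite !mulr_ge0 ?powR_ge0 ?addr_ge0.
- by rewrite /c; apply/andP; split; lra.
move=> h A s t x A0 /andP[s0 st] mh hA; rewrite -aE.
set tau := root4 (t - s); have t0 := lt_trans s0 st.
have tau0 : 0 < tau by rewrite root4_gt0// subr_gt0.
set S := root4 s; have S0 : 0 < S := root4_gt0 s0.
set T := root4 t; have T0 : 0 < T := root4_gt0 t0.
pose psi (y : 'rV[R]_N) := pnorm y s `^ (- a).
have sp : singular a psi by apply: singular_pnorm; exact: ltW.
have [jp Ip] := HC psi x tau tau0 sp.
have hpsi y : `|h y| <= A * s `^ (- c) * psi y.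
  apply: (le_trans (hA y)); rewrite -mulrA; apply: (ler_wpM2l A0).
  have -> : beta + 4 = a + 4 * c by rewrite aE subrK.
  exact: (pnormN_split _ _ s0 c0).
have j2 := integrableZl measurableT (D * (A * s `^ (- c))) jp.
have m : measurable_fun setT (fun z => G z * h (x - tau *: z)).
  apply: measurable_funM => //; apply: (measurableT_comp mh).
  have := measurable_rV_affine x (- tau).
  by congr (measurable_fun _ _); apply/funext => z; rewrite scaleNr.
have dom z : `|G z * h (x - tau *: z)| <=
    D * (A * s `^ (- c)) * (K z * psi (x - tau *: z)).
  rewrite normrM (le_trans (ler_pM _ _ (GK z) (hpsi _)))// le_eqVlt; apply/orP; left.
  by apply/eqP; ring.
split; first exact: (integrable_dominated j2 m dom).
apply: (le_trans (normr_Rintegral_le j2 m dom)).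
rewrite (RintegralZl _ measurableT jp).
suff I : \int[leb N]_z (K z * psi (x - tau *: z)) <= 2 `^ a * (C + IK) * pnorm x t `^ (- a).
  have -> : D * (2 `^ a * (C + IK)) * A * (s `^ (- c) * pnorm x t `^ (- a)) =
    D * (A * s `^ (- c)) * (2 `^ a * (C + IK) * pnorm x t `^ (- a)) by ring.
  by apply: ler_wpM2l => //; rewrite !mulr_ge0 ?powR_ge0.
have p0 := pnorm_gt0 x t0.
(* In the first case max(|x|, tau) is at least half of [pnorm x t], and [weight_singular] suffices.
   In the second, tau^4 + S^4 = T^4 forces S >= T/2, so psi itself is bounded by the target and only
   the mass of [K] remains. *)
have [hx|] := boolP ((T <= `|x|) || (T / 2 <= tau)).
  apply: (le_trans Ip); rewrite [2 `^ a * _]mulrC -mulrA.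
  apply: (@le_trans _ _ (C * (2 `^ a * pnorm x t `^ (- a)))).
    apply: (ler_wpM2l C0); apply: (powRN_half (ltW a0) p0); rewrite ler_pdivrMr// ge_max.
    have x2 : `|x| <= Num.max `|x| tau * 2.
      have : `|x| <= Num.max `|x| tau by rewrite le_max lexx.
      by have := normr_ge0 x; lra.
    have t2 : tau * 2 <= Num.max `|x| tau * 2 by rewrite ler_pM2r// le_max lexx orbT.
    rewrite x2/= -/T; case/orP: hx => [/le_trans|]; first exact.
    by rewrite ler_pdivrMr// => /le_trans; exact.
  by rewrite ler_wpM2r ?mulr_ge0 ?powR_ge0// lerDl.
rewrite negb_or -!ltNge => /andP[xT tT].
have TS : T / 2 <= S.
  rewrite leNgt; apply/negP => ST.
  have := root4K (ltW t0); have := root4K (ltW s0).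
  have := @root4K (t - s); rewrite subr_ge0 (ltW st) => /(_ isT).
  rewrite -/T -/S -/tau => E1 E2 E3.
  have l1 : tau ^+ 4 < (T / 2) ^+ 4 by rewrite ltrXn2r// ltW.
  have l2 : S ^+ 4 < (T / 2) ^+ 4 by rewrite ltrXn2r// ltW.
  have : (T / 2) ^+ 4 = t / 16 by rewrite expr_div_n E3; congr (_ / _); ring.
  by move=> E; rewrite E E1 in l1; rewrite E E2 in l2; lra.
have pS z : K z * psi (x - tau *: z) <= 2 `^ a * pnorm x t `^ (- a) * K z.
  rewrite mulrC; apply: ler_wpM2r; first exact: weight_ge0.
  apply: (powRN_half (ltW a0) p0).
  rewrite (le_trans _ (pnorm_root4 _ _))// -/S (le_trans _ TS)// ler_pM2r//.
  by rewrite ge_max lexx (ltW xT).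
have j3 := integrableZl measurableT (2 `^ a * pnorm x t `^ (- a)) jK.
apply: (@le_trans _ _ (\int[leb N]_z (2 `^ a * pnorm x t `^ (- a) * K z))).
  by apply: le_Rintegral => // z _; exact: pS.
rewrite (RintegralZl _ measurableT jK) -/IK mulrAC ler_wpM2r ?powR_ge0//.
by rewrite ler_wpM2l ?powR_ge0// lerDr.
Qed.

Definition heat_conv (f : R -> 'rV[R]_N -> R) (x : 'rV[R]_N) tau s : R :=
  \int[leb N]_z (G z * f s (x - tau *: z)).

Definition pbound A a (f : R -> 'rV[R]_N -> R) : Prop := forall s y, 0 < s ->
  `|f s y| <= A * pnorm y s `^ (- a).

(** Near p0 the time stays above s(p0)/2, where the weight is bounded by a constant, so a multiple
    of |G| dominates. The abstract parameter serves both for s alone and for (t, x) at fixed s. *)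
Lemma heat_conv_cvg (P : pseudoMetricType R) (p0 : P) (X : P -> 'rV[R]_N) (tau s : P -> R)
    A a f : jcont f -> pbound A a f -> 0 <= A -> 0 <= a -> 0 < s p0 ->
  X p @[p --> p0] --> X p0 -> tau p @[p --> p0] --> tau p0 ->
  s p @[p --> p0] --> s p0 ->
  heat_conv f (X p) (tau p) (s p) @[p --> p0] --> heat_conv f (X p0) (tau p0) (s p0).
Proof.
move=> fc fb A0 a0 sp0 cX ct cs.
pose B := A * root4 (s p0 / 2) `^ (- a).
have near_s : \forall p \near p0, s p0 / 2 < s p.
  have h : \forall v \near s p0, s p0 / 2 < v.
    by apply: lt_nbhsr; rewrite ltr_pdivrMr//; lra.
  exact: (cs _ h).
have s2 : 0 < s p0 / 2 by rewrite divr_gt0.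
have B0 : 0 <= B by rewrite mulr_ge0// powR_ge0.
have jB : (leb N).-integrable setT (EFin \o (fun z => B * `|G z|)).
  exact: (integrableZl measurableT B (integrable_norm integrable_kernel)).
apply: (@cvg_Rintegral_dominated _ _ R (leb N) P p0 (fun p z => G z * f (s p) (X p - tau p *: z))
  (fun z => B * `|G z|) set0 measurable0 (measure0 _) jB).
- apply: filterS near_s => p sp; have s0 : 0 < s p := lt_trans s2 sp.
  apply: measurable_funM => //.
  apply: (measurableT_comp (continuous_measurable_rV (jcont_slice fc s0))).
  have := measurable_rV_affine (X p) (- tau p).
  by congr (measurable_fun _ _); apply/funext => z; rewrite scaleNr.
- apply: filterS near_s => p sp z _; have s0 : 0 < s p := lt_trans s2 sp.
  rewrite normrM mulrC ler_wpM2r// (le_trans (fb _ _ s0))// ler_wpM2l//.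
  rewrite powRN_le ?root4_gt0//.
  by rewrite (le_trans _ (pnorm_root4 _ _))// ler_root4// ltW.
- move=> z _; apply: (@cvgM _ _ (nbhs p0)); first exact: (@cvg_cst _ _ _ (nbhs p0)).
  have cS : (s p, X p - tau p *: z) @[p --> p0] --> (s p0, X p0 - tau p0 *: z).
    apply: (@cvg_pair_nbhs _ (nbhs p0)) => //.
    apply: (@cvgB _ _ _ (nbhs p0)) => //.
    by apply: (@cvgZ _ _ _ (nbhs p0)) => //; exact: (@cvg_cst _ _ _ (nbhs p0)).
  exact: (cvg_comp _ _ cS (fc _ _ sp0)).
Qed.

Definition duhamel f (t : R) (x : 'rV[R]_N) : R :=
  \int[mu]_(s in `]0, t[) heat_conv f x (root4 (t - s)) s.

Lemma measurable_heat_conv A a f t x : jcont f -> pbound A a f -> 0 <= A -> 0 <= a ->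
  measurable_fun setT ((fun s => heat_conv f x (root4 (t - s)) s) \_ `]0, t[).
Proof.
move=> fc fb A0 a0; apply: (measurable_restrictT _ _).1 => //.
apply: open_continuous_measurable_fun; first by apply: interval_open.
move=> s; rewrite inE/= in_itv/= => /andP[s0 st].
apply: (heat_conv_cvg (X := fun=> x) (tau := fun s => root4 (t - s)) (s := id) fc fb A0 a0 s0).
- exact: (@cvg_cst _ _ _ (nbhs s)).
- apply: (@continuous_comp _ _ _ (fun s => t - s) root4 s); last exact: root4_continuous.
  by apply: (@cvgB _ _ _ (nbhs s)); [exact: (@cvg_cst _ _ _ (nbhs s))|exact: cvg_id].
- exact: cvg_id.
Qed.

(** The integral of s^(-c) over ]0, t[ is t^(1-c)/(1-c), and t^(1-c) is at most [pnorm x t] to the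
    power 4 (1 - c), which turns the exponent a of [kernel_bound] back into beta. *)
Lemma duhamel_bound : exists2 C : R, 0 <= C & forall (A : R) f, 0 <= A -> jcont f ->
  pbound A (beta + 4) f ->
  [/\ jcont (duhamel f), pbound (C * A) beta (duhamel f),
      (forall (t : R) x, 0 < t ->
        mu.-integrable `]0, t[ (fun s => (heat_conv f x (root4 (t - s)) s)%:E)) &
      forall (s t : R) x, 0 < s < t ->
        (leb N).-integrable setT (fun z => (G z * f s (x - root4 (t - s) *: z))%:E)].
Proof.
have [C [c [C0 /andP[c0 c1] HC]]] := kernel_bound.
have b40 : 0 <= beta + 4 by rewrite addr_ge0// ltW.
have [a aE] : exists a, a = beta + 4 - 4 * c by exists (beta + 4 - 4 * c).
have a0 : 0 <= a.
  have aux (u v : R) : 0 < u -> v < 1 -> 0 <= u + 4 - 4 * v by lra.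
  by rewrite aE; exact: aux.
have c10 : 0 < 1 - c by rewrite subr_gt0.
exists (C / (1 - c)); first by rewrite divr_ge0// ltW.
move=> A f A0 fc fb.
have HI s t x : 0 < s < t ->
    (leb N).-integrable setT (fun z => (G z * f s (x - root4 (t - s) *: z))%:E) /\
    `|heat_conv f x (root4 (t - s)) s| <= C * A * (s `^ (- c) * pnorm x t `^ (- a)).
  move=> /andP[s0 st]; rewrite aE; apply: HC => //; first by rewrite s0.
    exact: continuous_measurable_rV (jcont_slice fc s0).
  by move=> y; exact: fb.
(* Extension by zero turns the variable domain of integration into a dependence of the integrand on
   t. *)
pose F (q : R * 'rV[R]_N) := (fun s => heat_conv f q.2 (root4 (q.1 - s)) s) \_ `]0, q.1[.
have mF q : measurable_fun setT (F q) := measurable_heat_conv q.1 q.2 fc fb A0 b40.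
pose g B (t : R) : R -> R := (fun s => B * s `^ (- c)) \_ `]0, t].
have itvS (t : R) : `]0, t[ `<=` `]0, t].
  by move=> s/=; rewrite !in_itv/= => /andP[-> /ltW].
have HG B t : 0 <= B -> 0 < t -> mu.-integrable setT (EFin \o g B t) /\
    \int[mu]_s g B t s <= B * (t `^ (1 - c) / (1 - c)).
  move=> B0 t0; apply: ge0_integrable_le.
  - apply: (measurable_restrictT _ _).1 => //; apply: measurable_funM => //.
    by apply: (measurable_funS measurableT) => //; exact: measurable_powR.
  - by move=> s; rewrite /g patchE; case: ifP => // _; rewrite mulr_ge0 ?powR_ge0.
  rewrite /g -/(EFin \o _) -restrict_EFin -integral_mkcond.
  under eq_integral do rewrite /= EFinM.
  rewrite ge0_integralZl_EFin//.
  - by rewrite EFinM lee_wpmul2l// ?lee_fin// integral_powR_le.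
  - by move=> s _; rewrite lee_fin powR_ge0.
  - by apply/measurable_EFinP; apply: (measurable_funS measurableT).
have dom t x s : `|F (t, x) s| <= g (C * A * pnorm x t `^ (- a)) t s.
  rewrite /F /g !patchE/=; case: ifPn => [|_]; last first.
    rewrite normr0; case: ifP => // _.
    by rewrite mulr_ge0 ?powR_ge0// mulr_ge0 ?powR_ge0// mulr_ge0.
  rewrite inE => st; rewrite mem_set; last exact: itvS.
  have [_] := HI s t x st; move/le_trans; apply.
  by rewrite le_eqVlt; apply/orP; left; apply/eqP; ring.
have jF t x : 0 < t -> mu.-integrable setT (EFin \o F (t, x)).
  move=> t0; have B0 : 0 <= C * A * pnorm x t `^ (- a).
    by rewrite mulr_ge0 ?powR_ge0// mulr_ge0.
  have [jg _] := HG _ t B0 t0.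
  exact: (integrable_dominated jg (mF (t, x)) (dom t x)).
have DE t x : duhamel f t x = \int[mu]_s F (t, x) s.
  by rewrite /duhamel Rintegral_mkcond.
split.
- move=> t0 x0 t00; pose M := root4 (t0 / 2) `^ (- a).
  have th : 0 < t0 / 2 by rewrite divr_gt0.
  have t2 : 0 < 2 * t0 by rewrite mulr_gt0.
  have B0 : 0 <= C * A * M by rewrite mulr_ge0 ?powR_ge0// mulr_ge0.
  (* One majorant for all t in ]t0/2, 2 t0[: the weight is frozen at its bound for time t0/2, and
     ]0, 2 t0] contains every ]0, t[. *)
  have [jg _] := HG _ (2 * t0) B0 t2.
  have cfst : q.1 @[q --> (t0, x0)] --> t0 by exact: cvg_fst.
  have csnd : q.2 @[q --> (t0, x0)] --> x0 by exact: cvg_snd.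
  rewrite DE; under eq_cvg do rewrite DE.
  (* At s = t0 the extended integrand may jump as t crosses t0, hence the exceptional set. *)
  apply: (@cvg_Rintegral_dominated _ _ R mu _ (t0, x0) (fun q => F (q.1, q.2))
    (g (C * A * M) (2 * t0)) [set t0] _ _ jg).
  + exact: measurable_set1.
  + exact: lebesgue_measure_set1.
  + by apply: (@nearW _ (nbhs (t0, x0))) => q; exact: mF.
  + have n1 : \forall q \near (t0, x0), t0 / 2 < q.1.
      have h : \forall v \near t0, t0 / 2 < v.
        by apply: lt_nbhsr; rewrite ltr_pdivrMr//; lra.
      exact: (cfst _ h).
    have n2 : \forall q \near (t0, x0), q.1 < 2 * t0.
      have h : \forall v \near t0, v < 2 * t0 by apply: lt_nbhsl; lra.
      exact: (cfst _ h).
    apply: filterS (filterI n1 n2) => -[t x] /= [t1 t3] s _.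
    apply: (le_trans (dom t x s)); rewrite /g !patchE.
    case: ifPn => [|_]; last first.
      by case: ifP => // _; rewrite mulr_ge0 ?powR_ge0.
    rewrite inE/= in_itv/= => /andP[s0 st].
    rewrite mem_set/=; last by rewrite in_itv/= s0 (le_trans st)// ltW.
    rewrite ler_wpM2r ?powR_ge0// ler_wpM2l ?mulr_ge0// powRN_le ?root4_gt0//.
    by rewrite (le_trans _ (pnorm_root4 _ _))// ler_root4// ltW.
  + move=> s st0; rewrite /F/=.
    have [s0|s0] := ltP 0 s; last first.
      have E t x : ((fun s => heat_conv f x (root4 (t - s)) s) \_ `]0, t[) s = 0.
        by rewrite patchE memNset//= in_itv/= => /andP[]; rewrite ltNge s0.
      rewrite E; under eq_cvg do rewrite E.
      exact: (@cvg_cst _ _ _ (nbhs (t0, x0))).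
    have [st|st] := ltP s t0; last first.
      have tlt : t0 < s by rewrite lt_neqAle st andbT; apply/eqP => ts; exact: st0.
      rewrite patchE memNset/=; last first.
        by rewrite in_itv/= => /andP[_]; rewrite ltNge st.
      apply: (@cvg_near_cst _ _ _ _ (nbhs (t0, x0))).
      have n1 : \forall q \near (t0, x0), q.1 < s := cfst _ (lt_nbhsl tlt).
      apply: filterS n1 => -[t x] /= ts; apply/eqP; rewrite patchE memNset//=.
      by rewrite in_itv/= => /andP[_]; rewrite ltNge (ltW ts).
    rewrite patchE mem_set/=; last by rewrite in_itv/= s0.
    have n1 : \forall q \near (t0, x0), s < q.1 := cfst _ (lt_nbhsr st).
    apply: cvg_trans (_ : heat_conv f q.2 (root4 (q.1 - s)) s @[q --> (t0, x0)] --> _).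
      apply: near_eq_cvg; apply: filterS n1 => -[t x] /= ts.
      by rewrite patchE mem_set//= in_itv/= s0.
    apply: (heat_conv_cvg (p0 := (t0, x0)) (X := snd) (tau := fun q => root4 (q.1 - s))
      (s := fun=> s) fc fb A0 b40 s0) => //.
    * have cS : q.1 - s @[q --> (t0, x0)] --> t0 - s.
        apply: (@cvgB _ _ _ (nbhs (t0, x0))); first exact: cfst.
        exact: (@cvg_cst _ _ _ (nbhs (t0, x0))).
      exact: (cvg_comp _ _ cS (@root4_continuous (t0 - s))).
    * exact: (@cvg_cst _ _ _ (nbhs (t0, x0))).
- move=> t x t0; rewrite DE.
  have B0 : 0 <= C * A * pnorm x t `^ (- a).
    by rewrite mulr_ge0 ?powR_ge0// mulr_ge0.
  have [jg Ig] := HG _ t B0 t0.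
  apply: (le_trans (normr_Rintegral_le jg (mF (t, x)) (dom t x))); apply: (le_trans Ig).
  have -> : C * A * pnorm x t `^ (- a) * (t `^ (1 - c) / (1 - c)) =
    C / (1 - c) * A * (pnorm x t `^ (- a) * t `^ (1 - c)) by ring.
  apply: ler_wpM2l; first by rewrite mulr_ge0// divr_ge0// ltW.
  have -> : - beta = - a + 4 * (1 - c) by rewrite aE; ring.
  rewrite (@powR_add (pnorm x t)) ?pnorm_gt0// ler_wpM2l ?powR_ge0//.
  have -> : t `^ (1 - c) = root4 t `^ (4 * (1 - c)).
    by rewrite root4_powR ?(ltW t0)//; congr (_ `^ _); field.
  apply: ge0_ler_powR; rewrite ?nnegrE ?root4_ge0 ?(ltW (pnorm_gt0 _ _))//.
    by rewrite mulr_ge0// ltW.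
  exact: pnorm_root4.
- move=> t x t0; have := jF t x t0; rewrite /F -restrict_EFin => j.
  by apply/integrable_mkcond; [exact: measurable_itv|exact: j].
- by move=> s t x st; have [] := HI s t x st.
Qed.

End duhamel.

(** * Picard iteration *)

Section limits.
Context {R : realType}.

Lemma geometric_cvg (a : R^nat) (B : R) : 0 <= B ->
  (forall n, `|a n.+1 - a n| <= B * 2^-1 ^+ n) ->
  exists l, forall n, `|l - a n| <= 2 * B * 2^-1 ^+ n.
Proof.
move=> B0 aB.
have h2 n : 0 <= 2^-1 ^+ n :> R by rewrite exprn_ge0// invr_ge0.
(* The last factor, dropped in [tail2], makes the induction on k close with equality. *)
have tail n k : `|a (n + k)%N - a n| <= 2 * B * 2^-1 ^+ n * (1 - 2^-1 ^+ k).
  elim: k => [|k IH]; first by rewrite addn0 !subrr normr0 mulr0.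
  rewrite addnS; have -> : a (n + k).+1 - a n = (a (n + k).+1 - a (n + k)%N) + (a (n + k)%N - a n).
    by ring.
  rewrite (le_trans (ler_normD _ _))// (le_trans (lerD (aB _) IH))//.
  rewrite exprD exprS le_eqVlt; by apply/orP; left; apply/eqP; field.
have tail2 n k : `|a (n + k)%N - a n| <= 2 * B * 2^-1 ^+ n.
  by apply: (le_trans (tail n k)); rewrite ler_piMr ?mulr_ge0// gerBl.
have c0 : 2 * B * 2^-1 ^+ n @[n --> \oo] --> (0 : R).
  have : geometric (2 * B) 2^-1 n @[n --> \oo] --> (0 : R).
    by apply: cvg_geometric; rewrite ger0_norm ?invr_ge0// invf_lt1// ltr1n.
  exact.
have ca : cvgn a.
  apply/cauchy_cvgP/cauchy_ballP => e e0.
  have [m _ Hm] := (cvgrPdist_lt _ _).1 c0 (e / 2) (divr_gt0 e0 (ltr0n _ 2)).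
  have {Hm} Hm : 2 * B * 2^-1 ^+ m < e / 2.
    have := Hm m (leqnn _); rewrite /= sub0r normrN ger0_norm//.
    by rewrite !mulr_ge0.
  have near k : (m <= k)%N -> `|a k - a m| < e / 2.
    by move=> mk; rewrite -(subnKC mk) (le_lt_trans (tail2 _ _)).
  exists ([set x | `|x - a m| < e / 2], [set x | `|x - a m| < e / 2]).
    by split; exists m.
  move=> [x y] /= [xm ym]; rewrite /ball/=.
  have -> : x - y = (x - a m) - (y - a m) by ring.
  by rewrite (le_lt_trans (ler_normB _ _))// [e]splitr ltrD.
exists (lim (a @ \oo)) => n; rewrite distrC.
have cn : `|a n - a k| @[k --> \oo] --> `|a n - lim (a @ \oo)|.
  by apply: cvg_norm; apply: cvgB => //; exact: cvg_cst.
apply: (ler_cvg_to cn (@cvg_cst _ _ _ _ _)); near=> k.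
rewrite distrC -(@subnKC n k); first exact: tail2.
by near: k; exact: nbhs_infty_ge.
Unshelve. all: by end_near.
Qed.

End limits.

Section nonlinearity.
Context {R : realType}.
Variable p : R.
Hypothesis p1 : 1 < p.

Let p_ge0 : 0 <= p. Proof. exact: ltW (lt_trans ltr01 p1). Qed.

Lemma power_nonlinearity_continuous : continuous (@power_nonlinearity R p).
Proof.
move=> x0; set M := `|x0| + 1; set L := 2 * p * M `^ (p - 1).
have M0 : 0 <= M by rewrite addr_ge0.
have L0 : 0 <= L by rewrite !mulr_ge0 ?powR_ge0.
apply/cvgrPdist_le => e e0.
have d0 : 0 < e / (L + 1) by rewrite divr_gt0// ltr_wpDl.
have n1 : \forall x \near x0, `|x0 - x| <= 1.
  by have /cvgrPdist_le := @cvg_id _ (nbhs x0); exact.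
have n2 : \forall x \near x0, `|x0 - x| <= e / (L + 1).
  by have /cvgrPdist_le := @cvg_id _ (nbhs x0); exact.
apply: filterS (filterI n1 n2) => x [x1 x2].
have xM : `|x| <= M.
  by have := ler_normB x0 (x0 - x); rewrite subKr /M; lra.
have x0M : `|x0| <= M by rewrite lerDl.
apply: (le_trans (power_nonlinearity_lip p1 x0M xM)).
apply: (le_trans (ler_wpM2l L0 x2)).
by rewrite mulrCA ler_piMr ?(ltW e0)// ler_pdivrMr ?mul1r ?lerDl ?ltr_wpDl.
Qed.

Variables (N : nat) (beta : R).
Hypothesis bp : beta * (p - 1) = 4.
Implicit Types u v : R -> 'rV[R]_N -> R.
Local Notation F u := (fun s => @power_nonlinearity R p \o u s).

Lemma jcont_power u : jcont u -> jcont (F u).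
Proof.
move=> uc s y s0.
exact: (cvg_comp _ _ (uc s y s0) (@power_nonlinearity_continuous (u s y))).
Qed.

Lemma jcontB u v : jcont u -> jcont v -> jcont (fun s y => u s y - v s y).
Proof.
by move=> uc vc s y s0; apply: (@cvgB _ _ _ (nbhs (s, y))); [exact: uc|exact: vc].
Qed.

Lemma jcontD u v : jcont u -> jcont v -> jcont (fun s y => u s y + v s y).
Proof.
by move=> uc vc s y s0; apply: (@cvgD _ _ _ (nbhs (s, y))); [exact: uc|exact: vc].
Qed.

Lemma pbound_power M u : 0 <= M -> pbound M beta u -> pbound (M `^ p) (beta + 4) (F u).
Proof.
move=> M0 uM s y s0; rewrite /= normr_power_nonlinearity//.
have w0 := powR_ge0 (pnorm y s) (- beta).
apply: (@le_trans _ _ ((M * pnorm y s `^ (- beta)) `^ p)).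
  by apply: ge0_ler_powR; rewrite ?nnegrE ?mulr_ge0//; exact: uM.
rewrite powRM// -powRrM le_eqVlt; apply/orP; left; apply/eqP.
congr (_ * _ `^ _).
have -> : - beta * p = - (beta * (p - 1) + beta) by ring.
by rewrite bp addrC.
Qed.

(** The local Lipschitz constant carries the weight to the power p - 1, that is, [pnorm y s] to the
    power -4: exactly what the Duhamel operator regains. *)
Lemma pbound_power_sub M B u v : 0 <= M -> 0 <= B -> pbound M beta u -> pbound M beta v ->
  pbound B beta (fun s y => u s y - v s y) ->
  pbound (2 * p * M `^ (p - 1) * B) (beta + 4) (fun s y => F u s y - F v s y).
Proof.
move=> M0 B0 uM vM uvB s y s0 /=.
apply: (le_trans (power_nonlinearity_lip p1 (uM s y s0) (vM s y s0))).
have P0 := pnorm_gt0 y s0; have w0 := powR_ge0 (pnorm y s) (- beta).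
have c0 : 0 <= 2 * p * (M * pnorm y s `^ (- beta)) `^ (p - 1).
  by rewrite !mulr_ge0 ?powR_ge0.
apply: (le_trans (ler_wpM2l c0 (uvB s y s0))).
have -> : - (beta + 4) = - beta * (p - 1) + - beta by rewrite mulNr bp; ring.
rewrite (@powR_add R (pnorm y s))// powRM// -powRrM le_eqVlt; apply/orP; left; apply/eqP; ring.
Qed.

End nonlinearity.

Section duhamelB.
Context {R : realType}.
Local Notation mu := (@lebesgue_measure R).
Local Notation leb n := (@lebesgue_rV R n).
Variables (N : nat) (G : 'rV[R]_N -> R).

Lemma duhamelB (f g : R -> 'rV[R]_N -> R) (t : R) x :
  (forall h, h = f \/ h = g ->
    mu.-integrable `]0, t[ (fun s => (heat_conv G h x (root4 (t - s)) s)%:E) /\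
    forall s, 0 < s < t ->
     (leb N).-integrable setT (fun z => (G z * h s (x - root4 (t - s) *: z))%:E)) ->
  duhamel G (fun s y => f s y - g s y) t x = duhamel G f t x - duhamel G g t x.
Proof.
move=> H; have [jf If] := H f (or_introl erefl); have [jg Ig] := H g (or_intror erefl).
rewrite /duhamel -RintegralB//; apply: eq_Rintegral => s.
rewrite inE/= in_itv/= => st; rewrite /heat_conv.
rewrite -(RintegralB measurableT (If s st) (Ig s st)).
by apply: eq_Rintegral => z _; rewrite mulrBr.
Qed.

End duhamelB.

Section picard.
Context {R : realType}.
Local Notation mu := (@lebesgue_measure R).
Local Notation leb n := (@lebesgue_rV R n).
Variables (N : nat) (beta p C : R) (G : 'rV[R]_N -> R).
Hypotheses (p1 : 1 < p) (bp : beta * (p - 1) = 4) (b0 : 0 < beta) (C0 : 0 <= C).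
Hypothesis DG : forall (A : R) f, 0 <= A -> jcont f -> pbound A (beta + 4) f ->
  [/\ jcont (duhamel G f), pbound (C * A) beta (duhamel G f),
      (forall (t : R) x, 0 < t ->
        mu.-integrable `]0, t[ (fun s => (heat_conv G f x (root4 (t - s)) s)%:E)) &
      forall (s t : R) x, 0 < s < t ->
        (leb N).-integrable setT (fun z => (G z * f s (x - root4 (t - s) *: z))%:E)].
Variables (v : R -> 'rV[R]_N -> R) (K : R).
Hypotheses (K0 : 0 <= K) (vc : jcont v) (vK : pbound K beta v).
Hypothesis small : 2 * p * (3 * K) `^ (p - 1) * C <= 2^-1.
Implicit Types u : R -> 'rV[R]_N -> R.
Local Notation F u := (fun s => @power_nonlinearity R p \o u s).

Let K3 : 0 <= 3 * K. Proof. by rewrite mulr_ge0. Qed.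

(** One smallness condition gives both contraction and invariance: as p > 1, [small] bounds (3
    K)^(p-1) C by 1/4, and 3/4 < 1. *)
Lemma small_power : C * (3 * K) `^ p <= K.
Proof.
have p0 : 0 < p := lt_trans ltr01 p1.
rewrite -(mulr_powRB1 K3 p0).
have X0 : 0 <= (3 * K) `^ (p - 1) * C by rewrite mulr_ge0// powR_ge0.
have h1 : (3 * K) `^ (p - 1) * C <= 4^-1.
  have := small; have := p1; rewrite -mulrA; move: (_ * C) X0 => X X0 p1' h.
  have : 0 <= (p - 1) * X by rewrite mulr_ge0//; lra.
  lra.
have -> : C * (3 * K * (3 * K) `^ (p - 1)) = (3 * K) `^ (p - 1) * C * (3 * K) by ring.
apply: (le_trans (ler_wpM2r K3 h1)); have := K0; lra.
Qed.

Lemma contraction B u1 u2 : 0 <= B -> jcont u1 -> jcont u2 ->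
  pbound (3 * K) beta u1 -> pbound (3 * K) beta u2 ->
  pbound B beta (fun s y => u1 s y - u2 s y) ->
  pbound (B * 2^-1) beta (fun s y => duhamel G (F u1) s y - duhamel G (F u2) s y).
Proof.
move=> B0 c1 c2 h1 h2 h12 t x t0 /=.
have e0 : 0 <= (3 * K) `^ p by exact: powR_ge0.
have [_ _ i1 j1] := DG e0 (jcont_power p1 c1) (pbound_power p1 bp K3 h1).
have [_ _ i2 j2] := DG e0 (jcont_power p1 c2) (pbound_power p1 bp K3 h2).
rewrite -duhamelB; last first.
  move=> h [->|->]; split.
  - exact: i1.
  - by move=> s st; exact: j1.
  - exact: i2.
  - by move=> s st; exact: j2.
have L0 : 0 <= 2 * p * (3 * K) `^ (p - 1) * B.
  by rewrite !mulr_ge0 ?powR_ge0// ltW// (lt_trans ltr01).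
have cF := jcontB (jcont_power p1 c1) (jcont_power p1 c2).
have [_ H _ _] := DG L0 cF (pbound_power_sub p1 bp K3 B0 h1 h2 h12).
apply: (le_trans (H t x t0)); apply: ler_wpM2r; first exact: powR_ge0.
have -> : C * (2 * p * (3 * K) `^ (p - 1) * B) = B * (2 * p * (3 * K) `^ (p - 1) * C) by ring.
exact: ler_wpM2l.
Qed.

Definition picard_step u : R -> 'rV[R]_N -> R := fun s y => v s y + duhamel G (F u) s y.

Definition picard_iter n := iter n picard_step v.

Lemma picard_iterS n s y :
  picard_iter n.+1 s y = v s y + duhamel G (F (picard_iter n)) s y.
Proof. by []. Qed.

(** K comes from [v] and at most K from the Duhamel term. The nonlinearity is estimated with 3 K, a
    bound the limit satisfies too, so that one contraction constant covers iterates and limit. *)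
Lemma picard_iter_prop n : jcont (picard_iter n) /\ pbound (2 * K) beta (picard_iter n).
Proof.
elim: n => [|n [c h]].
  split=> // s y s0; apply: (le_trans (vK y s0)).
  by rewrite ler_wpM2r ?powR_ge0//; have := K0; lra.
have h3 : pbound (3 * K) beta (picard_iter n).
  move=> s y s0; apply: (le_trans (h s y s0)).
  by rewrite ler_wpM2r ?powR_ge0//; have := K0; lra.
have e0 : 0 <= (3 * K) `^ p by exact: powR_ge0.
have [cD hD _ _] := DG e0 (jcont_power p1 c) (pbound_power p1 bp K3 h3).
split; first exact: (jcontD vc cD).
move=> s y s0; apply: (le_trans (ler_normD _ _)).
apply: (le_trans (lerD (vK y s0) (hD s y s0))); rewrite -mulrDl.
apply: ler_wpM2r; first exact: powR_ge0.
by have := small_power; lra.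
Qed.

Lemma picard_iter3 n : pbound (3 * K) beta (picard_iter n).
Proof.
have [_ h] := picard_iter_prop n.
move=> s y s0; apply: (le_trans (h s y s0)).
by rewrite ler_wpM2r ?powR_ge0//; have := K0; lra.
Qed.

Lemma picard_diff n :
  pbound (K * 2^-1 ^+ n) beta (fun s y => picard_iter n.+1 s y - picard_iter n s y).
Proof.
elim: n => [|n IH] s y s0.
  have e0 : 0 <= (3 * K) `^ p by exact: powR_ge0.
  have [_ hD _ _] := DG e0 (jcont_power p1 vc) (pbound_power p1 bp K3 (picard_iter3 0)).
  have -> : picard_iter 1 s y - picard_iter 0 s y = duhamel G (F v) s y.
    by rewrite /picard_iter /= /picard_step addrAC subrr add0r.
  apply: (le_trans (hD s y s0)).
  by rewrite expr0 mulr1 ler_wpM2r ?powR_ge0// small_power.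
have [cn _] := picard_iter_prop n; have [cn1 _] := picard_iter_prop n.+1.
have B0 : 0 <= K * 2^-1 ^+ n by rewrite mulr_ge0// exprn_ge0// invr_ge0.
have := contraction B0 cn1 cn (picard_iter3 n.+1) (picard_iter3 n) IH y s0.
rewrite exprSr mulrA; congr (`|_| <= _).
by rewrite !picard_iterS opprD addrACA subrr add0r.
Qed.

Lemma half_pow_small (B e : R) : 0 < e -> exists n, B * 2^-1 ^+ n <= e.
Proof.
move=> e0.
have : geometric B 2^-1 n @[n --> \oo] --> (0 : R).
  by apply: cvg_geometric; rewrite ger0_norm ?invr_ge0// invf_lt1// ltr1n.
move=> /cvgrPdist_le/(_ e e0)[n _ /(_ n (leqnn n))] /=.
by rewrite sub0r normrN => H; exists n; exact: le_trans (ler_norm _) H.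
Qed.

(** The limit is taken pointwise, with arbitrary values at times s <= 0. The geometric rate,
    relative to the weight, is uniform for s away from 0, which transfers continuity to the
    limit. *)
Lemma picard_fixpoint : exists u, [/\ jcont u, pbound (3 * K) beta u &
  forall t x, 0 < t -> u t x = v t x + duhamel G (F u) t x].
Proof.
have /choice[U HU] (q : R * 'rV[R]_N) : exists l, 0 < q.1 ->
    forall n, `|l - picard_iter n q.1 q.2| <= 2 * K * 2^-1 ^+ n * pnorm q.2 q.1 `^ (- beta).
  have [q0|q0] := ltP 0 q.1; last by exists 0.
  have w0 := powR_ge0 (pnorm q.2 q.1) (- beta).
  have [|n|l Hl] := @geometric_cvg R (fun n => picard_iter n q.1 q.2) (K * pnorm q.2 q.1 `^ (- beta)).
  - by rewrite mulr_ge0.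
  - by rewrite mulrAC; exact: picard_diff.
  exists l => _ n; have := Hl n; congr (_ <= _); ring.
pose u s y := U (s, y).
have uE s y n : 0 < s -> `|u s y - picard_iter n s y| <= 2 * K * 2^-1 ^+ n * pnorm y s `^ (- beta).
  by move=> s0; exact: (HU (s, y) s0 n).
(* Iterate 0 is [v], bounded by K, and the limit is within 2 K of it. *)
have u3 : pbound (3 * K) beta u.
  move=> s y s0; have := uE s y 0%N s0; rewrite expr0 mulr1 => h.
  have := vK y s0; have := ler_normD (u s y - v s y) (v s y); rewrite subrK.
  rewrite /picard_iter/= in h.
  have -> : 3 * K * pnorm y s `^ (- beta) = 2 * K * pnorm y s `^ (- beta) + K * pnorm y s `^ (- beta) by ring.
  by move=> h1 h2; apply: (le_trans h1); exact: lerD.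
have uc : jcont u.
  move=> s0 y0 s00; apply/cvgrPdist_le => e e0.
  have th : 0 < s0 / 2 by rewrite divr_gt0.
  have e3 : 0 < e / 3 by rewrite divr_gt0.
  have [n Hn] := half_pow_small (2 * K * root4 (s0 / 2) `^ (- beta)) e3.
  have near_n s y : s0 / 2 < s -> `|u s y - picard_iter n s y| <= e / 3.
    move=> ss; apply: (le_trans (uE s y n (lt_trans th ss))).
    apply: le_trans Hn; rewrite mulrAC ler_wpM2r ?exprn_ge0 ?invr_ge0//.
    rewrite ler_wpM2l ?mulr_ge0// powRN_le ?root4_gt0// ?(ltW b0)//.
    by rewrite (le_trans _ (pnorm_root4 _ _))// ler_root4// ltW.
  have [cn _] := picard_iter_prop n.
  have n1 : \forall q \near (s0, y0), `|picard_iter n s0 y0 - picard_iter n q.1 q.2| <= e / 3.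
    by have /cvgrPdist_le := cn s0 y0 s00; exact.
  have n2 : \forall q \near (s0, y0), s0 / 2 < q.1.
    have h : \forall s \near s0, s0 / 2 < s.
      by apply: lt_nbhsr; rewrite ltr_pdivrMr//; lra.
    have cf : q.1 @[q --> (s0, y0)] --> s0 by exact: cvg_fst.
    exact: (cf _ h).
  apply: filterS (filterI n1 n2) => -[s y] /= [d1 d2].
  have h0 : `|u s0 y0 - picard_iter n s0 y0| <= e / 3.
    by apply: near_n; rewrite ltr_pdivrMr//; lra.
  have := near_n s y d2; rewrite distrC => h1.
  have -> : u s0 y0 - u s y = (u s0 y0 - picard_iter n s0 y0) +
     (picard_iter n s0 y0 - picard_iter n s y) + (picard_iter n s y - u s y) by ring.
  apply: (le_trans (ler_normD _ _)); apply: (le_trans (lerD (ler_normD _ _) h1)).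
  have := lerD h0 d1; lra.
(* The residual is the sum of u - u_(n+1) and of the difference of the Duhamel terms of u_n and u;
   both are O(2^(-n)). *)
exists u; split => // t x t0.
apply/eqP; rewrite -subr_eq0 -normr_le0; apply/ler_addgt0Pr => e e0; rewrite add0r.
have [n Hn] := half_pow_small (2 * K * pnorm x t `^ (- beta)) e0.
apply: le_trans Hn; rewrite mulrAC.
have [cn _] := picard_iter_prop n.
have B0 : 0 <= 2 * K * 2^-1 ^+ n by rewrite !mulr_ge0// exprn_ge0// invr_ge0.
have cB : pbound (2 * K * 2^-1 ^+ n) beta (fun s y => picard_iter n s y - u s y).
  by move=> s y s0; rewrite distrC; exact: uE.
have h1 := contraction B0 cn uc (picard_iter3 n) u3 cB x t0.
have h2 := uE t x n.+1 t0.
have -> : u t x - (v t x + duhamel G (F u) t x) =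
    (u t x - picard_iter n.+1 t x) + (duhamel G (F (picard_iter n)) t x - duhamel G (F u) t x).
  by rewrite picard_iterS; ring.
apply: (le_trans (ler_normD _ _)); apply: (le_trans (lerD h2 h1)).
by rewrite exprSr le_eqVlt; apply/orP; left; apply/eqP; field.
Qed.

End picard.

(** * Continuity in time with values in BC(R^N) *)

Section uniform_continuity.
Context {R : realType}.

Lemma powRN_small (b e : R) : 0 < b -> 0 < e -> exists2 r, 0 < r & r `^ (- b) <= e.
Proof.
move=> b0 e0; exists (e `^ (- b^-1)); first exact: powR_gt0.
by rewrite -powRrM mulrNN mulVf ?gt_eqF// powRr1// ltW.
Qed.

Variables (N : nat) (beta M : R) (u : R -> 'rV[R]_N -> R).
Hypotheses (b0 : 0 < beta) (M0 : 0 <= M) (uc : jcont u) (uM : pbound M beta u).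

(** Outside a large ball both values are at most e/2, uniformly in time; on the ball, compactness
    extracts one neighbourhood of t0 from joint continuity at each point. *)
Lemma pbound_uniform (t0 e : R) : 0 < t0 -> 0 < e ->
  \forall t \near t0, forall x, `|u t0 x - u t x| <= e.
Proof.
move=> t00 e0; have M1 : 0 < M + 1 by rewrite ltr_wpDl.
have e1 : 0 < e / 2 / (M + 1) by rewrite !divr_gt0.
have [r r0 Hr] := powRN_small b0 e1.
have far t x : 0 < t -> r < `|x| -> `|u t x| <= e / 2.
  move=> t0' rx; apply: (le_trans (uM x t0')).
  have rp : r <= pnorm x t by rewrite (le_trans (ltW rx))// le_max lexx.
  have := le_trans (powRN_le (ltW b0) r0 rp) Hr; rewrite ler_pdivlMr//.
  have := powR_ge0 (pnorm x t) (- beta); move: (_ `^ _) => w w0.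
  by rewrite mulrC mulrDl mul1r; lra.
have near_A := (compact_near_coveringP _).1 (@compact_rV_ball R N r) R (nbhs t0)
  (fun t x => `|u t0 x - u t x| <= e) _.
have nA : \forall t \near t0, [set x | `|x| <= r] `<=` (fun x => `|u t0 x - u t x| <= e).
  apply: near_A => x _; have /cvgrPdist_le/(_ (e / 2)) := @uc t0 x t00.
  rewrite divr_gt0// => /(_ isT)[[Q1 Q2] /= [q1 q2] HQ].
  exists (Q2, Q1) => // -[y t] /= [y2 t1].
  have h1 := HQ (t, y) (conj t1 y2); have h2 := HQ (t0, y) (conj (nbhs_singleton q1) y2).
  rewrite /= in h1 h2; have -> : u t0 y - u t y = (u t0 x - u t y) - (u t0 x - u t0 y) by ring.
  by apply: (le_trans (ler_normB _ _)); rewrite [e]splitr lerD.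
have npos : \forall t \near t0, 0 < t by exact: lt_nbhsr.
apply: filterS (filterI nA npos) => t [H t1] x.
have [xr|xr] := leP `|x| r; first exact: H.
by apply: (le_trans (ler_normB _ _)); rewrite [e]splitr lerD// far.
Qed.

Lemma pbound_continuous : {within `]0, +oo[, continuous (u : R -> {uniform 'rV[R]_N -> R})}.
Proof.
apply: continuous_in_subspaceT => t0; rewrite inE/= in_itv/= andbT => t00 P.
move=> /uniform_nbhs[E [entE EP]].
move: entE; rewrite -entourage_ballE => -[e /= e0 He].
have e2 : 0 < e / 2 by rewrite divr_gt0.
apply: filterS (pbound_uniform t00 e2) => t H; apply: EP => x _; apply: He => /=.
by rewrite /ball/= (le_lt_trans (H x))// ltr_pdivrMr//; lra.
Qed.

Lemma pbound_BC t : 0 < t -> BC (u t).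
Proof.
move=> t0; split; first exact: jcont_slice.
exists (M * root4 t `^ (- beta)); split; first exact: num_real.
move=> B HB x _ /=; apply: (le_trans _ (ltW HB)); apply: (le_trans (uM x t0)).
by rewrite ler_wpM2l// powRN_le ?root4_gt0 ?pnorm_root4 ?(ltW b0).
Qed.

End uniform_continuity.

(** * The linear solution in self-similar form *)

Section linear_solution.
Context {R : realType}.
Variables (N : nat) (beta : R).
Hypotheses (N0 : (0 < N)%N) (b0 : 0 < beta) (bN : beta < N%:R).
Local Notation phi := (@radial_power R N beta).

(** Self-similar profile of S(t) phi; estimates and joint continuity reduce to those of
    [heat_phi]. *)
Definition linear_solution (t : R) (x : 'rV[R]_N) : R :=
  root4 t `^ (- beta) * heat_phi beta ((root4 t)^-1 *: x).

Lemma semigroup_linear t x : 0 < t -> semigroup t phi x = linear_solution t x.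
Proof.
move=> t0; rewrite -[in LHS](root4K (ltW t0)).
exact: (semigroup_phi N0 b0 bN _ (root4_gt0 t0)).
Qed.

Lemma pnorm_scale t (x : 'rV[R]_N) : 0 < t ->
  pnorm x t `^ (- beta) = root4 t `^ (- beta) * Num.max `|(root4 t)^-1 *: x| 1 `^ (- beta).
Proof.
move=> t0; have r0 := root4_gt0 t0.
rewrite -powRM ?(ltW r0)//.
rewrite maxr_pMr ?(ltW r0)// mulr1 normrZ normfV (gtr0_norm r0) mulrA divff ?mul1r//.
by rewrite gt_eqF.
Qed.

Lemma linear_solution_bound : exists2 K : R, 0 <= K & pbound K beta linear_solution.
Proof.
have [K K0 HK] := heat_phi_bound N0 b0 bN; exists K => // t x t0.
rewrite pnorm_scale// mulrCA /linear_solution normrM ger0_norm ?powR_ge0//.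
by apply: ler_wpM2l; [exact: powR_ge0|exact: HK].
Qed.

Lemma linear_solution_lower : (forall (x : 'rV[R]_N) (t : R), 0 < t -> 0 < semigroup t phi x) ->
  exists2 c : R, 0 < c & forall t x, 0 < t -> c * pnorm x t `^ (- beta) <= linear_solution t x.
Proof.
move=> pos; have [|c c0 Hc] := heat_phi_lower N0 b0 bN.
  move=> x; have := pos x 1 ltr01; rewrite semigroup_linear// /linear_solution.
  by rewrite /root4 !sqrtr1 invr1 scale1r powR1 mul1r.
exists c => // t x t0; rewrite pnorm_scale// mulrCA /linear_solution.
by apply: ler_wpM2l; [exact: powR_ge0|exact: Hc].
Qed.

Lemma powR_cvg (a x0 : R) : 0 < x0 -> x `^ a @[x --> x0] --> x0 `^ a.
Proof.
move=> x00.
have E y : 0 < y -> expR (a * ln y) = y `^ a by move=> y0; rewrite /powR gt_eqF.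
rewrite -(E _ x00).
apply: cvg_trans (_ : expR (a * ln x) @[x --> x0] --> expR (a * ln x0)).
  apply: near_eq_cvg; apply: filterS (lt_nbhsr x00) => y y0; exact: E.
apply: (@continuous_comp _ _ _ (fun x => a * ln x)); last exact: continuous_expR.
by apply: (@cvgM _ _ (nbhs x0)); [exact: (@cvg_cst _ _ _ (nbhs x0))|exact: continuous_ln].
Qed.

Lemma linear_solution_jcont : jcont linear_solution.
Proof.
move=> t x t0; have r0 := root4_gt0 t0.
have cr : root4 q.1 @[q --> (t, x)] --> root4 t.
  exact: (cvg_comp _ _ (@cvg_fst _ _ (nbhs t) (nbhs x) _) (@root4_continuous R t)).
have cx : q.2 @[q --> (t, x)] --> x by exact: cvg_snd.
apply: (@cvgM _ _ (nbhs (t, x))).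
  exact: (cvg_comp (fun q : R * 'rV[R]_N => root4 q.1) (fun y => y `^ (- beta)) cr
    (@powR_cvg (- beta) (root4 t) r0)).
have cS : (root4 q.1)^-1 *: q.2 @[q --> (t, x)] --> (root4 t)^-1 *: x.
  apply: (@cvgZ _ _ _ (nbhs (t, x))) => //.
  by apply: (@cvgV _ _ (nbhs (t, x))) => //; rewrite gt_eqF.
exact: (cvg_comp _ _ cS (@heat_phi_continuous R N beta N0 b0 bN _)).
Qed.

End linear_solution.

(** * Choice of eps and conclusion *)

Lemma near_powR_le (R : realType) (q A B : R) : 0 < q -> 0 <= A -> 0 < B ->
  \forall eps \near 0^'+, A * eps `^ q <= B.
Proof.
move=> q0 A0 B0; have c : A * eps `^ q @[eps --> 0^'+] --> A * 0.
  by apply: cvgM; [exact: cvg_cst|exact: powR_cvg0].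
by apply: (cvgr_le _ c); rewrite mulr0.
Qed.

Theorem theorem1p3 (R : realType) (N : nat) (p : R) :
  (1 <= N)%N -> 1 + 4 / N%:R < p ->
  let beta := 4 / (p - 1) in
  let phi := @radial_power R N beta in
  (forall (x : 'rV[R]_N) (t : R), 0 < t -> 0 < semigroup t phi x) ->
  exists2 M : R, 0 < M &
    \forall eps \near 0^'+, exists2 u : R -> 'rV[R]_N -> R,
      global_solution p eps phi u &
      forall (x : 'rV[R]_N) (t : R), 0 < t ->
        eps * M / (enorm x `^ beta + t `^ (beta / 4)) <= u t x.
Proof.
move=> N0 pN beta phi pos.
have Nn0 : 0 < N%:R :> R by rewrite ltr0n.
have N4 : 0 < 4 / N%:R :> R by rewrite divr_gt0.
have p1 : 1 < p by lra.
have q0 : 0 < p - 1 by rewrite subr_gt0.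
have b0 : 0 < beta by rewrite divr_gt0.
have bp : beta * (p - 1) = 4 by rewrite divfK// gt_eqF.
have bN : beta < N%:R.
  rewrite ltr_pdivrMr// mulrC -ltr_pdivrMr//; lra.
have [D D0 [GD _]] := heat_kernel_weight (R := R) N0.
have [C C0 DC] := duhamel_bound N0 b0 bN D0 (@measurable_heat_kernel1 R N) GD.
have [K K0 lK] := linear_solution_bound N0 b0 bN.
have [c c0 lc] := linear_solution_lower N0 b0 bN pos.
have K3 : 0 <= 3 * K by rewrite mulr_ge0.
(* [c] was obtained before eps, from N and p alone; the other half of it absorbs the Duhamel
   term. *)
exists (c / 2); first by rewrite divr_gt0.
have A1 : 0 <= 2 * p * (3 * K) `^ (p - 1) * C.
  by rewrite !mulr_ge0 ?powR_ge0// ltW// (lt_trans ltr01).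
have A2 : 0 <= C * (3 * K) `^ p by rewrite mulr_ge0 ?powR_ge0.
(* Both conditions bound a multiple of eps^(p-1): the first makes the iteration a contraction with
   factor 1/2, the second makes C (3 K eps)^p at most eps c/2. *)
have n1 := near_powR_le q0 A1 (_ : 0 < 2^-1).
have n2 := near_powR_le q0 A2 (divr_gt0 c0 (ltr0n R 2)).
have n3 : \forall eps \near (0 : R)^'+, 0 < eps by exact: nbhs_right_gt.
have half0 : 0 < 2^-1 :> R by rewrite invr_gt0.
apply: filterS (filterI n3 (filterI (n1 half0) n2)) => eps [e0 [s1 s2]].
pose v t (x : 'rV[R]_N) := eps * linear_solution beta t x.
have vc : jcont v.
  move=> t x t0; apply: (@cvgM _ _ (nbhs (t, x))); first exact: (@cvg_cst _ _ _ (nbhs (t, x))).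
  exact: (linear_solution_jcont N0 b0 bN).
have vK : pbound (eps * K) beta v.
  move=> t x t0; rewrite /v normrM (gtr0_norm e0) -mulrA.
  by apply: (ler_wpM2l (ltW e0)); exact: lK.
have eK0 : 0 <= eps * K by rewrite mulr_ge0// ltW.
have E3 : 3 * (eps * K) = 3 * K * eps by ring.
have small : 2 * p * (3 * (eps * K)) `^ (p - 1) * C <= 2^-1.
  by apply: le_trans s1; rewrite E3 powRM ?(ltW e0)// le_eqVlt; apply/orP; left; apply/eqP; ring.
have [u [uc uK uE]] := picard_fixpoint p1 bp b0 C0 DC eK0 vc vK small.
have M0 : 0 <= 3 * (eps * K) by rewrite mulr_ge0.
have P0 : 0 <= (3 * (eps * K)) `^ p by exact: powR_ge0.
have [_ uD ui uj] := DC _ _ P0 (jcont_power p1 uc) (pbound_power p1 bp M0 uK).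
(* Identifies the rescaled convolution of the Picard scheme with S(t - s), by [semigroupE] and the
   slice integrability [uj]. *)
have SE t x s : 0 < s < t -> semigroup (t - s) (power_nonlinearity p \o u s) x =
    heat_conv (fun z => heat_kernel z 1) (fun s => power_nonlinearity p \o u s) x (root4 (t - s)) s.
  move=> st; have ts : 0 < t - s by case/andP: st => _; rewrite subr_gt0.
  rewrite -[in LHS](root4K (ltW ts)); apply: semigroupE; first exact: root4_gt0.
  exact: uj.
exists u; last first.
  move=> x t t0; rewrite (uE t x t0).
  have w0 := powR_ge0 (pnorm x t) (- beta).
  have P1 := pnorm_gt0 x t0.
  have low := lc t x t0; have dlow := uD t x t0.
  (* A maximum is at most the sum, and the sup norm is at most the Euclidean norm. *)
  have wlow : (enorm x `^ beta + t `^ (beta / 4))^-1 <= pnorm x t `^ (- beta).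
    rewrite powRN lef_pV2 ?posrE ?powR_gt0//; last by rewrite ltr_wpDl ?powR_ge0 ?powR_gt0.
    rewrite -root4_powR ?(ltW t0)// /pnorm; case: (leP `|x| (root4 t)) => _.
      by rewrite lerDr powR_ge0.
    apply: (@le_trans _ _ (enorm x `^ beta)); last by rewrite lerDl powR_ge0.
    by rewrite ge0_ler_powR ?nnegrE ?(ltW b0) ?norm_le_enorm// enorm_ge0.
  apply: (@le_trans _ _ (eps * (c / 2) * pnorm x t `^ (- beta))).
    by apply: ler_wpM2l => //; rewrite mulr_ge0 ?(ltW e0)// divr_ge0// ltW.
  have dl : - (eps * (c / 2) * pnorm x t `^ (- beta)) <=
      duhamel (fun z => heat_kernel z 1) (fun s => power_nonlinearity p \o u s) t x.
    have := ler_norm (- duhamel (fun z => heat_kernel z 1) (fun s => power_nonlinearity p \o u s) t x).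
    rewrite normrN lerNl => /le_trans; apply; apply: (le_trans dlow).
    apply: ler_wpM2r => //; rewrite E3 powRM ?(ltW e0)//.
    have -> : eps `^ p = eps * eps `^ (p - 1).
      by rewrite mulr_powRB1 ?(ltW e0)// (lt_trans ltr01).
    have -> : C * ((3 * K) `^ p * (eps * eps `^ (p - 1))) = eps * (C * (3 * K) `^ p * eps `^ (p - 1)) by ring.
    exact: ler_wpM2l (ltW e0) _ _ s2.
  have vl : eps * (c * pnorm x t `^ (- beta)) <= v t x by exact: ler_wpM2l (ltW e0) _ _ low.
  move: (duhamel _ _ t x) (v t x) (pnorm x t `^ _) vl dl => d y w vl dl.
  nra.
split.
- by move=> t t0; exact: (pbound_BC b0 M0 uc uK t0).
- exact: (pbound_continuous b0 M0 uc uK).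
- move=> x t t0; have := ui t x t0; apply: eq_integrable; first exact: measurable_itv.
  by move=> s; rewrite inE/= in_itv/= => st; rewrite SE.
- move=> x t t0; rewrite (uE t x t0) (semigroup_linear N0 b0 bN x t0); congr (_ + _).
  by apply: eq_Rintegral => s; rewrite inE/= in_itv/= => st; rewrite SE.
Qed.
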